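(* Let $A:\mathcal{G}_{\tau,\mathcal{S}}(\mathbb{R}^n)\to\mathcal{G}_{\tau,\mathcal{S}}(\mathbb{R}^n)$ be a linear map. Then $A$ is an operator with $\mathcal{S}$-regular kernel if and only if $A$ is a pseudo-differential operator with smoothing symbol, i.e. if and only if there is $(a_\epsilon)_\epsilon\in\mathcal{S}^{-\infty}$ such that for every $u\in\mathcal{G}_{\tau,\mathcal{S}}(\mathbb{R}^n)$ with representative $(u_\epsilon)_\epsilon$, $Au$ has the representative $$A_\epsilon u_\epsilon(x)=(2\pi)^{-n}\int_{\mathbb{R}^{2n}}e^{i(x-y)\xi}a_\epsilon(x,\xi)u_\epsilon(y)\widehat{\varphi_\epsilon}(y)\,dy\,d\xi .$$
   Context: Notation: $\langle x\rangle=(1+|x|^2)^{1/2}$, $\hat f(\xi)=\int e^{-ix\xi}f(x)\,dx$. $f(z)\prec g(z)$ on a set means $f\le c\,g$ there with a constant $c>0$ independent of $z$; $f\sim g$ means both $f\prec g$ and $g\prec f$. $\mathcal{E}[\mathbb{R}^p]$ is the algebra of all nets $(u_\epsilon)_{\epsilon\in(0,1]}$ with $u_\epsilon\in\mathcal{C}^\infty(\mathbb{R}^p)$. For $p\ge1$: $\mathcal{E}_\tau(\mathbb{R}^p)$ is the set of $(u_\epsilon)_\epsilon\in\mathcal{E}[\mathbb{R}^p]$ such that for all $\alpha$ there is $N\in\mathbb{N}$ with $\sup_\epsilon\epsilon^N\|\langle x\rangle^{-N}\partial^\alpha u_\epsilon\|_{L^\infty}<\infty$; $\mathcal{N}_{\mathcal{S}}(\mathbb{R}^p)$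 is the set of those such that for all $\alpha,\beta$ and all $q\in\mathbb{N}$, $\sup_\epsilon\epsilon^{-q}\|x^\alpha\partial^\beta u_\epsilon\|_{L^\infty}<\infty$; $\mathcal{E}^\infty_{\mathcal{S}}(\mathbb{R}^p)$ is the set of those for which there is $N\in\mathbb{N}$ such that for all $\alpha,\beta$, $\sup_\epsilon\epsilon^{N}\|x^\alpha\partial^\beta u_\epsilon\|_{L^\infty}<\infty$. $\mathcal{G}_{\tau,\mathcal{S}}(\mathbb{R}^p)=\mathcal{E}_\tau(\mathbb{R}^p)/\mathcal{N}_{\mathcal{S}}(\mathbb{R}^p)$, $\mathcal{G}^\infty_{\mathcal{S}}(\mathbb{R}^p)=\mathcal{E}^\infty_{\mathcal{S}}(\mathbb{R}^p)/\mathcal{N}_{\mathcal{S}}(\mathbb{R}^p)$. Mollifier: $\varphi\in\mathcal{S}(\mathbb{R}^n)$ is fixed with $\int\varphi\,dx=1$ and $\int x^\alpha\varphi\,dx=0$ for all $\alpha\neq0$; $\varphi_\epsilon(x)=\epsilon^{-n}\varphi(x/\epsilon)$, so $\widehat{\varphi_\epsilon}(y)=\hat\varphi(\epsilon y)$. Operator with $\mathcal{S}$-regular kernel: a linear map $A$ on $\mathcal{G}_{\tau,\mathcal{S}}(\mathbb{R}^n)$ for which there is $k_A\in\mathcal{G}^\infty_{\mathcal{S}}(\mathbb{R}^{2n})$, with representative $(k_{A,\epsilon})_\epsilon$, such that for all $u$, $Au=\int_{\mathbb{R}^n}k_A(\cdot,y)u(y)\,dy$, where the right-hand side is by definition the (well-defined)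 generalized function with representative $\big(\int_{\mathbb{R}^n}k_{A,\epsilon}(x,y)u_\epsilon(y)\widehat{\varphi_\epsilon}(y)\,dy\big)_\epsilon$. Weight function: a continuous real function $\Lambda$ on $\mathbb{R}^{2n}$ such that (i) there is $\mu>0$ with $\langle z\rangle^\mu\prec\Lambda(z)\prec\langle z\rangle$; (ii) $\Lambda(z)\sim\Lambda(\zeta)$ on $\{|\zeta-z|\le\mu\Lambda(z)\}$; (iii) for all $t\in\mathbb{R}^{2n}$, $\Lambda(t_1z_1,\dots,t_{2n}z_{2n})\prec\Lambda(z)$. Smoothing symbols: for a weight function $\Lambda$, $m\in\mathbb{R}$, $\rho\in(0,1]$, $N\in\mathbb{N}$, $\mathcal{S}^m_{\Lambda,\rho,N}$ is the set of $(a_\epsilon)_\epsilon\in\mathcal{E}[\mathbb{R}^{2n}]$ such that for all $\alpha\in\mathbb{N}^{2n}$ there is $c>0$ with $|\partial^\alpha a_\epsilon(z)|\le c\Lambda(z)^{m-\rho|\alpha|}\epsilon^{-N}$ for all $\epsilon\in(0,1]$, $z=(x,\xi)\in\mathbb{R}^{2n}$. $\mathcal{S}^{-\infty}=\bigcup_{N\in\mathbb{N}}\bigcap_{m\in\mathbb{R}}\mathcal{S}^m_{\Lambda,\rho,N}$; this set does not depend on the choice of $\Lambda$ and $\rho$. *)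

(* Defs.v *)
From HB Require Import structures.
From mathcomp Require Import all_boot all_order all_algebra.
From mathcomp Require Import generic_quotient ring_quotient complex.
From mathcomp Require Import all_classical all_reals all_analysis.

Set Implicit Arguments.
Unset Strict Implicit.
Unset Printing Implicit Defensive.

Import Order.TTheory GRing.Theory Num.Theory.
Import numFieldNormedType.Exports.
Import Normc.

Local Open Scope classical_set_scope.
Local Open Scope quotient_scope.
Local Open Scope complex_scope.
Local Open Scope ring_scope.

(* E / (E n N) for submodules E and N of V; in the uses below N is contained *)
(* in E. *)

Section SubmoduleQuotient.
Variables (K : pzRingType) (V : lmodType K).

Section Sub.
Variable E : submodClosed V.

Record subm := Subm { subm_val :> V; _ : subm_val \in E }.

HB.instance Definition _ := [isSub for subm_val].
HB.instance Definition _ := [Choice of subm by <:].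
HB.instance Definition _ := [SubChoice_isSubLmodule of subm by <:].

End Sub.

Section Quot.
Variables E N : submodClosed V.

Definition trace_pred : {pred subm E} := [pred v : subm E | val v \in N].

Lemma trace_submod_closed : submod_closed trace_pred.
Proof.
split=> [|a u v]; rewrite !inE ?raddf0 ?rpred0// => uN vN.
by rewrite linearD linearZ rpredD// rpredZ.
Qed.

HB.instance Definition _ :=
  GRing.isSubmodClosed.Build K (subm E) trace_pred trace_submod_closed.

Definition subquot := Quotient.quot trace_pred.

HB.instance Definition _ := GRing.Zmodule.on subquot.
HB.instance Definition _ := EqQuotient.on subquot.

Definition subquot_scale (a : K) (x : subquot) : subquot :=
  \pi_subquot (a *: repr x).

Lemma subquot_eqP (u v : subm E) :
  (\pi_subquot u = \pi_subquot v) <-> (u - v \in trace_pred).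
Proof.
by rewrite (Quotient.idealrBE trace_pred); split=> [->|/eqP].
Qed.

Lemma subquot_piD (u v : subm E) :
  \pi_subquot (u + v) = \pi_subquot u + \pi_subquot v.
Proof. exact: (raddfD (\pi_(Quotient.quot trace_pred))). Qed.

Lemma subquot_piZ a (u : subm E) :
  subquot_scale a (\pi_subquot u) = \pi_subquot (a *: u).
Proof.
apply/subquot_eqP; rewrite -scalerBr; apply: rpredZ.
exact: (subquot_eqP _ _).1 (reprK _).
Qed.

Lemma subquot_scaleA a b x :
  subquot_scale a (subquot_scale b x) = subquot_scale (a * b) x.
Proof. by elim/quotW: x => x; rewrite (subquot_piZ b) !subquot_piZ scalerA. Qed.

Lemma subquot_scale1 : left_id 1 subquot_scale.
Proof. by elim/quotW => x; rewrite subquot_piZ scale1r. Qed.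

Lemma subquot_scaleDr : right_distributive subquot_scale +%R.
Proof.
move=> a; elim/quotW => x; elim/quotW => y.
by rewrite -subquot_piD !subquot_piZ scalerDr subquot_piD.
Qed.

Lemma subquot_scaleDl x :
  {morph subquot_scale^~ x : a b / a + b}.
Proof.
move=> a b; elim/quotW: x => x.
by rewrite !subquot_piZ scalerDl subquot_piD.
Qed.

HB.instance Definition _ := GRing.Zmodule_isLmodule.Build K subquot
  subquot_scaleA subquot_scale1 subquot_scaleDr subquot_scaleDl.

Definition represents (u : V) (U : subquot) : Prop :=
  exists2 v : subm E, val v = u & \pi_subquot v = U.

End Quot.
End SubmoduleQuotient.

(* Lebesgue measure on R^n, as an iterated product measure on n-tuples; this *)
(* is where the library puts the product sigma-algebra. *)

Lemma product_sigma_finite d1 d2 (T1 : measurableType d1)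
    (T2 : measurableType d2) (R : realType)
    (m1 : {sigma_finite_measure set T1 -> \bar R})
    (m2 : {sigma_finite_measure set T2 -> \bar R}) :
  sigma_finite setT (m1 \x m2)%E.
Proof.
have /sigma_finiteP[F [TF ndF Foo]] := sigma_finiteT m1.
have /sigma_finiteP[G [TG ndG Goo]] := sigma_finiteT m2.
exists (fun n => F n `*` G n).
  rewrite -setXTT TF TG predeqE => -[x y]; split.
    move=> [/= [n _ Fnx] [k _ Gky]]; exists (maxn n k) => //; split.
    - by move: x Fnx; exact/subsetPset/ndF/leq_maxl.
    - by move: y Gky; exact/subsetPset/ndG/leq_maxr.
  by move=> [n _ []/= ? ?]; split; exists n.
move=> k; have [? ?] := Foo k; have [? ?] := Goo k.
split; first exact: measurableX.
by rewrite product_measure1E// lte_mul_pinfty// ge0_fin_numE.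
Qed.

Section LebesgueTuple.
Variable R : realType.
Local Notation T := (measurableTypeR R).

Definition tuple_cons n (p : T * n.-tuple T) : n.+1.-tuple T :=
  [the n.+1.-tuple T of p.1 :: p.2].

Lemma measurable_tuple_cons n : measurable_fun setT (@tuple_cons n).
Proof. by apply: measurable_cons. Qed.

Section Step.
Variables (n : nat) (m : {sigma_finite_measure set (n.-tuple T) -> \bar R}).

Definition lebesgue_step : set (n.+1.-tuple T) -> \bar R :=
  pushforward (@lebesgue_measure R \x m)%E (@tuple_cons n).

Let lebesgue_step0 : lebesgue_step set0 = 0.
Proof. by rewrite /lebesgue_step /pushforward preimage_set0 measure0. Qed.

Let lebesgue_step_ge0 A : (0 <= lebesgue_step A)%E.
Proof. exact: (measure_ge0 (@lebesgue_measure R \x m)%E). Qed.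

Let lebesgue_step_sigma_additive : semi_sigma_additive lebesgue_step.
Proof.
have mf := @measurable_tuple_cons n.
apply: (@measure_semi_sigma_additive _ _ _
  (pushforward (@lebesgue_measure R \x m)%E (@tuple_cons n))).
exact: mf.
Qed.

HB.instance Definition _ := isMeasure.Build _ _ _ lebesgue_step
  lebesgue_step0 lebesgue_step_ge0 lebesgue_step_sigma_additive.

Lemma lebesgue_step_sigma_finite : sigma_finite setT lebesgue_step.
Proof.
have [F FT Ffin] : sigma_finite setT (@lebesgue_measure R \x m)%E.
  exact: (product_sigma_finite (@lebesgue_measure R) m).
pose g (t : n.+1.-tuple T) : T * n.-tuple T := (thead t, [tuple of behead t]).
have gK p : g (tuple_cons p) = p.
  by case: p => x t; congr pair; apply/val_inj.
exists (fun k => g @^-1` F k).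
  apply/seteqP; split=> // t _.
  by have [k _ Fk] : (\bigcup_k F k) (g t) by [rewrite -FT]; exists k.
move=> k; have [mF Foo] := Ffin k; split.
  rewrite -[X in measurable X]setTI; have mg : measurable_fun setT g.
    apply/measurable_fun_pairP; split.
      exact: (@measurable_tnth _ T n.+1 ord0).
    exact: (@measurable_behead _ T n).
  exact: mg.
rewrite /lebesgue_step /pushforward -comp_preimage.
by rewrite (_ : g \o @tuple_cons n = id)//; apply/funext => p; exact: gK.
Qed.

HB.instance Definition _ :=
  Measure_isSigmaFinite.Build _ _ _ lebesgue_step lebesgue_step_sigma_finite.

End Step.

Fixpoint lebesgue_tuple n : {sigma_finite_measure set (n.-tuple T) -> \bar R} :=
  if n is k.+1 then lebesgue_step (lebesgue_tuple k)
  else \d_([tuple] : 0.-tuple T).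

End LebesgueTuple.

Section Calculus.
Variable R : realType.
Local Notation C := R[i].
Local Notation T := (measurableTypeR R).


Definition cintegral d (X : measurableType d) (mu : {measure set X -> \bar R})
    (f : X -> C) : C :=
  Rintegral mu setT (fun x => complex.Re (f x))
  +i* Rintegral mu setT (fun x => complex.Im (f x)).

Definition row_of_tuple n (t : n.-tuple T) : 'rV[R]_n := \row_i tnth t i.

Definition integral_Rn n (f : 'rV[R]_n -> C) : C :=
  cintegral (lebesgue_tuple R n) (fun t => f (row_of_tuple t)).

Definition integral_RnRn n (f : 'rV[R]_n -> 'rV[R]_n -> C) : C :=
  cintegral (lebesgue_tuple R n \x lebesgue_tuple R n)%E
    (fun t => f (row_of_tuple t.1) (row_of_tuple t.2)).

Definition cis (t : R) : C := cos t +i* sin t.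

Section Dim.
Variable p : nat.
Implicit Types (x y z : 'rV[R]_p) (f : 'rV[R]_p -> C).

Definition dotrv x y : R := \sum_i x 0 i * y 0 i.

(* The norm `|x| of the library on row vectors is the sup norm. *)
Definition enorm x : R := Num.sqrt (\sum_i x 0 i ^+ 2).

Definition japanese x : R := Num.sqrt (1 + enorm x ^+ 2).

Definition multiindex := {ffun 'I_p -> nat}.

Definition order_mi (a : multiindex) : nat := (\sum_i a i)%N.

Definition monomial x (a : multiindex) : R := \prod_i x 0 i ^+ a i.

Definition partial (i : 'I_p) f : 'rV[R]_p -> C := fun x =>
  'D_(delta_mx 0 i) (fun y => complex.Re (f y)) x
  +i* 'D_(delta_mx 0 i) (fun y => complex.Im (f y)) x.

Definition partials (s : seq 'I_p) f : 'rV[R]_p -> C := foldr partial f s.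

(* For smooth f the order in which the derivatives are taken is immaterial. *)
Definition mderiv (a : multiindex) f : 'rV[R]_p -> C :=
  partials (flatten [seq nseq (a i) i | i <- enum 'I_p]) f.

Definition C1_fun f : Prop :=
  [/\ continuous (fun y => complex.Re (f y)),
      continuous (fun y => complex.Im (f y))
    & forall x i, derivable (fun y => complex.Re (f y)) x (delta_mx 0 i)
               /\ derivable (fun y => complex.Im (f y)) x (delta_mx 0 i)].

Definition smooth f : Prop := forall s, C1_fun (partials s f).

(* The L^oo norm; it is only used for continuous functions. *)
Definition supnorm f : \bar R := ereal_sup (range (fun x => (normc (f x))%:E)).

Definition schwartz f : Prop :=
  smooth f /\ forall a b : multiindex,
    (supnorm (fun x => (monomial x a)%:C * mderiv b f x)%R < +oo)%E.

End Dim.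
Arguments multiindex : clear implicits.

Definition fourier n (f : 'rV[R]_n -> C) (xi : 'rV[R]_n) : C :=
  integral_Rn (fun x => cis (- dotrv x xi) * f x).

End Calculus.
Arguments multiindex : clear implicits.

Section CalculusLemmas.
Variable R : realType.
Local Notation C := R[i].

Section Dim.
Variable p : nat.
Implicit Types (x y z : 'rV[R]_p) (f g : 'rV[R]_p -> C).

Lemma ReZD a (f g : 'rV[R]_p -> C) : (fun y => complex.Re ((a *: f + g) y)) =
  (complex.Re a \*: (fun y => complex.Re (f y)))
  + ((- complex.Im a) \*: (fun y => complex.Im (f y)))
  + (fun y => complex.Re (g y)).
Proof.
apply/funext => y; rewrite !fctE/=.
case: a (f y) (g y) => [a1 a2] [f1 f2] [g1 g2] /=.
by rewrite scaleNr.
Qed.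

Lemma ImZD a (f g : 'rV[R]_p -> C) : (fun y => complex.Im ((a *: f + g) y)) =
  (complex.Re a \*: (fun y => complex.Im (f y)))
  + (complex.Im a \*: (fun y => complex.Re (f y)))
  + (fun y => complex.Im (g y)).
Proof.
apply/funext => y; rewrite !fctE/=.
by case: a (f y) (g y) => [a1 a2] [f1 f2] [g1 g2].
Qed.

Lemma C1_funZD a f g : C1_fun f -> C1_fun g -> C1_fun (a *: f + g).
Proof.
move=> [fR fI fD] [gR gI gD]; split.
- rewrite ReZD => y; apply: (continuousD _ (gR y)).
  apply: continuousD; apply: continuousZl_tmp; [exact: fR|exact: fI].
- rewrite ImZD => y; apply: (continuousD _ (gI y)).
  apply: continuousD; apply: continuousZl_tmp; [exact: fI|exact: fR].
- move=> x i; have [fR1 fI1] := fD x i; have [gR1 gI1] := gD x i.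
  rewrite ReZD ImZD; split.
  + by apply: derivableD gR1; apply: derivableD; exact: derivableZ.
  + by apply: derivableD gI1; apply: derivableD; exact: derivableZ.
Qed.

Lemma partialZD i a f g : C1_fun f -> C1_fun g ->
  partial i (a *: f + g) = a *: partial i f + partial i g.
Proof.
move=> [fR fI fD] [gR gI gD]; apply/funext => x.
have [fR1 fI1] := fD x i; have [gR1 gI1] := gD x i.
have dZ k (h : 'rV[R]_p -> R) v : derivable h x v -> derivable (k \*: h) x v.
  exact: derivableZ.
rewrite /partial ReZD ImZD.
have dR := derivableD (dZ (complex.Re a) _ _ fR1) (dZ (- complex.Im a) _ _ fI1).
have dI := derivableD (dZ (complex.Re a) _ _ fI1) (dZ (complex.Im a) _ _ fR1).
rewrite (deriveD dR gR1) (deriveD dI gI1).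
rewrite (deriveD (dZ _ _ _ fR1) (dZ _ _ _ fI1)).
rewrite (deriveD (dZ _ _ _ fI1) (dZ _ _ _ fR1)).
rewrite !(deriveZ _ fR1) !(deriveZ _ fI1) !fctE/=.
case: (a) => a1 a2 /=.
by rewrite scaleNr.
Qed.

Lemma partialsZD s a f g : smooth f -> smooth g ->
  partials s (a *: f + g) = a *: partials s f + partials s g.
Proof.
move=> sf sg; elim: s => //= i s IH; rewrite -/(partials _ _) IH.
exact: partialZD.
Qed.

Lemma smoothZD a f g : smooth f -> smooth g -> smooth (a *: f + g).
Proof. by move=> sf sg s; rewrite partialsZD//; exact: C1_funZD. Qed.

Lemma partials0 s : partials s (0 : 'rV[R]_p -> C) = 0.
Proof.
elim: s => //= i s IH; rewrite -/(partials _ _) IH; apply/funext => x.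
by rewrite /partial /= !derive_cst.
Qed.

Lemma smooth0 : smooth (0 : 'rV[R]_p -> C).
Proof.
move=> s; rewrite partials0; split; [exact: cst_continuous..|].
by move=> x i; split; exact: derivable_cst.
Qed.

End Dim.
End CalculusLemmas.

Section Nets.
Variable R : realType.
Local Notation C := R[i].

Definition eps01 : Type := {e : R | 0 < e <= 1}.

Definition net (p : nat) : Type := eps01 -> 'rV[R]_p -> C.

Section Dim.
Variable p : nat.
Implicit Types u v : net p.

Definition smooth_net u : Prop := forall e, smooth (u e).

Definition sup_finite (w : eps01 -> R) (f : net p) : Prop :=
  (ereal_sup (range (fun e => (w e)%:E * supnorm (f e))) < +oo)%E.

Definition moderate_tau u : Prop :=
  smooth_net u /\ forall a : multiindex p, exists N : nat,
    sup_finite (fun e => sval e ^+ N)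
      (fun e x => (japanese x ^- N)%:C * mderiv a (u e) x).

Definition negligible_S u : Prop :=
  smooth_net u /\ forall (a b : multiindex p) (q : nat),
    sup_finite (fun e => sval e ^- q)
      (fun e x => (monomial x a)%:C * mderiv b (u e) x).

Definition regular_S u : Prop :=
  smooth_net u /\ exists N : nat, forall a b : multiindex p,
    sup_finite (fun e => sval e ^+ N)
      (fun e x => (monomial x a)%:C * mderiv b (u e) x).

Lemma sup_finiteP (w : eps01 -> R) (f : net p) : (forall e, 0 < w e) ->
  sup_finite w f <-> exists M, forall e x, w e * normc (f e x) <= M.
Proof.
move=> w0; split.
- move=> h; pose S := ereal_sup (range (fun e => ((w e)%:E * supnorm (f e))%E)).
  have hS e x : ((w e * normc (f e x))%:E <= S)%E.
    apply: (@le_trans _ _ ((w e)%:E * supnorm (f e))%E).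
      rewrite EFinM lee_pmul2l ?lte_fin//.
      by apply: ereal_sup_ubound; exists x.
    by apply: ereal_sup_ubound; exists e.
  have e1 : 0 < (1 : R) <= 1 by rewrite ltr01 lexx.
  have Sfin : S \is a fin_num.
    rewrite fin_numE gt_eqF ?lt_eqF//.
    by apply: lt_le_trans (hS (exist _ 1 e1) 0); rewrite ltNyr.
  by exists (fine S) => e x; rewrite -lee_fin fineK.
- move=> [M hM]; apply: (@le_lt_trans _ _ M%:E); last by rewrite ltry.
  apply: ge_ereal_sup => _ [e _ <-].
  rewrite -lee_pdivlMl ?lte_fin//.
  apply: ge_ereal_sup => _ [x _ <-].
  by rewrite -EFinM lee_fin mulrC ler_pdivlMr// mulrC.
Qed.

Lemma japanese_ge1 (x : 'rV[R]_p) : 1 <= japanese x.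
Proof.
by rewrite /japanese -[leLHS]sqrtr1 ler_wsqrtr// lerDl sqr_ge0.
Qed.

Lemma normcC (r : R) : 0 <= r -> normc r%:C = r.
Proof. by move=> r0; rewrite /normc/= expr0n addr0 sqrtr_sqr ger0_norm. Qed.

Lemma eps_pow_gt0 N (e : eps01) : 0 < sval e ^+ N.
Proof. by case: e => e /= /andP[e0 _]; rewrite exprn_gt0. Qed.

Lemma eps_powN_gt0 N (e : eps01) : 0 < sval e ^- N.
Proof. by rewrite invr_gt0 eps_pow_gt0. Qed.

Lemma mderivZD (b : multiindex p) (c : C) (f g : 'rV[R]_p -> C) x :
  smooth f -> smooth g ->
  mderiv b (c *: f + g) x = c * mderiv b f x + mderiv b g x.
Proof. by move=> sf sg; rewrite /mderiv partialsZD. Qed.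

Lemma mderiv0 (b : multiindex p) (x : 'rV[R]_p) :
  mderiv b (0 : 'rV[R]_p -> C) x = 0.
Proof. by rewrite /mderiv partials0. Qed.

Lemma sup_finiteZD (b : multiindex p) (c : C) u v (w w1 w2 : eps01 -> R)
    (k k1 k2 : 'rV[R]_p -> C) :
  smooth_net u -> smooth_net v ->
  (forall e, 0 < w e) -> (forall e, 0 < w1 e) -> (forall e, 0 < w2 e) ->
  (forall e, w e <= w1 e) -> (forall e, w e <= w2 e) ->
  (forall x, normc (k x) <= normc (k1 x)) ->
  (forall x, normc (k x) <= normc (k2 x)) ->
  sup_finite w1 (fun e x => k1 x * mderiv b (u e) x) ->
  sup_finite w2 (fun e x => k2 x * mderiv b (v e) x) ->
  sup_finite w (fun e x => k x * mderiv b ((c *: u + v) e) x).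
Proof.
move=> su sv w0 w10 w20 ww1 ww2 kk1 kk2.
move=> /(sup_finiteP _ w10)[M1 h1] /(sup_finiteP _ w20)[M2 h2].
apply/(sup_finiteP _ w0); exists (normc c * M1 + M2) => e x.
have nc0 (z : C) : 0 <= normc z by case: z => ? ?; exact: sqrtr_ge0.
rewrite (_ : (c *: u + v) e = c *: u e + v e)//.
rewrite (mderivZD _ _ _ (su e) (sv e)) mulrDr.
apply: (@le_trans _ _ (w e * (normc (k x * (c * mderiv b (u e) x)) +
                              normc (k x * mderiv b (v e) x)))).
  by apply: ler_wpM2l; [exact: ltW|exact: le_normcD].
rewrite mulrDr; apply: lerD.
  rewrite (mulrCA (k x)) normcM mulrCA ler_wpM2l//.
  apply: le_trans (h1 e x); rewrite !normcM.
  apply: ler_pM => //; first exact: ltW.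
    by rewrite mulr_ge0.
  by rewrite ler_wpM2r.
apply: le_trans (h2 e x); rewrite !normcM.
apply: ler_pM => //; first exact: ltW.
  by rewrite mulr_ge0.
by rewrite ler_wpM2r.
Qed.

Lemma sup_finite0 (b : multiindex p) (w : eps01 -> R) (k : 'rV[R]_p -> C) :
  (forall e, 0 < w e) ->
  sup_finite w (fun e x => k x * mderiv b ((0 : net p) e) x).
Proof.
move=> w0; apply/(sup_finiteP _ w0); exists 0 => e x.
by rewrite (mderiv0 b x) mulr0 normc0 mulr0.
Qed.

Lemma smooth_netZD (c : C) u v :
  smooth_net u -> smooth_net v -> smooth_net (c *: u + v).
Proof. by move=> su sv e; exact: smoothZD. Qed.

Lemma smooth_net0 : smooth_net 0.
Proof. by move=> e; exact: smooth0. Qed.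

Definition moderate_tau_pred : {pred net p} := fun u => `[< moderate_tau u >].
Definition negligible_S_pred : {pred net p} := fun u => `[< negligible_S u >].
Definition regular_S_pred : {pred net p} := fun u => `[< regular_S u >].

Lemma moderate_tau_submod : submod_closed moderate_tau_pred.
Proof.
split=> [|c u v /asboolP[su hu] /asboolP[sv hv]]; apply/asboolP; split.
- exact: smooth_net0.
- by move=> a; exists 0%N; apply: sup_finite0 => e; exact: eps_pow_gt0.
- exact: smooth_netZD.
- move=> a; have [N1 h1] := hu a; have [N2 h2] := hv a; exists (N1 + N2)%N.
  have jN (x : 'rV[R]_p) N N' : (N <= N')%N ->
      normc (japanese x ^- N')%:C <= normc (japanese x ^- N)%:C.
    have j0 : 0 < japanese x by apply: lt_le_trans (japanese_ge1 x).
    have jM M : 0 <= japanese x ^- M by rewrite invr_ge0 exprn_ge0// ltW.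
    move=> NN'; rewrite (normcC (jM N)) (normcC (jM N')).
    by rewrite lef_pV2 ?posrE ?exprn_gt0// ler_weXn2l// japanese_ge1.
  have eN (e : eps01) N N' : (N <= N')%N -> sval e ^+ N' <= sval e ^+ N.
    case: e => e /= /andP[e0 e1] NN'.
    by rewrite ler_wiXn2l// ltW.
  apply: (sup_finiteZD _ su sv _ _ _ _ _ _ _ h1 h2) => [e|e|e|e|e|x|x];
    by [exact: eps_pow_gt0|exact/eN/leq_addr|exact/eN/leq_addl
       |exact/jN/leq_addr|exact/jN/leq_addl].
Qed.

Lemma negligible_S_submod : submod_closed negligible_S_pred.
Proof.
split=> [|c u v /asboolP[su hu] /asboolP[sv hv]]; apply/asboolP; split.
- exact: smooth_net0.
- by move=> a b q; apply: sup_finite0 => e; exact: eps_powN_gt0.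
- exact: smooth_netZD.
- move=> a b q; have h1 := hu a b q; have h2 := hv a b q.
  by apply: (sup_finiteZD _ su sv _ _ _ _ _ _ _ h1 h2) => // e;
    exact: eps_powN_gt0.
Qed.

Lemma regular_S_submod : submod_closed regular_S_pred.
Proof.
split=> [|c u v /asboolP[su [N1 hu]] /asboolP[sv [N2 hv]]]; apply/asboolP;
  split.
- exact: smooth_net0.
- by exists 0%N => a b; apply: sup_finite0 => e; exact: eps_pow_gt0.
- exact: smooth_netZD.
- exists (N1 + N2)%N => a b; have h1 := hu a b; have h2 := hv a b.
  have eN (e : eps01) N N' : (N <= N')%N -> sval e ^+ N' <= sval e ^+ N.
    case: e => e /= /andP[e0 e1] NN'.
    by rewrite ler_wiXn2l// ltW.
  by apply: (sup_finiteZD _ su sv _ _ _ _ _ _ _ h1 h2) => // e;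
    [exact: eps_pow_gt0..|exact/eN/leq_addr|exact/eN/leq_addl].
Qed.

HB.instance Definition _ := GRing.isSubmodClosed.Build C (net p)
  moderate_tau_pred moderate_tau_submod.
HB.instance Definition _ := GRing.isSubmodClosed.Build C (net p)
  negligible_S_pred negligible_S_submod.
HB.instance Definition _ := GRing.isSubmodClosed.Build C (net p)
  regular_S_pred regular_S_submod.

End Dim.
End Nets.

Section GeneralizedFunctions.
Variable R : realType.
Local Notation C := R[i].

Definition G_tauS (p : nat) : lmodType C :=
  subquot (@moderate_tau_pred R p) (@negligible_S_pred R p).

Definition Ginf_S (p : nat) : lmodType C :=
  subquot (@regular_S_pred R p) (@negligible_S_pred R p).

Definition rep_tauS p (u : net R p) (U : G_tauS p) : Prop :=
  @represents _ _ (@moderate_tau_pred R p) (@negligible_S_pred R p) u U.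

Definition repinf_S p (u : net R p) (U : Ginf_S p) : Prop :=
  @represents _ _ (@regular_S_pred R p) (@negligible_S_pred R p) u U.

Definition mollifier n (phi : 'rV[R]_n -> C) : Prop :=
  [/\ schwartz phi,
      integral_Rn phi = 1
    & forall a : multiindex n, a != [ffun=> 0%N] ->
        integral_Rn (fun x => (monomial x a)%:C * phi x) = 0].

Definition mollify n (phi : 'rV[R]_n -> C) (e : eps01 R) : 'rV[R]_n -> C :=
  fun x => (sval e ^- n)%:C * phi ((sval e)^-1 *: x).

(* Elements of R^2n are written as row_mx x y with x, y in R^n. *)

Definition kernel_net n (phi : 'rV[R]_n -> C) (k : net R (n + n))
    (u : net R n) : net R n := fun e x =>
  integral_Rn (fun y =>
    k e (row_mx x y) * u e y * fourier (mollify phi e) y).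

(* The class of kernel_net phi k u does not depend on the representatives, and *)
(* the quantification over all of them, below and in psdo_smoothing, records *)
(* this. *)
Definition S_regular_kernel n (phi : 'rV[R]_n -> C)
    (A : G_tauS n -> G_tauS n) : Prop :=
  exists kA : Ginf_S (n + n), forall k : net R (n + n), repinf_S k kA ->
    forall (U : G_tauS n) (u : net R n), rep_tauS u U ->
      rep_tauS (kernel_net phi k u) (A U).

Definition prec (X : Type) (D : set X) (f g : X -> R) : Prop :=
  exists2 c, 0 < c & forall z, D z -> f z <= c * g z.

Definition sim (X : Type) (D : set X) (f g : X -> R) : Prop :=
  prec D f g /\ prec D g f.

Definition weight_function p (Lambda : 'rV[R]_p -> R) : Prop :=
  [/\ continuous Lambda,
      exists mu : R,
        [/\ 0 < mu,
            prec setT (fun z => japanese z `^ mu) Lambda,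
            prec setT Lambda (@japanese R p)
          & sim [set w : 'rV[R]_p * 'rV[R]_p |
                  enorm (w.2 - w.1) <= mu * Lambda w.1]
                (fun w => Lambda w.1) (fun w => Lambda w.2)]
    & forall t : 'rV[R]_p,
        prec setT (fun z : 'rV[R]_p => Lambda (\row_i (t 0 i * z 0 i))) Lambda].

Definition symbol p (Lambda : 'rV[R]_p -> R) (m rho : R) (N : nat)
    (a : net R p) : Prop :=
  smooth_net a /\ forall al : multiindex p, exists2 c : R, 0 < c &
    forall (e : eps01 R) (z : 'rV[R]_p),
      normc (mderiv al (a e) z) <=
        c * Lambda z `^ (m - rho * (order_mi al)%:R) * sval e ^- N.

Definition smoothing_symbol p (Lambda : 'rV[R]_p -> R) (rho : R)
    (a : net R p) : Prop :=
  exists N : nat, forall m : R, symbol Lambda m rho N a.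

Definition psdo_net n (phi : 'rV[R]_n -> C) (a : net R (n + n))
    (u : net R n) : net R n := fun e x =>
  ((2 * pi) ^- n)%:C *
  integral_RnRn (fun y xi =>
    cis (dotrv (x - y) xi) * a e (row_mx x xi) * u e y
    * fourier (mollify phi e) y).

Definition psdo_smoothing n (phi : 'rV[R]_n -> C)
    (Lambda : 'rV[R]_(n + n) -> R) (rho : R)
    (A : G_tauS n -> G_tauS n) : Prop :=
  exists a : net R (n + n), smoothing_symbol Lambda rho a /\
    forall (U : G_tauS n) (u : net R n), rep_tauS u U ->
      rep_tauS (psdo_net phi a u) (A U).

End GeneralizedFunctions.

(* Main.v *)
(* Up to the cut-off by the Fourier transform of phi_e, a pseudo-differential  *)
(* operator with symbol a has the kernel                                        *)
(*   k(x, y) = (2 pi)^-n int e^(i (x - y) xi) a(x, xi) dxi,                     *)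
(* a multiplication by e^(i x xi) followed by a Fourier transform in the second *)
(* variable. Both operations, and their inverses, preserve the families that    *)
(* are bounded in the Schwartz space. A weight function lies between two        *)
(* powers of <z>, so the smoothing symbols are exactly the S-regular nets, and  *)
(* the correspondence between a and k is a bijection between symbols and        *)
(* kernels. A negligible kernel gives a negligible operator, so the class of k  *)
(* suffices. Fourier inversion is obtained by Abel summation with the           *)
(* multiplier prod_i e^(-d |xi_i|), whose Fourier transform is a product of     *)
(* Poisson kernels.                                                             *)
Require Import Defs.
From mathcomp Require Import all_boot all_order all_algebra.
From mathcomp Require Import generic_quotient complex ring lra.
From mathcomp Require Import all_classical all_reals all_analysis.
From mathcomp Require Import measurable_realfun lebesgue_integral_under.

Set Implicit Arguments.
Unset Strict Implicit.
Unset Printing Implicit Defensive.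

Import Order.TTheory GRing.Theory Num.Theory.
Import numFieldNormedType.Exports.
Import Normc.

Local Open Scope classical_set_scope.
Local Open Scope complex_scope.
Local Open Scope quotient_scope.
Local Open Scope ring_scope.

(** * Complex-valued integrals *)

(** The heart is an exact identity of nets, not only of classes: for moderate [u] one has
    [psdo_net phi a u = kernel_net phi k u] when k(x, y) = (2 pi)^-n int e^(i (x - y) xi) a(x, xi)
    dxi ([psdo_as_kernel]), and also when a(x, xi) = int e^(i (y - x) xi) k(x, y) dy, by Fourier
    inversion ([kernel_as_psdo]). For each fixed eps the function u_eps(y) hat phi(eps y) is bounded
    by a multiple of [omega], so Fubini lets the xi-integral be computed first.

    It remains to see that a and k range over the same kind of nets. Uniformity in eps is carried by
    [bddS]: a family on which every word in the operators x_i and d_i is bounded. A net is S-regular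
    iff eps^N times it is such a family for a single N, and negligible iff eps^-q times it is one
    for every q. Multiplication by a unimodular exponential of a polynomial and the partial Fourier
    transform only turn these operators into one another up to polynomial factors, so they preserve
    [bddS] with the same N ([bddS_cis], [bddS_fourier2]). On the symbol side, a weight lies between
    <z>^mu and <z> up to constants, so powers of the weight and powers of <z> can be traded, and
    smoothing symbols are the S-regular nets ([smoothing_regular], [regular_smoothing]).

    A kernel operator has to be described by every representative of its kernel. Two representatives
    differ by a negligible net, and integrating such a net against u_eps(y) hat phi(eps y), which is
    at most eps^-N times a polynomial uniformly in eps, gives a negligible net
    ([kernel_net_negligible]).

    The inversion formula ([fourier_inversion]) comes from damping by prod_i e^(-d |xi_i|), whose
    Fourier transform is explicit ([fourier_laplE]) with known mass ([integral_omega]); d tends to 0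
    by dominated convergence on both sides. Throughout, integrability is checked against multiples
    of [omega], an integrable product whose inverse is a polynomial. *)

Section ComplexNorm.
Variable R : realType.
Local Notation C := R[i].
Implicit Types (z w : C).

Lemma normc_nneg z : 0 <= normc z.
Proof. by case: z => a b; exact: sqrtr_ge0. Qed.

Lemma normRe z : `|complex.Re z| <= normc z.
Proof.
by case: z => a b /=; rewrite -sqrtr_sqr ler_wsqrtr// lerDl sqr_ge0.
Qed.

Lemma normIm z : `|complex.Im z| <= normc z.
Proof.
by case: z => a b /=; rewrite -sqrtr_sqr ler_wsqrtr// lerDr sqr_ge0.
Qed.

Lemma normc_ReIm z : normc z <= `|complex.Re z| + `|complex.Im z|.
Proof.
case: z => a b /=; rewrite -[leRHS]ger0_norm ?addr_ge0// -sqrtr_sqr.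
apply: ler_wsqrtr; rewrite sqrrD !real_normK ?num_real//.
by rewrite lerD2r lerDl mulrn_wge0// mulr_ge0.
Qed.

Lemma normc_real (r : R) : normc r%:C = `|r|.
Proof. by rewrite /normc /= expr0n addr0 sqrtr_sqr. Qed.

Lemma normc_cis (t : R) : normc (cis t) = 1.
Proof. by rewrite /normc/= cos2Dsin2 sqrtr1. Qed.

Lemma cisD (s t : R) : cis (s + t) = cis s * cis t.
Proof.
rewrite /cis cosD sinD; apply/eqP; rewrite eq_complex /=.
by rewrite eqxx /= addrC eqxx.
Qed.

Lemma cis0 : cis 0 = 1 :> C.
Proof. by rewrite /cis cos0 sin0. Qed.

Lemma cReD z w : complex.Re (z + w) = complex.Re z + complex.Re w.
Proof. by case: z => ? ?; case: w. Qed.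
Lemma cImD z w : complex.Im (z + w) = complex.Im z + complex.Im w.
Proof. by case: z => ? ?; case: w. Qed.
Lemma cReM z w : complex.Re (z * w) =
  complex.Re z * complex.Re w - complex.Im z * complex.Im w.
Proof. by case: z => ? ?; case: w. Qed.
Lemma cImM z w : complex.Im (z * w) =
  complex.Re z * complex.Im w + complex.Im z * complex.Re w.
Proof. by case: z => ? ?; case: w. Qed.

End ComplexNorm.

Section ComplexIntegral.
Context d (X : measurableType d) (R : realType).
Variable mu : {measure set X -> \bar R}.
Local Notation C := R[i].
Implicit Types (f g : X -> C) (B : X -> R).

Definition cmeasurable f :=
  measurable_fun setT (fun x => complex.Re (f x)) /\
  measurable_fun setT (fun x => complex.Im (f x)).

Definition cintegrable f :=
  mu.-integrable setT (fun x => (complex.Re (f x))%:E) /\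
  mu.-integrable setT (fun x => (complex.Im (f x))%:E).

Definition rintegrable B := mu.-integrable setT (EFin \o B).

Lemma cmeasurableM f g : cmeasurable f -> cmeasurable g ->
  cmeasurable (fun x => f x * g x).
Proof.
move=> [fR fI] [gR gI]; split.
- under eq_fun do rewrite cReM.
  by apply: measurable_funB; apply: measurable_funM.
- under eq_fun do rewrite cImM.
  by apply: measurable_funD; apply: measurable_funM.
Qed.

Lemma cmeasurable_real (g : X -> R) : measurable_fun setT g ->
  cmeasurable (fun x => (g x)%:C).
Proof. by move=> mg; split => //=; exact: measurable_cst. Qed.

Lemma cmeasurable_cst (c : C) : cmeasurable (fun=> c).
Proof. by split; exact: measurable_cst. Qed.

Lemma cmeasurable_cis (g : X -> R) : measurable_fun setT g ->
  cmeasurable (fun x => cis (g x)).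
Proof.
move=> mg; split => /=.
- by apply: measurableT_comp mg; apply: continuous_measurable_fun;
    exact: continuous_cos.
- by apply: measurableT_comp mg; apply: continuous_measurable_fun;
    exact: continuous_sin.
Qed.

Lemma cintegrable_dom B f : rintegrable B -> cmeasurable f ->
  (forall x, normc (f x) <= B x) -> cintegrable f.
Proof.
move=> iB [mR mI] fB; split; apply: le_integrable iB => //.
- exact/measurable_EFinP.
- move=> x _; rewrite lee_fin; apply: le_trans (normRe _) _.
  by apply: le_trans (fB x) _; exact: ler_norm.
- exact/measurable_EFinP.
- move=> x _; rewrite lee_fin; apply: le_trans (normIm _) _.
  by apply: le_trans (fB x) _; exact: ler_norm.
Qed.

Lemma eq_cintegral f g : f =1 g -> cintegral mu f = cintegral mu g.
Proof. by move=> fg; congr cintegral; exact/funext. Qed.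

Lemma cintegralZ (c : C) f : cintegrable f ->
  cintegral mu (fun x => c * f x) = c * cintegral mu f.
Proof.
move=> [fR fI]; apply/eqP; rewrite eq_complex /= cReM cImM /=.
have iZ (r : R) (g : X -> R) : mu.-integrable setT (fun x => (g x)%:E) ->
    mu.-integrable setT (EFin \o (fun x => r * g x)).
  move=> ig; rewrite (_ : _ \o _ = (fun x => r%:E * (g x)%:E)%E).
    exact: integrableZl.
  by apply/funext => x /=; rewrite EFinM.
apply/andP; split; apply/eqP.
- under eq_Rintegral do rewrite cReM.
  rewrite RintegralB//; [|exact: iZ..].
  by rewrite !RintegralZl.
- under eq_Rintegral do rewrite cImM.
  rewrite RintegralD//; [|exact: iZ..].
  by rewrite !RintegralZl.
Qed.

Lemma cintegralD f g : cintegrable f -> cintegrable g ->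
  cintegral mu (fun x => f x + g x) = cintegral mu f + cintegral mu g.
Proof.
move=> [fR fI] [gR gI]; apply/eqP; rewrite eq_complex /=.
apply/andP; split; apply/eqP.
- by under eq_Rintegral do rewrite cReD; rewrite RintegralD.
- by under eq_Rintegral do rewrite cImD; rewrite RintegralD.
Qed.

Lemma cintegral_real B : cintegral mu (fun x => (B x)%:C) =
  (Rintegral mu setT B)%:C.
Proof.
apply/eqP; rewrite eq_complex /= eqxx /=.
by rewrite /Rintegral integral0_eq.
Qed.

(** Real and imaginary parts are estimated separately, whence the factor 2; a sharper constant would
    bring nothing to boundedness statements. *)
Lemma normc_cintegral B f : rintegrable B -> cmeasurable f ->
  (forall x, normc (f x) <= B x) ->
  normc (cintegral mu f) <= 2 * Rintegral mu setT B.
Proof.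
move=> iB mf fB; have [fR fI] := cintegrable_dom iB mf fB.
apply: le_trans (normc_ReIm _) _; rewrite mulr2n mulrDl !mul1r /=.
have aux (h : X -> R) : mu.-integrable setT (fun x => (h x)%:E) ->
    (forall x, `|h x| <= B x) -> `|Rintegral mu setT h| <= Rintegral mu setT B.
  move=> ih hB; apply: le_trans (le_normr_Rintegral _ ih) _ => //.
  by apply: le_Rintegral => //; exact: (integrable_abse ih).
apply: lerD; apply: aux => // x.
- exact: le_trans (normRe _) (fB x).
- exact: le_trans (normIm _) (fB x).
Qed.

(** Convergence is expressed on real and imaginary parts, so that dominated convergence for real
    integrands applies to each of them. *)
Lemma ccvg_dominated B (f_ : nat -> X -> C) f : rintegrable B ->
  (forall n, cmeasurable (f_ n)) -> cmeasurable f ->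
  (forall n x, normc (f_ n x) <= B x) ->
  (forall x, complex.Re (f_ n x) @[n --> \oo] --> complex.Re (f x)) ->
  (forall x, complex.Im (f_ n x) @[n --> \oo] --> complex.Im (f x)) ->
  (complex.Re (cintegral mu (f_ n)) @[n --> \oo] -->
     complex.Re (cintegral mu f)) /\
  (complex.Im (cintegral mu (f_ n)) @[n --> \oo] -->
     complex.Im (cintegral mu f)).
Proof.
move=> iB mf_ [mfR mfI] fB cR cI.
have aux (h_ : nat -> X -> R) (h : X -> R) :
    (forall n, measurable_fun setT (h_ n)) -> measurable_fun setT h ->
    (forall n x, `|h_ n x| <= B x) ->
    (forall x, h_ n x @[n --> \oo] --> h x) ->
    Rintegral mu setT (h_ n) @[n --> \oo] --> Rintegral mu setT h.
  move=> mh_ mh hB ch.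
  have [|||||ih _ ] := @dominated_convergence _ X R mu setT measurableT
    (fun n x => (h_ n x)%:E) (fun x => (h x)%:E) (EFin \o B).
  - by move=> n; exact/measurable_EFinP.
  - exact/measurable_EFinP.
  - by apply: aeW => x _; apply: cvg_EFin; [exact: nearW|exact: ch].
  - exact: iB.
  - by apply: aeW => x n _; rewrite lee_fin.
  move=> hc; rewrite /Rintegral; apply: fine_cvg; rewrite fineK//.
  exact: integrable_fin_num.
by split => /=; apply: aux => // n; [case: (mf_ n)| |case: (mf_ n)|] => // x;
  [exact: le_trans (normRe _) (fB n x)|exact: le_trans (normIm _) (fB n x)].
Qed.

End ComplexIntegral.

(** * Fubini's theorem for complex integrands *)

Section ComplexFubini.
Context d1 d2 (X : measurableType d1) (Y : measurableType d2) (R : realType).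
Variables (m1 : {sigma_finite_measure set X -> \bar R})
  (m2 : {sigma_finite_measure set Y -> \bar R}).
Local Notation C := R[i].
Implicit Types (f : X * Y -> C).

Let rfubini1 (h : X * Y -> R) :
  (m1 \x m2)%E.-integrable setT (fun x => (h x)%:E) ->
  (forall x, m2.-integrable setT (fun y => (h (x, y))%:E)) ->
  Rintegral m1 setT (fun x => Rintegral m2 setT (fun y => h (x, y))) =
  Rintegral (m1 \x m2)%E setT h.
Proof.
move=> ih ih2; rewrite /Rintegral -integral12_prod_meas1//.
congr fine; apply: eq_integral => x _; rewrite fineK//.
exact: integrable_fin_num.
Qed.

Let rfubini2 (h : X * Y -> R) :
  (m1 \x m2)%E.-integrable setT (fun x => (h x)%:E) ->
  (forall y, m1.-integrable setT (fun x => (h (x, y))%:E)) ->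
  Rintegral m2 setT (fun y => Rintegral m1 setT (fun x => h (x, y))) =
  Rintegral (m1 \x m2)%E setT h.
Proof.
move=> ih ih2; rewrite /Rintegral -integral21_prod_meas1//.
congr fine; apply: eq_integral => x _; rewrite fineK//.
exact: integrable_fin_num.
Qed.

Lemma rintegrable_prod (B1 : X -> R) (B2 : Y -> R) :
  (forall x, 0 <= B1 x) -> (forall y, 0 <= B2 y) ->
  rintegrable m1 B1 -> rintegrable m2 B2 ->
  rintegrable (m1 \x m2)%E (fun z => B1 z.1 * B2 z.2).
Proof.
move=> B10 B20 i1 i2.
have mB1 : measurable_fun setT B1 by apply/measurable_EFinP; exact: measurable_int i1.
have mB2 : measurable_fun setT B2 by apply/measurable_EFinP; exact: measurable_int i2.
have mB : measurable_fun setT (EFin \o (fun z : X * Y => B1 z.1 * B2 z.2)).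
  apply/measurable_EFinP; apply: measurable_funM.
  - exact: (measurableT_comp mB1 measurable_fst).
  - exact: (measurableT_comp mB2 measurable_snd).
apply/(integrable12ltyP _ _ mB) => /=.
rewrite (_ : (fun x => _) = (fun x => (B1 x)%:E * (Rintegral m2 setT B2)%:E)%E).
  rewrite ge0_integralZr//; last 3 first.
  - exact/measurable_EFinP.
  - by move=> x _; rewrite lee_fin.
  - by rewrite lee_fin; apply: Rintegral_ge0.
  rewrite lte_mul_pinfty//; last by rewrite ltry.
  - by apply: integral_ge0 => x _; rewrite lee_fin.
  - exact: (integrable_fin_num measurableT i1).
apply/funext => x; rewrite /Rintegral fineK; last exact: (integrable_fin_num measurableT i2).
rewrite -ge0_integralZl//.
- by apply: eq_integral => y _; rewrite ger0_norm ?mulr_ge0// EFinM.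
- exact/measurable_EFinP.
- by move=> y _; rewrite lee_fin.
- by rewrite lee_fin.
Qed.

(** The product majorant makes [f] integrable on the product and makes every section integrable, not
    only almost every one; hence each inner integral is finite and passing to [fine] loses
    nothing. *)
Lemma cfubini (B1 : X -> R) (B2 : Y -> R) f :
  (forall x, 0 <= B1 x) -> (forall y, 0 <= B2 y) ->
  rintegrable m1 B1 -> rintegrable m2 B2 -> cmeasurable f ->
  (forall x y, normc (f (x, y)) <= B1 x * B2 y) ->
  cintegral m1 (fun x => cintegral m2 (fun y => f (x, y))) =
    cintegral (m1 \x m2)%E f /\
  cintegral m2 (fun y => cintegral m1 (fun x => f (x, y))) =
    cintegral (m1 \x m2)%E f.
Proof.
move=> B10 B20 i1 i2 mf fB.
have iB := rintegrable_prod B10 B20 i1 i2.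
have [fR fI] := cintegrable_dom iB mf (fun z => let: (x, y) := z in fB x y).
have s2 x : cintegrable m2 (fun y => f (x, y)).
  apply: (@cintegrable_dom _ _ _ _ (fun y => B1 x * B2 y)) => //.
  - rewrite /rintegrable (_ : _ \o _ = (fun y => (B1 x)%:E * (B2 y)%:E)%E).
      exact: integrableZl.
    by apply/funext => y /=; rewrite EFinM.
  - by case: mf => mR mI; split; [apply: (measurableT_comp mR)|
      apply: (measurableT_comp mI)]; exact: measurable_pair1.
have s1 y : cintegrable m1 (fun x => f (x, y)).
  apply: (@cintegrable_dom _ _ _ _ (fun x => B1 x * B2 y)) => //.
  - rewrite /rintegrable (_ : _ \o _ = (fun x => (B1 x)%:E * (B2 y)%:E)%E).
      exact: integrableZr.
    by apply/funext => x /=; rewrite EFinM.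
  - by case: mf => mR mI; split; [apply: (measurableT_comp mR)|
      apply: (measurableT_comp mI)]; exact: measurable_pair2.
split; apply/eqP; rewrite eq_complex /=.
- by rewrite (rfubini1 fR) ?(rfubini1 fI) ?eqxx// => x; case: (s2 x).
- by rewrite (rfubini2 fR) ?(rfubini2 fI) ?eqxx// => x; case: (s1 x).
Qed.

End ComplexFubini.

(** * Lebesgue measure on tuples *)

Section MeasurableRow.
Context d (X : measurableType d) (R : realType).

(* An open set is a countable union of rational boxes. *)
Lemma measurable_continuous_row p (c : 'I_p -> X -> R) (g : 'rV[R]_p -> R) :
  continuous g -> (forall i, measurable_fun setT (c i)) ->
  measurable_fun setT (fun x => g (\row_i c i x)).
Proof.
move=> cg mc.
have mopen U : open U -> measurable ((fun x => \row_i c i x) @^-1` U).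
  move=> oU.
  pose box (q : 'rV[rat]_p * nat) : set X :=
    [set x | forall i, `|ratr (q.1 0 i) - c i x| < q.2.+1%:R^-1].
  pose good (q : 'rV[rat]_p * nat) := box q `<=` (fun x => \row_i c i x) @^-1` U.
  rewrite (_ : _ @^-1` U = \bigcup_n
      (if @unpickle ('rV[rat]_p * nat)%type n is Some q then
         if `[< good q >] then box q else set0 else set0)).
    apply: bigcupT_measurable => n; case: unpickle => // q.
    case: asboolP => // _.
    rewrite (_ : box q = \bigcap_(i in [set: 'I_p])
        [set x | `|ratr (q.1 0 i) - c i x| < q.2.+1%:R^-1]); last first.
      by apply/seteqP; split => x /= h i => [_|]; exact: h.
    apply: fin_bigcap_measurable => // i _.
    have mi : measurable_fun setT (fun x => `|ratr (q.1 0 i) - c i x|).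
      by apply: measurableT_comp => //; apply: measurable_funB.
    rewrite (_ : [set x | _] = setT `&` (fun x => `|ratr (q.1 0 i) - c i x|) @^-1`
        `]-oo, (q.2.+1%:R^-1 : R)[%classic).
      exact: mi.
    by rewrite setTI; apply/seteqP; split => x /=; rewrite in_itv.
  apply/seteqP; split => x /=; last first.
    move=> [n _]; case: unpickle => // q; case: asboolP => // gq; exact: gq.
  move=> Ux.
  have /nbhs_ballP[e /= e0 eU] : nbhs (\row_i c i x) U by exact: open_nbhs_nbhs.
  have [k ke] : exists k, k.+1%:R^-1 < e / 2 :> R.
    have [k _ hk] := near_infty_natSinv_lt (PosNum (divr_gt0 e0 (@ltr0Sn R 1))).
    by exists k; apply: (hk k) => /=.
  have rq i : {q : rat | `|ratr q - c i x| < k.+1%:R^-1}.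
    have h : c i x - k.+1%:R^-1 < c i x + k.+1%:R^-1.
      by rewrite ltrD2l (@lt_trans _ _ 0) ?invr_gt0// oppr_lt0 invr_gt0.
    apply: cid; have [q] := rat_in_itvoo h.
    rewrite in_itv/= => /andP[q1 q2]; exists q.
    move: (ratr q) (k.+1%:R^-1 : R) q1 q2 => r e1 r1 r2.
    by rewrite ltr_norml; apply/andP; split; lra.
  pose q : 'rV[rat]_p * nat := (\row_i sval (rq i), k).
  have xq : box q x by move=> i /=; rewrite mxE; case: (rq i).
  have gq : good q.
    move=> y yq /=; apply: eU; split => // i j; rewrite !ord1 !mxE /ball /=.
    have := xq j; have := yq j; rewrite /= => h1 h2.
    apply: le_lt_trans (ler_distD (ratr (q.1 0 j)) _ _) _.
    rewrite [ltRHS](splitr e) ltrD//.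
      by rewrite distrC (lt_trans h2).
    by rewrite (lt_trans h1).
  exists (pickle q) => //; rewrite pickleK.
  by case: asboolP.
apply: (measurability _ (RGenOpens.measurableE R)) => _ [_ [a [b ->]] <-].
rewrite setTI (_ : _ @^-1` _ =
  (fun x => \row_i c i x) @^-1` (g @^-1` `]a, b[%classic)) //.
apply: mopen; apply: open_comp; last exact: itv_open.
by move=> y _; exact: cg.
Qed.

End MeasurableRow.

Section TupleMeasure.
Variable R : realType.
Local Notation T := (measurableTypeR R).
Local Notation mu := (@lebesgue_measure R).
Local Notation muT := (lebesgue_tuple R).
Local Open Scope ereal_scope.

(** Tuples carry the product sigma-algebra while continuity refers to the topology of row vectors;
    this lemma is the bridge between the two. *)
Lemma measurable_row_of_tuple n (g : 'rV[R]_n -> R) : continuous g ->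
  measurable_fun setT (fun t : n.-tuple T => g (row_of_tuple t)).
Proof.
move=> cg; apply: (measurable_continuous_row (c := fun i t => tnth t i)) => // i.
exact: measurable_tnth.
Qed.

Lemma ge0_integral_tupleS n (f : n.+1.-tuple T -> \bar R) :
  measurable_fun setT f -> (forall t, 0 <= f t) ->
  \int[muT n.+1]_t f t = \int[mu]_s \int[muT n]_t f (tuple_cons (s, t)).
Proof.
move=> mf f0.
have mc := @measurable_tuple_cons R n.
rewrite [LHS](ge0_integral_pushforward mc (mu \x muT n)%E measurableT)//.
rewrite preimage_setT fubini_tonelli1// => [|x]; last exact: f0.
exact: measurableT_comp mc.
Qed.

(** By uniqueness of Lebesgue measure: k times its image under s |-> a + k s agrees with it on the
    half-open intervals. *)
Lemma lebesgue_affine (a k : R) (A : set T) : (0 < k)%R -> measurable A ->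
  mu ((fun s => a + k * s)%R @^-1` A) = (k^-1)%:E * mu A.
Proof.
move=> k0 mA.
have mf : measurable_fun setT (fun s : T => (a + k * s)%R : T).
  by apply: measurable_funD => //; apply: measurable_funM.
have kk : (k * k^-1 = 1)%R by rewrite divff// gt_eqF.
pose nu0 := mscale (NngNum (ltW k0)) (pushforward mu (fun s : T => (a + k * s)%R : T)).
pose nu := nu0 mf.
have nuE B : nu B = k%:E * mu ((fun s => a + k * s)%R @^-1` B) by [].
suff -> : mu A = nu A by rewrite nuE muleA -EFinM mulrC kk mul1e.
apply: (@lebesgue_measure_unique R (mscale (NngNum (ltW k0)) (pushforward mu (fun s : T => (a + k * s)%R : T)))) => // _ [[u v] /= uv <-].
change (mu `]u, v]%classic = k%:E * mu ((fun s => a + k * s)%R @^-1` `]u, v]%classic)).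
rewrite (_ : _ @^-1` _ = `]((u - a) / k)%R, ((v - a) / k)%R]%classic); last first.
  apply/seteqP; split => s /=; rewrite !in_itv /=.
    by rewrite ltr_pdivrMr// ler_pdivlMr// ltrBlDl lerBrDl mulrC.
  by rewrite ltr_pdivrMr// ler_pdivlMr// ltrBlDl lerBrDl mulrC.
rewrite !lebesgue_measure_itv /= !lte_fin ltr_pM2r ?invr_gt0// ltrD2r.
case: ifPn => _; last by rewrite mule0.
by rewrite -!EFinD -EFinM; congr EFin; field; rewrite gt_eqF.
Qed.

Lemma ge0_integral_affine (a k : R) (f : T -> \bar R) : (0 < k)%R ->
  measurable_fun setT f -> (forall t, 0 <= f t) ->
  \int[mu]_s f (a + k * s)%R = (k^-1)%:E * \int[mu]_s f s.
Proof.
move=> k0 mf f0.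
have mg : measurable_fun setT (fun s : T => (a + k * s)%R : T).
  by apply: measurable_funD => //; apply: measurable_funM.
have := @ge0_integral_pushforward _ _ _ _ _ _ mg mu setT f measurableT mf.
rewrite preimage_setT => <-//.
have k1 : (0 <= k^-1)%R by rewrite invr_ge0 ltW.
rewrite -(ge0_integral_mscale mu measurableT (NngNum k1))//.
apply: eq_measure_integral => A mA _.
exact: (lebesgue_affine a k0 mA).
Qed.

Definition tuple_affine n (a : 'rV[R]_n) (k : R) (t : n.-tuple T) : n.-tuple T :=
  [tuple (a 0 i + k * tnth t i)%R | i < n].

Lemma measurable_tuple_affine n (a : 'rV[R]_n) k :
  measurable_fun setT (tuple_affine a k).
Proof.
apply/measurable_fun_tnthP => i.
rewrite (_ : _ \o _ = (fun t : n.-tuple T => a 0 i + k * tnth t i)%R).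
  apply: measurable_funD => //; apply: measurable_funM => //.
  exact: measurable_tnth.
by apply/funext => t /=; rewrite tnth_mktuple.
Qed.

Lemma tuple_affine_cons n (a : 'rV[R]_n.+1) k s (t : n.-tuple T) :
  tuple_affine a k (tuple_cons (s, t)) =
  tuple_cons ((a 0 ord0 + k * s)%R, tuple_affine (\row_i a 0 (lift ord0 i))%R k t).
Proof.
apply: eq_from_tnth => i; rewrite tnth_mktuple.
case: (unliftP ord0 i) => [j|] ->.
  by rewrite !tnthS tnth_mktuple mxE.
by rewrite !tnth0.
Qed.

Lemma ge0_integral_tuple_affine n (a : 'rV[R]_n) k (f : n.-tuple T -> \bar R) :
  (0 < k)%R -> measurable_fun setT f -> (forall t, 0 <= f t) ->
  \int[muT n]_t f (tuple_affine a k t) = (k^-1 ^+ n)%:E * \int[muT n]_t f t.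
Proof.
move=> k0; elim: n a f => [|n IH] a f mf f0.
  rewrite expr0 mul1e; apply: eq_integral => t _.
  by rewrite (tuple0 t) (tuple0 (tuple_affine _ _ _)).
have kn0 m : (0 <= k^-1 ^+ m)%R by rewrite exprn_ge0// invr_ge0 ltW.
have mfc s : measurable_fun setT (fun t => f (tuple_cons (s, t))).
  apply: (measurableT_comp mf); apply: measurableT_comp; last exact: measurable_pair1.
  exact: measurable_tuple_cons.
have mF : measurable_fun setT (fun s => \int[muT n]_t f (tuple_cons (s, t))).
  apply: (@measurable_fun_fubini_tonelli_F _ _ _ _ _ (muT n) (f \o @tuple_cons R n)).
    exact: (measurableT_comp mf (@measurable_tuple_cons R n)).
  by move=> x; exact: f0.
rewrite !ge0_integral_tupleS//; last first.
  exact: (measurableT_comp mf (measurable_tuple_affine _ _)).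
pose F (s : T) := \int[muT n]_t f (tuple_cons (s, t)).
have F0 s : 0 <= F s by apply: integral_ge0.
have mFa : measurable_fun setT (fun s : T => F (a 0%R ord0 + k * s)%R).
  apply: (measurableT_comp mF).
  by apply: measurable_funD => //; apply: measurable_funM.
have kE : 0 <= (k^-1 ^+ n)%:E :> \bar R by rewrite lee_fin.
rewrite (eq_integral (fun s : T => (k^-1 ^+ n)%:E * F (a 0%R ord0 + k * s)%R)).
  rewrite (ge0_integralZl _ measurableT mFa (fun s _ => F0 _) kE).
  by rewrite (ge0_integral_affine _ k0 mF F0) muleA -EFinM -exprSr.
move=> s _; under eq_integral do rewrite tuple_affine_cons.
by rewrite (IH _ (fun t => f (tuple_cons ((a 0%R ord0 + k * s)%R, t)))).
Qed.

End TupleMeasure.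

Section TupleIntegral.
Variable R : realType.
Local Notation C := R[i].
Local Notation T := (measurableTypeR R).
Local Notation mu := (@lebesgue_measure R).
Local Notation muT := (lebesgue_tuple R).

Lemma rintegrable_ge0 d (X : measurableType d) (m : {measure set X -> \bar R})
    (B : X -> R) : measurable_fun setT B -> (forall x, 0 <= B x) ->
  (\int[m]_x (B x)%:E < +oo)%E -> rintegrable m B.
Proof.
move=> mB B0 fB; apply/integrableP; split; first exact/measurable_EFinP.
by under eq_integral do rewrite /= ger0_norm//.
Qed.

Lemma cmeasurable_row n (f : 'rV[R]_n -> C) :
  continuous (fun y => complex.Re (f y)) ->
  continuous (fun y => complex.Im (f y)) ->
  cmeasurable (fun t : n.-tuple T => f (row_of_tuple t)).
Proof.
by move=> cR cI; split; [apply: (measurable_row_of_tuple cR)|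
  apply: (measurable_row_of_tuple cI)].
Qed.

Lemma row_of_tuple_affine n (a : 'rV[R]_n) k (t : n.-tuple T) :
  row_of_tuple (tuple_affine a k t) = a + k *: row_of_tuple t.
Proof. by apply/rowP => i; rewrite !mxE tnth_mktuple. Qed.

Lemma Rintegral_tuple_affine n (a : 'rV[R]_n) k (h : n.-tuple T -> R) : 0 < k ->
  (muT n).-integrable setT (EFin \o h) ->
  Rintegral (muT n) setT (fun t => h (tuple_affine a k t)) =
  k^-1 ^+ n * Rintegral (muT n) setT h.
Proof.
move=> k0 ih.
have mh : measurable_fun setT (EFin \o h) by exact: measurable_int ih.
have kn0 : 0 <= k^-1 ^+ n by rewrite exprn_ge0// invr_ge0 ltW.
rewrite /Rintegral integralE [in RHS]integralE.
rewrite (_ : (fun t => (h (tuple_affine a k t))%:E)^\+%E =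
  (EFin \o h)^\+%E \o tuple_affine a k)//.
rewrite (_ : (fun t => (h (tuple_affine a k t))%:E)^\-%E =
  (EFin \o h)^\-%E \o tuple_affine a k)//.
rewrite /comp (ge0_integral_tuple_affine a k0 (measurable_funepos mh))//.
rewrite (ge0_integral_tuple_affine a k0 (measurable_funeneg mh))//.
rewrite -muleBr//; last first.
  rewrite fin_num_adde_defr//.
  exact: integrable_pos_fin_num ih.
rewrite fineM//.
rewrite fin_numB; apply/andP; split.
  exact: integrable_pos_fin_num ih.
exact: integrable_neg_fin_num ih.
- by rewrite -funeneg_comp.
- by rewrite -funepos_comp.
Qed.

Lemma cintegral_tuple_affine n (a : 'rV[R]_n) k (f : n.-tuple T -> C) : 0 < k ->
  cintegrable (muT n) f ->
  cintegral (muT n) (fun t => f (tuple_affine a k t)) =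
  (k^-1 ^+ n)%:C * cintegral (muT n) f.
Proof.
move=> k0 [fR fI]; apply/eqP; rewrite eq_complex /=.
rewrite (@Rintegral_tuple_affine n a k (fun t => complex.Re (f t)) k0 fR).
rewrite (@Rintegral_tuple_affine n a k (fun t => complex.Im (f t)) k0 fI).
by rewrite !mul0r subr0 addr0 !eqxx.
Qed.

(** The standard majorant: being a product of functions of one variable it is integrable by Tonelli,
    and its inverse is a polynomial, so that Schwartz bounds yield bounds by multiples of it. *)
Definition omega n (y : 'rV[R]_n) : R := \prod_i (1 + y 0 i ^+ 2)^-1.

Lemma omega_gt0 n (y : 'rV[R]_n) : 0 < omega y.
Proof.
by apply: prodr_gt0 => i _; rewrite invr_gt0 ltr_wpDr// sqr_ge0.
Qed.

Lemma omega_ge0 n (y : 'rV[R]_n) : 0 <= omega y.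
Proof. exact/ltW/omega_gt0. Qed.

Lemma omega_le1 n (y : 'rV[R]_n) : omega y <= 1.
Proof.
have -> : 1 = \prod_(i < n) 1 :> R by rewrite big1_eq.
apply: ler_prod => i _; rewrite invr_ge0 addr_ge0 ?sqr_ge0//=.
by rewrite invf_le1 ?lerDl ?sqr_ge0// ltr_wpDr// sqr_ge0.
Qed.

Lemma continuous_coord n (i : 'I_n) : continuous (fun y : 'rV[R]_n => y 0 i).
Proof. by move=> y; exact: coord_continuous. Qed.

Lemma continuous_prod (Z : topologicalType) (I : Type) (s : seq I)
    (g : I -> Z -> R) : (forall i, continuous (g i)) ->
  continuous (fun y => \prod_(i <- s) g i y).
Proof.
move=> cg; elim: s => [|i s IH].
  by under eq_fun do rewrite big_nil; exact: cst_continuous.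
under eq_fun do rewrite big_cons.
by move=> y; apply: cvgM; [exact: cg|exact: IH].
Qed.

Lemma continuous_omega n : continuous (@omega n).
Proof.
apply: continuous_prod => i y.
apply: (@continuous_comp _ _ _ (fun y : 'rV[R]_n => y 0 i)
  (fun x => (1 + x ^+ 2)^-1)); first exact: continuous_coord.
exact: continuous_oneDsqrV.
Qed.

Lemma integral_oneDsqrV : (\int[mu]_x ((1 + x ^+ 2)^-1)%:E = pi%:E)%E.
Proof.
rewrite (@ge0_symfun_integralT R (fun x => (1 + x ^+ 2)^-1)).
- rewrite -set_itvcy (integral0y_oneDsqr R) -EFinM.
  by congr EFin; rewrite mulrC divfK.
- by move=> x; rewrite invr_ge0 addr_ge0// sqr_ge0.
- exact: continuous_oneDsqrV.
- by move=> x /=; rewrite sqrrN.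
Qed.

Lemma rintegrable_oneDsqrV : rintegrable mu (fun x => (1 + x ^+ 2)^-1 : R).
Proof.
apply: rintegrable_ge0.
- by apply: continuous_measurable_fun; exact: continuous_oneDsqrV.
- by move=> x; rewrite invr_ge0 addr_ge0// sqr_ge0.
- by rewrite integral_oneDsqrV ltry.
Qed.

Lemma rintegrable_prod_tuple (b : R -> R) n : (forall x, 0 <= b x) ->
  rintegrable mu b ->
  rintegrable (muT n) (fun t => \prod_i b (tnth t i)).
Proof.
move=> b0 ib.
have mb : measurable_fun setT b by apply/measurable_EFinP; exact: measurable_int ib.
have mP m : measurable_fun setT (fun t : m.-tuple T => \prod_i b (tnth t i)).
  apply: measurable_prod => i _.
  exact: (measurableT_comp mb (@measurable_tnth _ T m i)).
have P0 m (t : m.-tuple T) : 0 <= \prod_i b (tnth t i) by apply: prodr_ge0.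
apply: (rintegrable_ge0 (mP n) (P0 n)); elim: n => [|n IH].
  rewrite (eq_integral (cst 1%E)); last by move=> t _; rewrite big_ord0.
  by rewrite integral_cst// mul1e /= diracE in_setT ltry.
have mPE m : measurable_fun setT (fun t : m.-tuple T => (\prod_i b (tnth t i))%:E).
  by apply/measurable_EFinP; exact: mP.
have PE0 m (t : m.-tuple T) : setT t -> (0 <= (\prod_i b (tnth t i))%:E)%E.
  by rewrite lee_fin.
rewrite (ge0_integral_tupleS (mPE n.+1) (fun t => @PE0 n.+1 t I)).
rewrite (eq_integral (fun s : T => (b s)%:E *
    \int[muT n]_t (\prod_i b (tnth t i))%:E)%E); last first.
  move=> s _; have b0s : (0 <= (b s)%:E)%E by rewrite lee_fin.
  rewrite -(ge0_integralZl _ measurableT (mPE n) (@PE0 n) b0s).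
  apply: eq_integral => t _; rewrite big_ord_recl EFinM tnth0.
  by congr (_ * _%:E)%E; apply: eq_bigr => i _; rewrite tnthS.
have mbE : measurable_fun setT (fun s : T => (b s)%:E) by exact/measurable_EFinP.
have bE0 (s : T) : setT s -> (0 <= (b s)%:E)%E by rewrite lee_fin.
rewrite (ge0_integralZr _ measurableT mbE bE0); last first.
  by apply: integral_ge0 => t _; exact: PE0.
rewrite lte_mul_pinfty//.
- by apply: integral_ge0 => x _; rewrite lee_fin.
- exact: (integrable_fin_num measurableT ib).
Qed.

Lemma rintegrable_omega n : rintegrable (muT n) (fun t => omega (row_of_tuple t)).
Proof.
rewrite (_ : (fun t => _) =
  (fun t : n.-tuple T => \prod_i (1 + tnth t i ^+ 2)^-1)); last first.
  by apply/funext => t; apply: eq_bigr => i _; rewrite mxE.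
apply: (rintegrable_prod_tuple (b := fun x => (1 + x ^+ 2)^-1)).
  by move=> x; rewrite invr_ge0 addr_ge0// sqr_ge0.
exact: rintegrable_oneDsqrV.
Qed.

Lemma cintegral_tupleS n (B1 : T -> R) (B2 : n.-tuple T -> R)
    (f : n.+1.-tuple T -> C) :
  (forall s, 0 <= B1 s) -> (forall t, 0 <= B2 t) ->
  rintegrable mu B1 -> rintegrable (muT n) B2 -> cmeasurable f ->
  (forall s t, normc (f (tuple_cons (s, t))) <= B1 s * B2 t) ->
  cintegral (muT n.+1) f =
  cintegral mu (fun s => cintegral (muT n) (fun t => f (tuple_cons (s, t)))).
Proof.
move=> B10 B20 i1 i2 [mR mI] fB.
have mc := @measurable_tuple_cons R n.
have mfc : cmeasurable (fun z => f (tuple_cons z)).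
  by split; [exact: (measurableT_comp mR mc)|exact: (measurableT_comp mI mc)].
have [-> _] := @cfubini _ _ _ _ _ _ (muT n) B1 B2 _ B10 B20 i1 i2 mfc fB.
have iB := rintegrable_prod B10 B20 i1 i2.
have [iR iI] := cintegrable_dom iB mfc (fun z => let: (x, y) := z in fB x y).
have aux (h : n.+1.-tuple T -> R) : measurable_fun setT h ->
    (mu \x muT n)%E.-integrable setT (fun z => (h (tuple_cons z))%:E) ->
    Rintegral (muT n.+1) setT h =
    Rintegral (mu \x muT n)%E setT (fun z => h (tuple_cons z)).
  move=> mh ih; rewrite /Rintegral; congr fine.
  apply: (@integral_pushforward _ _ _ _ _ _ mc (mu \x muT n)%E setT (EFin \o h)) => //.
  exact/measurable_EFinP.
by rewrite /cintegral (aux _ mR iR) (aux _ mI iI).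
Qed.

Lemma cmeasurable_prod n (g : 'I_n -> R -> C) :
  (forall i, cmeasurable (g i : T -> C)) ->
  cmeasurable (fun t : n.-tuple T => \prod_i g i (tnth t i)).
Proof.
move=> mg; rewrite (_ : (fun t => _) =
  (fun t : n.-tuple T => \prod_(i <- index_enum 'I_n) g i (tnth t i)))//.
elim: (index_enum _) => [|i s IH].
  by under eq_fun do rewrite big_nil; exact: cmeasurable_cst.
under eq_fun do rewrite big_cons.
apply: cmeasurableM IH; have [mR mI] := mg i.
by split; [exact: (measurableT_comp mR (@measurable_tnth _ T n i))|
  exact: (measurableT_comp mI (@measurable_tnth _ T n i))].
Qed.

Lemma normc_prod (I : Type) (s : seq I) (g : I -> C) :
  normc (\prod_(i <- s) g i) = \prod_(i <- s) normc (g i).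
Proof.
elim/big_ind2 : _ => [|x1 x2 y1 y2 <- <-|//]; last by rewrite normcM.
by rewrite -[1 in LHS]cis0 normc_cis.
Qed.

(** Induction on n, splitting off the first coordinate; the common majorant [b] supplies the product
    majorant that Fubini asks for. *)
Lemma cintegral_prod (b : R -> R) n (g : 'I_n -> R -> C) :
  (forall x, 0 <= b x) -> rintegrable mu b ->
  (forall i, cmeasurable (g i : T -> C)) ->
  (forall i x, normc (g i x) <= b x) ->
  cintegral (muT n) (fun t => \prod_i g i (tnth t i)) =
  \prod_i cintegral mu (g i).
Proof.
move=> b0 ib; elim: n g => [|n IH] g mg gb.
  rewrite big_ord0 (@eq_cintegral _ _ _ _ _ (fun=> (1 : R)%:C)); last first.
    by move=> t; rewrite big_ord0.
  rewrite cintegral_real Rintegral_cst// mul1r.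
  have E : muT 0 setT = 1%E by rewrite /= diracE in_setT.
  exact: (congr1 (fun x => (fine x)%:C) E).
have P0 m (t : m.-tuple T) : 0 <= \prod_i b (tnth t i) by apply: prodr_ge0.
rewrite (cintegral_tupleS b0 (P0 n) ib (rintegrable_prod_tuple n b0 ib)); last first.
- move=> s t; rewrite normc_prod big_ord_recl tnth0.
  rewrite ler_pM ?normc_nneg ?prodr_ge0//; last first.
    apply: ler_prod => i _; rewrite tnthS normc_nneg /=; exact: gb.
  by move=> i _; rewrite normc_nneg.
- exact: cmeasurable_prod.
rewrite big_ord_recl -IH// mulrC -cintegralZ; last first.
  apply: (@cintegrable_dom _ _ _ mu b); [exact: ib|exact: (mg ord0)|exact: (gb ord0)].
apply: eq_cintegral => s; rewrite mulrC -cintegralZ.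
  apply: eq_cintegral => t; rewrite big_ord_recl tnth0; congr (_ * _).
  by apply: eq_bigr => i _; rewrite tnthS.
apply: (cintegrable_dom (rintegrable_prod_tuple n b0 ib)).
  by apply: (cmeasurable_prod (g := fun i => g (lift ord0 i))) => i; exact: mg.
move=> t; rewrite normc_prod; apply: ler_prod => i _.
by rewrite normc_nneg /=; exact: gb.
Qed.

End TupleIntegral.

(** * Partial derivatives and parameter integrals *)

Section LineDerivative.
Variable R : realType.

(** Only increments along [v] matter: under the hypothesis on [L] the two difference quotients are
    the same function of h, so [L] need not be differentiable in any other direction. *)
Lemma is_derive_line (V W : normedModType R) (f : W -> R) (L : V -> W)
    (x v : V) (w : W) (d : R) :
  (forall h : R, L (h *: v + x) = h *: w + L x) ->
  is_derive (L x) w f d -> is_derive x v (f \o L) d.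
Proof.
move=> hL [fd <-].
have E : (fun h : R => h^-1 *: (((f \o L) \o shift x) (h *: v) - (f \o L) x)) =
    (fun h : R => h^-1 *: ((f \o shift (L x)) (h *: w) - f (L x))).
  by apply/funext => h /=; rewrite hL.
by split; rewrite /derivable/derive E.
Qed.

Lemma is_derive_along (V : normedModType R) (f : V -> R) (x v : V) (d s : R) :
  is_derive (s *: v + x) v f d <-> is_derive s 1 (fun t : R => f (t *: v + x)) d.
Proof.
have E : (fun h : R => h^-1 *: ((f \o shift (s *: v + x)) (h *: v) - f (s *: v + x))) =
  (fun h : R => h^-1 *: (((fun t : R => f (t *: v + x)) \o shift s) (h *: 1)
     - (fun t : R => f (t *: v + x)) s)).
  apply/funext => h; rewrite /shift /=; congr (_ *: (f _ - _)).
  by rewrite addrA -scalerDl [h *: 1]mulr1.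
by split => -[fd <-]; split; [rewrite /derivable -E|rewrite /derive -E|
  rewrite /derivable E|rewrite /derive E].
Qed.

Lemma is_derive_along0 (V : normedModType R) (f : V -> R) (x v : V) (d : R) :
  is_derive x v f d <-> is_derive (0 : R) 1 (fun t : R => f (t *: v + x)) d.
Proof. by have := @is_derive_along V f x v d 0; rewrite scale0r add0r. Qed.

Lemma lipschitz_along (V : normedModType R) (f : V -> R) (v : V) (K : R) :
  (forall x, derivable f x v) -> (forall x, `|'D_v f x| <= K) ->
  forall x s, `|f (s *: v + x) - f x| <= K * `|s|.
Proof.
move=> fd fK x; have pos y t : 0 <= t -> `|f (t *: v + y) - f y| <= K * `|t|.
  move=> t0; pose g (r : R) := f (r *: v + y).
  have gd (r : R) : is_derive r 1 g ('D_v f (r *: v + y)).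
    exact: ((@is_derive_along V f y v _ r).1 (derivableP (fd _))).
  have [|c _] := @MVT_segment R g (fun r => 'D_v f (r *: v + y)) 0 t t0
    (fun r _ => gd r).
    by apply: derivable_within_continuous => r _; exact: (@ex_derive _ _ _ _ _ _ _ (gd r)).
  by rewrite /g scale0r add0r subr0 => ->; rewrite normrM ler_wpM2r.
(* For negative s the two end points are exchanged: start from s v + x and move by -s. *)
move=> s; case: (leP 0 s) => [|s0]; first exact: pos.
have := @pos (s *: v + x) (- s); rewrite addrA -scalerDl addNr scale0r add0r.
by rewrite distrC normrN; apply; rewrite oppr_ge0 ltW.
Qed.

(** Walk from y to x changing one coordinate at a time and apply the one-dimensional bound to each
    leg. *)
Lemma lipschitz_row p (f : 'rV[R]_p -> R) (K : R) :
  (forall x i, derivable f x (delta_mx 0 i)) ->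
  (forall x i, `|'D_(delta_mx 0 i) f x| <= K) ->
  forall x y, `|f x - f y| <= K * \sum_i `|x 0 i - y 0 i|.
Proof.
move=> fd fK x y.
(* The k-th stop of the walk: the first k coordinates are already those of x. *)
pose z k : 'rV[R]_p := \row_i (if (i < k)%N then x 0 i else y 0 i).
have zS k (kp : (k < p)%N) : z k.+1 = (x 0 (Ordinal kp) - y 0 (Ordinal kp)) *:
    delta_mx 0 (Ordinal kp) + z k.
  apply/rowP => i; rewrite !mxE eqxx /= ltnS -(inj_eq val_inj) /=.
  case: ltngtP => [ik|ik|ik]; rewrite ?mulr0 ?add0r//.
  rewrite mulr1; have -> : Ordinal kp = i by apply/val_inj.
  by rewrite subrK.
suff H k : (k <= p)%N -> `|f (z k) - f y| <=
    K * \sum_(i < p | (i < k)%N) `|x 0 i - y 0 i|.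
  have := H p (leqnn p); rewrite (eq_bigl xpredT); last by move=> i; exact: ltn_ord.
  by rewrite (_ : z p = x)//; apply/rowP => i; rewrite mxE ltn_ord.
elim: k => [_|k IH kp].
  rewrite big_pred0_eq mulr0 (_ : z 0%N = y) ?subrr ?normr0//.
  by apply/rowP => i; rewrite mxE.
rewrite (bigD1 (Ordinal kp))//= mulrDr.
apply: le_trans (ler_distD (f (z k)) _ _) _; apply: lerD.
  by rewrite zS; exact: lipschitz_along.
apply: le_trans (IH (ltnW kp)) _.
rewrite le_eqVlt; apply/orP; left; apply/eqP; congr (_ * _).
apply: eq_bigl => i; rewrite ltnS -(inj_eq val_inj) /=.
by case: ltngtP.
Qed.

Lemma continuous_sum (Z : topologicalType) (I : Type) (s : seq I)
    (g : I -> Z -> R) : (forall i, continuous (g i)) ->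
  continuous (fun y => \sum_(i <- s) g i y).
Proof.
move=> cg; elim: s => [|i s IH].
  by under eq_fun do rewrite big_nil; exact: cst_continuous.
under eq_fun do rewrite big_cons.
by move=> y; apply: cvgD; [exact: cg|exact: IH].
Qed.

(** Existence of partial derivatives does not give continuity, but bounded ones give a Lipschitz
    estimate. Parameter integrals get their continuity from here. *)
Lemma lipschitz_continuous p (f : 'rV[R]_p -> R) (K : R) :
  (forall x i, derivable f x (delta_mx 0 i)) ->
  (forall x i, `|'D_(delta_mx 0 i) f x| <= K) -> continuous f.
Proof.
move=> fd fK x; have := lipschitz_row fd fK.
pose g (y : 'rV[R]_p) := K * \sum_i `|x 0 i - y 0 i|.
have gx : g x = 0.
  by rewrite /g big1 ?mulr0// => i _; rewrite subrr normr0.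
have cg : continuous g.
  have cs : continuous (fun y : 'rV[R]_p => \sum_i `|x 0 i - y 0 i|).
    apply: (continuous_sum (g := fun i (y : 'rV[R]_p) => `|x 0 i - y 0 i|)) => i y.
    apply: (@continuous_comp _ _ _ (fun z : 'rV[R]_p => x 0 i - z 0 i) Num.norm).
      by apply: (@cvgB _ _ _ (nbhs y) _ (fun=> x 0 i) (fun z : 'rV[R]_p => z 0 i) (x 0 i) (y 0 i)); [exact: cvg_cst|exact: coord_continuous].
    exact: norm_continuous.
  by move=> y; exact: (@cvgMl_tmp R _ (nbhs y) _ _ K _ (cs y)).
have c0 : g y @[y --> x] --> (0 : R) by rewrite -gx; exact: cg.
move=> H.
have FF : Filter (nbhs x) by exact: nbhs_filter.
apply/(@cvgrPdist_le _ _ _ (nbhs x) FF) => e e0.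
have /(@cvgrPdist_le _ _ _ (nbhs x) FF)/(_ e e0) := c0; apply: filterS => y; rewrite sub0r normrN.
by apply: le_trans; apply: le_trans (H x y) (ler_norm _).
Qed.

End LineDerivative.

(** * Differentiation under the integral sign *)

Section ParameterIntegral.
Context d (Y : measurableType d) (R : realType).
Variable mu : {measure set Y -> \bar R}.

(** The bounds are required for |s| < 1 only, because a majorant such as [omega] is stable under
    translations of bounded length and not under arbitrary ones. *)
Lemma is_derive_Rintegral (f : R -> Y -> R) (df : Y -> R) (B0 B1 : Y -> R) :
  rintegrable mu B0 -> rintegrable mu B1 ->
  (forall s, -1 < s < 1 -> measurable_fun setT (f s)) ->
  (forall s y, -1 < s < 1 -> `|f s y| <= B0 y) ->
  (forall s y, -1 < s < 1 -> derivable (f^~ y) s 1) ->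
  (forall s y, -1 < s < 1 -> `|'D_1 (f^~ y) s| <= B1 y) ->
  (forall y, 'D_1 (f^~ y) 0 = df y) ->
  is_derive (0 : R) 1 (fun s => Rintegral mu setT (f s)) (Rintegral mu setT df).
Proof.
move=> i0 i1 mf fB0 fd fB1 dfE.
have I0 : `](-1 : R), 1[%classic 0 by rewrite /= in_itv/= ltr01 oppr_lt0 ltr01.
have intf (s : R) : `](-1 : R), 1[%classic s -> mu.-integrable setT (EFin \o f s).
  rewrite /= in_itv/= => s1; apply: le_integrable i0 => //.
    by apply/measurable_EFinP; exact: mf.
  by move=> y _; rewrite lee_fin (le_trans (fB0 s y s1))// ler_norm.
have fder s y : `](-1 : R), 1[%classic s -> setT y -> derivable (f^~ y) s 1.
  by rewrite /= in_itv/= => s1 _; exact: fd.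
have B10 y : 0 <= B1 y.
  apply: le_trans (normr_ge0 _) (fB1 0 y _).
  by rewrite ltr01 oppr_lt0 ltr01.
have fub s y : `](-1 : R), 1[%classic s -> setT y -> `|partial1of2 f s y| <= B1 y.
  by rewrite /= in_itv/= => s1 _; rewrite partial1of2E; exact: fB1.
split; first exact: (derivable_under_integral measurableT I0 intf fder B10 i1 fub).
rewrite -derive1E (differentiation_under_integral measurableT I0 intf fder B10 i1 fub).
by apply: eq_Rintegral => y _; rewrite partial1of2E dfE.
Qed.

Lemma is_derive_Rintegral_row p (f : 'rV[R]_p -> Y -> R) (i : 'I_p) x
    (B0 B1 : Y -> R) :
  rintegrable mu B0 -> rintegrable mu B1 ->
  (forall x, measurable_fun setT (f x)) ->
  (forall x y, `|f x y| <= B0 y) ->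
  (forall x y, derivable (f^~ y) x (delta_mx 0 i)) ->
  (forall x y, `|'D_(delta_mx 0 i) (f^~ y) x| <= B1 y) ->
  is_derive x (delta_mx 0 i) (fun x => Rintegral mu setT (f x))
    (Rintegral mu setT (fun y => 'D_(delta_mx 0 i) (f^~ y) x)).
Proof.
move=> i0 i1 mf fB0 fd fB1.
apply: (@is_derive_along0 R 'rV[R]_p (fun x => Rintegral mu setT (f x)) x (delta_mx 0 i) _).2.
have dE (s : R) y : is_derive s 1 (fun t : R => f (t *: delta_mx 0 i + x) y)
    ('D_(delta_mx 0 i) (f^~ y) (s *: delta_mx 0 i + x)).
  exact: ((@is_derive_along R 'rV[R]_p (f^~ y) x _ _ s).1 (derivableP (fd _ y))).
apply: (is_derive_Rintegral (f := fun s => f (s *: delta_mx 0 i + x)) i0 i1).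
- by move=> s _; exact: mf.
- by move=> s y _; exact: fB0.
- by move=> s y _; exact: (@ex_derive _ _ _ _ _ _ _ (dE s y)).
- by move=> s y _; rewrite (@derive_val _ _ _ _ _ _ _ (dE s y)).
- by move=> y; rewrite (@derive_val _ _ _ _ _ _ _ (dE 0 y)) scale0r add0r.
Qed.

End ParameterIntegral.

Section ComplexContinuity.
Variable R : realType.
Local Notation C := R[i].

Definition ccontinuous (Z : topologicalType) (f : Z -> C) : Prop :=
  continuous (fun y => complex.Re (f y)) /\
  continuous (fun y => complex.Im (f y)).

Lemma continuous_rmul (Z : topologicalType) (r s : Z -> R) : continuous r -> continuous s ->
  continuous (fun y => r y * s y).
Proof. by move=> cr cs y; apply: cvgM; [exact: cr|exact: cs]. Qed.

Lemma continuous_rsub (Z : topologicalType) (r s : Z -> R) : continuous r -> continuous s ->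
  continuous (fun y => r y - s y).
Proof. by move=> cr cs y; apply: cvgB; [exact: cr|exact: cs]. Qed.

Lemma continuous_radd (Z : topologicalType) (r s : Z -> R) : continuous r -> continuous s ->
  continuous (fun y => r y + s y).
Proof. by move=> cr cs y; apply: cvgD; [exact: cr|exact: cs]. Qed.

Section General.
Variable Z : topologicalType.
Implicit Types (f g : Z -> C) (r s : Z -> R).

Lemma ccontinuousM f g : ccontinuous f -> ccontinuous g ->
  ccontinuous (fun y => f y * g y).
Proof.
move=> [fR fI] [gR gI]; split.
- by under eq_fun do rewrite cReM; apply: continuous_rsub; exact: continuous_rmul.
- by under eq_fun do rewrite cImM; apply: continuous_radd; exact: continuous_rmul.
Qed.

Lemma ccontinuousD f g : ccontinuous f -> ccontinuous g ->
  ccontinuous (fun y => f y + g y).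
Proof.
move=> [fR fI] [gR gI]; split.
- by under eq_fun do rewrite cReD; exact: continuous_radd.
- by under eq_fun do rewrite cImD; exact: continuous_radd.
Qed.

Lemma ccontinuous_cst (c : C) : ccontinuous (fun _ : Z => c).
Proof. by split; exact: cst_continuous. Qed.

Lemma ccontinuous_real r : continuous r -> ccontinuous (fun y => (r y)%:C).
Proof. by split => //=; exact: cst_continuous. Qed.

Lemma ccontinuous_cis r : continuous r -> ccontinuous (fun y => cis (r y)).
Proof.
move=> cr; split => /= y.
- by apply: (@continuous_comp _ _ _ r cos); [exact: cr|exact: continuous_cos].
- by apply: (@continuous_comp _ _ _ r sin); [exact: cr|exact: continuous_sin].
Qed.

Lemma ccontinuous_comp (W : topologicalType) (f : W -> C) (L : Z -> W) :
  continuous L -> ccontinuous f -> ccontinuous (fun z => f (L z)).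
Proof.
move=> cL [fR fI]; split => y.
- by apply: (@continuous_comp _ _ _ L (fun y => complex.Re (f y)));
    [exact: cL|exact: fR].
- by apply: (@continuous_comp _ _ _ L (fun y => complex.Im (f y)));
    [exact: cL|exact: fI].
Qed.

Lemma continuous_rowP p (L : Z -> 'rV[R]_p) :
  (forall j, continuous (fun z => L z 0 j)) -> continuous L.
Proof.
move=> cL z A [P nP PA].
have h : nbhs z [set z' | forall j, P 0 j (L z' 0 j)].
  apply: filter_forall => j; exact: (cL j z (P 0 j) (nP 0 j)).
by apply: filterS h => z' hz'; apply: PA => i j; rewrite (ord1 i).
Qed.

End General.
End ComplexContinuity.

(** * Partial derivatives of complex functions, and polynomial functions *)

Section Partial.
Variable R : realType.
Local Notation C := R[i].
Variable p : nat.
Implicit Types (f g : 'rV[R]_p -> C) (x : 'rV[R]_p) (i : 'I_p).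

Definition is_partial i f x (d : C) : Prop :=
  is_derive x (delta_mx 0 i) (fun y => complex.Re (f y)) (complex.Re d) /\
  is_derive x (delta_mx 0 i) (fun y => complex.Im (f y)) (complex.Im d).

Lemma is_partialE i f x d : is_partial i f x d -> partial i f x = d.
Proof.
move=> [dR dI]; rewrite /partial (@derive_val _ _ _ _ _ _ _ dR).
by rewrite (@derive_val _ _ _ _ _ _ _ dI); case: d {dR dI}.
Qed.

Lemma C1_is_partial f : C1_fun f -> forall i x, is_partial i f x (partial i f x).
Proof.
by move=> [_ _ fd] i x; have [dR dI] := fd x i; split;
  [exact: (derivableP dR)|exact: (derivableP dI)].
Qed.

Lemma C1_ccontinuous f : C1_fun f -> ccontinuous f.
Proof. by case. Qed.

Lemma is_partial_C1 f (df : 'I_p -> 'rV[R]_p -> C) : ccontinuous f ->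
  (forall i x, is_partial i f x (df i x)) -> C1_fun f.
Proof.
move=> [cR cI] fd; split => // x i; have [dR dI] := fd i x.
by split; [exact: (@ex_derive _ _ _ _ _ _ _ dR)|exact: (@ex_derive _ _ _ _ _ _ _ dI)].
Qed.

Lemma is_partial_real i (r : 'rV[R]_p -> R) x d :
  is_derive x (delta_mx 0 i) r d -> is_partial i (fun y => (r y)%:C) x d%:C.
Proof. by move=> rd; split => //=; exact: is_derive_cst. Qed.

Lemma is_partialD i f g x df dg : is_partial i f x df -> is_partial i g x dg ->
  is_partial i (fun y => f y + g y) x (df + dg).
Proof.
move=> [fR fI] [gR gI]; split.
- by under eq_fun do rewrite cReD; rewrite cReD; exact: is_deriveD.
- by under eq_fun do rewrite cImD; rewrite cImD; exact: is_deriveD.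
Qed.

Lemma is_partialM i f g x df dg : is_partial i f x df -> is_partial i g x dg ->
  is_partial i (fun y => f y * g y) x (df * g x + f x * dg).
Proof.
move=> [fR fI] [gR gI]; split.
- under eq_fun do rewrite cReM; rewrite cReD !cReM.
  apply: is_derive_eq (is_deriveB (is_deriveM fR gR) (is_deriveM fI gI)) _.
  by rewrite /GRing.scale /=; ring.
- under eq_fun do rewrite cImM; rewrite cImD !cImM.
  apply: is_derive_eq (is_deriveD (is_deriveM fR gI) (is_deriveM fI gR)) _.
  by rewrite /GRing.scale /=; ring.
Qed.

Lemma is_partial_cst i (c : C) x : is_partial i (fun=> c) x 0.
Proof. by split; exact: is_derive_cst. Qed.

Lemma is_derive_coord i j x :
  is_derive x (delta_mx 0 i) (fun y : 'rV[R]_p => y 0 j) (i == j)%:R.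
Proof.
apply/is_derive_along0.
have -> : (fun t : R => (t *: delta_mx 0 i + x) 0 j) =
    (fun t => (i == j)%:R *: t) + cst (x 0 j).
  by apply/funext => t; rewrite !mxE eqxx /= eq_sym mulrC.
apply: is_derive_eq (is_deriveD (is_deriveZ _ (is_derive_id _ _)) (is_derive_cst _ _ _)) _.
by rewrite addr0 [_ *: _]mulr1.
Qed.

Lemma is_partial_cis i (r : 'rV[R]_p -> R) x d :
  is_derive x (delta_mx 0 i) r d ->
  is_partial i (fun y => cis (r y)) x ((0 +i* d) * cis (r x)).
Proof.
move=> /is_derive_along0 rd.
have rx : r (0 *: delta_mx 0 i + x) = r x by rewrite scale0r add0r.
split.
- apply/is_derive_along0 => /=.
  apply: is_derive_eq (is_derive1_comp (is_derive_cos _) rd) _.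
  by rewrite rx; ring.
- apply/is_derive_along0 => /=.
  apply: is_derive_eq (is_derive1_comp (is_derive_sin _) rd) _.
  by rewrite rx; ring.
Qed.

Lemma C1_funM f g : C1_fun f -> C1_fun g -> C1_fun (fun y => f y * g y).
Proof.
move=> cf cg.
apply: (is_partial_C1 (df := fun i x => partial i f x * g x + f x * partial i g x)).
  by apply: ccontinuousM; exact: C1_ccontinuous.
by move=> i x; apply: is_partialM; exact: C1_is_partial.
Qed.

Lemma partialM i f g x : C1_fun f -> C1_fun g ->
  partial i (fun y => f y * g y) x = partial i f x * g x + f x * partial i g x.
Proof.
by move=> cf cg; apply: is_partialE; apply: is_partialM; exact: C1_is_partial.
Qed.

Lemma C1_funD f g : C1_fun f -> C1_fun g -> C1_fun (fun y => f y + g y).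
Proof.
move=> cf cg.
apply: (is_partial_C1 (df := fun i x => partial i f x + partial i g x)).
  by apply: ccontinuousD; exact: C1_ccontinuous.
by move=> i x; apply: is_partialD; exact: C1_is_partial.
Qed.

Lemma partialD i f g x : C1_fun f -> C1_fun g ->
  partial i (fun y => f y + g y) x = partial i f x + partial i g x.
Proof.
by move=> cf cg; apply: is_partialE; apply: is_partialD; exact: C1_is_partial.
Qed.

Lemma C1_cst (c : C) : C1_fun (fun _ : 'rV[R]_p => c).
Proof.
by apply: (is_partial_C1 (df := fun _ _ => 0)) => [|i x];
  [exact: ccontinuous_cst|exact: is_partial_cst].
Qed.

Lemma partial_cst i (c : C) x : partial i (fun _ : 'rV[R]_p => c) x = 0.
Proof. exact/is_partialE/is_partial_cst. Qed.

(** Real polynomial functions, generated inductively so that continuity, stability under d_i and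
    multiplication of bounded families are proved by induction on the way a polynomial is built. *)
Inductive polyfun : ('rV[R]_p -> R) -> Prop :=
| polyfun_cst c : polyfun (fun=> c)
| polyfun_coord i : polyfun (fun x => x 0 i)
| polyfunD r s : polyfun r -> polyfun s -> polyfun (fun x => r x + s x)
| polyfunM r s : polyfun r -> polyfun s -> polyfun (fun x => r x * s x).

Lemma polyfun_continuous r : polyfun r -> continuous r.
Proof.
elim=> [c|i|{}r s _ cr _ cs|{}r s _ cr _ cs] y.
- exact: cst_continuous.
- exact: coord_continuous.
- by apply: (@continuousD R _ _ r s); [exact: cr|exact: cs].
- by apply: (@continuousM R _ r s); [exact: cr|exact: cs].
Qed.

Lemma polyfun_derive r : polyfun r -> forall i, exists2 dr, polyfun dr &
  forall x, is_derive x (delta_mx 0 i) r (dr x).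
Proof.
elim=> [c|j|{}r s _ IHr _ IHs|{}r s pr IHr ps IHs] i.
- by exists (fun=> 0) => [|x]; [exact: polyfun_cst|exact: is_derive_cst].
- exists (fun=> (i == j)%:R) => [|x]; first exact: polyfun_cst.
  exact: is_derive_coord.
- have [dr pdr rd] := IHr i; have [ds pds sd] := IHs i.
  exists (fun x => dr x + ds x) => [|x]; first exact: polyfunD.
  exact: is_deriveD.
- have [dr pdr rd] := IHr i; have [ds pds sd] := IHs i.
  exists (fun x => r x * ds x + s x * dr x) => [|x].
    by apply: polyfunD; exact: polyfunM.
  exact: is_derive_eq (is_deriveM (rd x) (sd x)) _.
Qed.

Lemma polyfun_sum (I : Type) (s : seq I) (g : I -> 'rV[R]_p -> R) :
  (forall k, polyfun (g k)) -> polyfun (fun x => \sum_(k <- s) g k x).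
Proof.
move=> pg; elim: s => [|k s IH].
  by under eq_fun do rewrite big_nil; exact: polyfun_cst.
by under eq_fun do rewrite big_cons; exact: polyfunD.
Qed.

Lemma polyfun_prod (I : Type) (s : seq I) (g : I -> 'rV[R]_p -> R) :
  (forall k, polyfun (g k)) -> polyfun (fun x => \prod_(k <- s) g k x).
Proof.
move=> pg; elim: s => [|k s IH].
  by under eq_fun do rewrite big_nil; exact: polyfun_cst.
by under eq_fun do rewrite big_cons; exact: polyfunM.
Qed.

Lemma polyfunX r k : polyfun r -> polyfun (fun x => r x ^+ k).
Proof.
move=> pr; elim: k => [|k IH]; first exact: (polyfun_cst 1).
by under eq_fun do rewrite exprS; exact: polyfunM.
Qed.

Lemma C1_polyfun r : polyfun r -> C1_fun (fun x => (r x)%:C).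
Proof.
move=> pr; have /choice[dr rd] : forall i, exists dr : 'rV[R]_p -> R,
    forall x, is_derive x (delta_mx 0 i) r (dr x).
  by move=> i; have [dr _ rd] := polyfun_derive pr i; exists dr.
apply: (is_partial_C1 (df := fun i x => (dr i x)%:C)).
  exact/ccontinuous_real/polyfun_continuous.
by move=> i x; apply: is_partial_real.
Qed.

End Partial.

Lemma is_partial_line (R : realType) p q (f : 'rV[R]_p -> R[i])
    (L : 'rV[R]_q -> 'rV[R]_p) (i : 'I_q) (j : 'I_p) x d :
  (forall h : R, L (h *: delta_mx 0 i + x) = h *: delta_mx 0 j + L x) ->
  is_partial j f (L x) d -> is_partial i (fun y => f (L y)) x d.
Proof.
move=> hL [fR fI]; split.
- exact: (is_derive_line (f := fun y => complex.Re (f y)) hL fR).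
- exact: (is_derive_line (f := fun y => complex.Im (f y)) hL fI).
Qed.

(** * Bounded families of Schwartz functions *)

Section BoundedFamilies.
Variable R : realType.
Local Notation C := R[i].

Inductive schop (p : nat) := MulX of 'I_p | DerX of 'I_p.

Section Dim.
Variable p : nat.
Implicit Types (f g : 'rV[R]_p -> C) (x : 'rV[R]_p) (i j : 'I_p).

Definition appop (o : schop p) f : 'rV[R]_p -> C :=
  match o with
  | MulX i => fun x => (x 0 i)%:C * f x
  | DerX i => partial i f
  end.

Definition appops (w : seq (schop p)) f := foldr appop f w.

Lemma appops_rcons w o f : appops (rcons w o) f = appops w (appop o f).
Proof. exact: foldr_rcons. Qed.

Lemma appops_DerX s f : appops (map (@DerX p) s) f = partials s f.
Proof. exact: foldr_map. Qed.

(* Families that are bounded in the Schwartz space: allowing all words in the *)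
(* operators x_i and d_i, in any order, makes closure properties coinductive. *)
Definition bddS (I : Type) (u : I -> 'rV[R]_p -> C) : Prop :=
  forall w, (forall k, C1_fun (appops w (u k))) /\
    exists M, forall k x, normc (appops w (u k) x) <= M.

Section Family.
Variable I : Type.
Implicit Types (u v : I -> 'rV[R]_p -> C).

(** Coinduction: if the members of a class of families are C^1 and uniformly bounded, and the class
    is stable under x_i and d_i, then applying a whole word never leaves the class. Closure
    properties below follow by taking for [P] the image of [bddS] under the operation in
    question. *)
Lemma bddS_coind (P : (I -> 'rV[R]_p -> C) -> Prop) :
  (forall u, P u -> forall k, C1_fun (u k)) ->
  (forall u, P u -> exists M, forall k x, normc (u k x) <= M) ->
  (forall u o, P u -> P (fun k => appop o (u k))) ->
  forall u, P u -> bddS u.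
Proof.
move=> PC PB PS u Pu w.
have Pw : P (fun k => appops w (u k)) by elim: w => [|o w IH] //; exact: PS.
by split; [exact: (PC _ Pw)|exact: (PB _ Pw)].
Qed.

Lemma bddS_C1 u : bddS u -> forall k, C1_fun (u k).
Proof. by move=> /(_ [::])[]. Qed.

Lemma bddS_bound u : bddS u -> exists M, forall k x, normc (u k x) <= M.
Proof. by move=> /(_ [::])[]. Qed.

Lemma bddS_op u o : bddS u -> bddS (fun k => appop o (u k)).
Proof.
move=> bu w; have [cu [M uM]] := bu (rcons w o).
split=> [k|]; last exists M => k x; first by have := cu k; rewrite appops_rcons.
by have := uM k x; rewrite appops_rcons.
Qed.

Lemma bddS_ops u w : bddS u -> bddS (fun k => appops w (u k)).
Proof. by move=> bu; elim: w => [|o w IH]//=; exact: bddS_op. Qed.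

Lemma bddS_smooth u : bddS u -> forall k, smooth (u k).
Proof.
move=> bu k s; have [+ _] := bu (map (@DerX p) s) => /(_ k).
by rewrite appops_DerX.
Qed.

Lemma bddS_partials u s : bddS u -> bddS (fun k => partials s (u k)).
Proof.
move=> bu; have := bddS_ops (map (@DerX p) s) bu.
by congr bddS; apply/funext => k; exact: appops_DerX.
Qed.

Lemma bddSZ (c : I -> C) K u : (forall k, normc (c k) <= K) -> bddS u ->
  bddS (fun k x => c k * u k x).
Proof.
move=> cK bu; pose P v := exists2 u, bddS u & v = (fun k x => c k * u k x).
apply: (@bddS_coind P); last by exists u.
- by move=> _ [v bv ->] k; apply: C1_funM; [exact: C1_cst|exact: bddS_C1].
- move=> _ [v bv ->]; have [M vM] := bddS_bound bv; exists (K * M) => k x.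
  by rewrite normcM ler_pM ?normc_nneg.
- move=> _ o [v bv ->]; exists (fun k => appop o (v k)); first exact: bddS_op.
  apply/funext => k; apply/funext => x; case: o => i /=; first by rewrite mulrCA.
  rewrite partialM ?partial_cst ?mul0r ?add0r//; [exact: C1_cst|exact: bddS_C1].
Qed.

Lemma bddSD u v : bddS u -> bddS v -> bddS (fun k x => u k x + v k x).
Proof.
move=> bu bv.
pose P w := exists u v, [/\ bddS u, bddS v & w = (fun k x => u k x + v k x)].
apply: (@bddS_coind P); last by exists u, v.
- by move=> _ [u' [v' [bu' bv' ->]]] k; apply: C1_funD; exact: bddS_C1.
- move=> _ [u' [v' [/bddS_bound[M uM] /bddS_bound[N vN] ->]]].
  exists (M + N) => k x; apply: le_trans (le_normcD _ _) _.
  by rewrite lerD.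
- move=> _ o [u' [v' [bu' bv' ->]]].
  exists (fun k => appop o (u' k)), (fun k => appop o (v' k)).
  split; [exact: bddS_op|exact: bddS_op|].
  apply/funext => k; apply/funext => x; case: o => i /=; first by rewrite mulrDr.
  by rewrite partialD//; exact: bddS_C1.
Qed.

Lemma bddS_polyfun r u : polyfun r -> bddS u ->
  bddS (fun k x => (r x)%:C * u k x).
Proof.
move=> pr; elim: pr u => [c|i|{}r s _ IHr _ IHs|{}r s _ IHr _ IHs] u bu.
- by apply: (bddSZ (c := fun=> c%:C) (K := normc c%:C)).
- exact: (bddS_op (MulX i) bu).
- have := bddSD (IHr _ bu) (IHs _ bu).
  by under eq_fun do under eq_fun do rewrite -mulrDl -rmorphD /=.
- have := IHr _ (IHs _ bu).
  by under eq_fun do under eq_fun do rewrite mulrA -rmorphM /=.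
Qed.

Lemma bddS_polybound r u : polyfun r -> bddS u ->
  exists2 M, 0 <= M & forall k x, `|r x| * normc (u k x) <= M.
Proof.
move=> pr bu; have [M uM] := bddS_bound (bddS_polyfun pr bu).
exists `|M| => // k x; have := uM k x; rewrite normcM normc_real => h.
exact: le_trans h (ler_norm _).
Qed.

(** The derivative of e^(i r) is i (d_i r) e^(i r); as d_i r is again a polynomial, the Leibniz rule
    gives e^(i r) times another bounded family. *)
Lemma bddS_cis r u : polyfun r -> bddS u ->
  bddS (fun k x => cis (r x) * u k x).
Proof.
move=> pr bu; pose P v := exists2 u, bddS u & v = (fun k x => cis (r x) * u k x).
have /choice[dr rd] : forall i, exists dr : 'rV[R]_p -> R, polyfun dr /\
    forall x, is_derive x (delta_mx 0 i) r (dr x).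
  by move=> i; have [dr pdr rd] := polyfun_derive pr i; exists dr.
have cisd i x := is_partial_cis ((rd i).2 x).
have C1cis : C1_fun (fun x => cis (r x)).
  apply: (is_partial_C1 (df := fun i x => (0 +i* dr i x) * cis (r x))) => //.
  exact/ccontinuous_cis/polyfun_continuous.
apply: (@bddS_coind P); last by exists u.
- by move=> _ [v bv ->] k; exact: (C1_funM C1cis (bddS_C1 bv k)).
- move=> _ [v bv ->]; have [M vM] := bddS_bound bv; exists M => k x.
  by rewrite normcM normc_cis mul1r.
- move=> _ [i|i] [v bv ->] /=.
    exists (fun k => appop (MulX i) (v k)); first exact: bddS_op.
    by apply/funext => k; apply/funext => x /=; rewrite mulrCA.
  exists (fun k x => ('i%C : C) * ((dr i x)%:C * v k x) + partial i (v k) x).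
    apply: bddSD; last exact: (bddS_op (DerX i) bv).
    exact: (bddSZ (c := fun=> 'i%C) (fun=> lexx _) (bddS_polyfun (rd i).1 bv)).
  apply/funext => k; apply/funext => x /=.
  rewrite (partialM i x C1cis (bddS_C1 bv k)).
  have -> : partial i (fun x => cis (r x)) x = 'i%C * (dr i x)%:C * cis (r x).
    rewrite (is_partialE (cisd i x)); congr (_ * _).
    apply/eqP; rewrite eq_complex /=.
    by apply/andP; split; apply/eqP; ring.
  by ring.
Qed.

End Family.

Lemma bddS_reindex (I J : Type) (h : J -> I) (u : I -> 'rV[R]_p -> C) :
  bddS u -> bddS (fun k => u (h k)).
Proof.
by move=> bu w; have [cu [M uM]] := bu w; split=> [k|]; [exact: cu|exists M].
Qed.

End Dim.

Section Schwarz.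
Variable V : normedModType R.
Implicit Types (f : V -> R) (x v w : V).

Lemma mean_value_along f v x h : (forall x, derivable f x v) -> 0 <= h ->
  exists2 c, 0 <= c <= h & f (h *: v + x) - f x = 'D_v f (c *: v + x) * h.
Proof.
move=> fd h0; pose g (r : R) := f (r *: v + x).
have gd (r : R) : is_derive r 1 g ('D_v f (r *: v + x)).
  exact: ((@is_derive_along R V f x v _ r).1 (derivableP (fd _))).
have [|c] := @MVT_segment R g (fun r => 'D_v f (r *: v + x)) 0 h h0
  (fun r _ => gd r).
  by apply: derivable_within_continuous => r _; exact: (@ex_derive _ _ _ _ _ _ _ (gd r)).
rewrite in_itv /= => c0h; rewrite /g scale0r add0r subr0 => E.
by exists c.
Qed.

(** Apply the mean value theorem along v to y |-> f(h w + y) - f(y), then along w to the derivative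
    of f along v. *)
Lemma second_difference f v w x h :
  (forall x, derivable f x v) -> (forall x, derivable ('D_v f) x w) -> 0 <= h ->
  exists c c', [/\ 0 <= c <= h, 0 <= c' <= h &
    f (h *: v + (h *: w + x)) - f (h *: v + x) - (f (h *: w + x) - f x) =
    'D_w ('D_v f) (c' *: w + (c *: v + x)) * h * h].
Proof.
move=> fv fvw h0; pose g y := f (h *: w + y) - f y.
have sh y : is_derive y v (fun y => f (h *: w + y)) ('D_v f (h *: w + y)).
  apply: (is_derive_line (f := f) (L := fun y => h *: w + y)).
    by move=> r; rewrite addrCA.
  exact: derivableP.
have gd y : is_derive y v g ('D_v f (h *: w + y) - 'D_v f y).
  apply: is_deriveB => //; exact: derivableP.
have [c c0h] := mean_value_along x (fun y => @ex_derive _ _ _ _ _ _ _ (gd y)) h0.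
rewrite (@derive_val _ _ _ _ _ _ _ (gd _)).
have [c' c0h' ->] := mean_value_along (c *: v + x) fvw h0.
rewrite /g => E; exists c, c'; split => //; rewrite -E.
by rewrite (addrCA (h *: v)).
Qed.

(* Two mean values of the same second difference, one for each order. *)
Lemma derive_comm f v w x :
  (forall x, derivable f x v) -> (forall x, derivable f x w) ->
  (forall x, derivable ('D_v f) x w) -> (forall x, derivable ('D_w f) x v) ->
  continuous ('D_w ('D_v f)) -> continuous ('D_v ('D_w f)) ->
  'D_w ('D_v f) x = 'D_v ('D_w f) x.
Proof.
move=> fv fw fvw fwv cA cB; apply/eqP; rewrite -subr_eq0 -normr_eq0 eq_le normr_ge0 andbT.
apply/ler_addgt0Pr => e e0; rewrite add0r.
have e2 : 0 < e / 2 by rewrite divr_gt0.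
have FF : Filter (nbhs x) by exact: nbhs_filter.
have /(@cvgrPdist_lt _ _ _ (nbhs x) FF)/(_ _ e2) /nbhs_ballP[r1 /= r10 h1] := cA x.
have /(@cvgrPdist_lt _ _ _ (nbhs x) FF)/(_ _ e2) /nbhs_ballP[r2 /= r20 h2] := cB x.
pose r := Num.min r1 r2; have r0 : 0 < r by rewrite lt_min r10.
pose N := `|v| + `|w| + 1.
have N0 : 0 < N by rewrite /N ltr_wpDl// addr_ge0.
(* With this h the displacement is at most h N = r / 2, so all mean value points lie in the ball
   where both mixed derivatives are within e / 2 of their values at x. *)
pose h := r / (2 * N); have h0 : 0 < h by rewrite divr_gt0// mulr_gt0.
have near a b c c' : `|a| + `|b| <= `|v| + `|w| -> 0 <= c <= h -> 0 <= c' <= h ->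
    ball x r (c' *: a + (c *: b + x)).
  move=> ab /andP[c0 ch] /andP[c0' ch']; rewrite -ball_normE /=.
  rewrite addrA opprD addrCA subrr addr0 normrN.
  apply: le_lt_trans (ler_normD _ _) _; rewrite !normrZ !ger0_norm//.
  apply: (@le_lt_trans _ _ (h * N)).
    apply: (@le_trans _ _ (h * (`|v| + `|w|))); last first.
      by apply: ler_wpM2l; [exact: ltW|rewrite /N lerDl].
    apply: (@le_trans _ _ (h * `|a| + h * `|b|)).
      by rewrite lerD// ler_wpM2r.
    by rewrite -mulrDr; apply: ler_wpM2l => //; exact: ltW.
  rewrite /h invfM mulrA mulfVK ?gt_eqF//.
  by rewrite ltr_pdivrMr// mulr2n mulrDr mulr1 ltrDl.
have eq_le1 : `|w| + `|v| <= `|v| + `|w| by rewrite addrC.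
have [c [c' [c1 c2 E1]]] := second_difference x fv fvw (ltW h0).
have [d [d' [d1 d2 E2]]] := second_difference x fw fwv (ltW h0).
(* The second difference is symmetric in v and w; after dividing twice by h its two mean value
   expressions coincide. *)
have E : 'D_w ('D_v f) (c' *: w + (c *: v + x)) = 'D_v ('D_w f) (d' *: v + (d *: w + x)).
  have hh : h != 0 by rewrite gt_eqF.
  have swap (a1 a2 a3 a4 : R) : a1 - a2 - (a3 - a4) = a1 - a3 - (a2 - a4) by ring.
  move: E1; rewrite (addrCA (h *: v)) swap E2 => EE.
  exact: (esym (mulIf hh (mulIf hh EE))).
apply: le_trans (ler_distD ('D_w ('D_v f) (c' *: w + (c *: v + x))) _ _) _.
rewrite (splitr e); apply: lerD.
  apply/ltW/h1; apply: (@le_ball _ _ x r); first by rewrite ge_min lexx.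
  exact: (near w v c c' eq_le1 c1 c2).
rewrite E distrC; apply/ltW/h2; apply: (@le_ball _ _ x r).
  by rewrite ge_min lexx orbT.
exact: near.
Qed.

End Schwarz.
End BoundedFamilies.

(** * Equivalence with the usual Schwartz seminorms *)

Section Seminorms.
Variable R : realType.
Local Notation C := R[i].
Variable p : nat.
Implicit Types (f g : 'rV[R]_p -> C) (x : 'rV[R]_p) (i j : 'I_p).

Lemma smooth_C1 f : smooth f -> C1_fun f.
Proof. by move/(_ [::]). Qed.

Lemma partials_cat s t f : partials (s ++ t) f = partials s (partials t f).
Proof. exact: foldr_cat. Qed.

Lemma smooth_partials s f : smooth f -> smooth (partials s f).
Proof. by move=> sf t; rewrite -partials_cat; exact: sf. Qed.

Lemma partial_comm i j f : smooth f ->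
  partial i (partial j f) = partial j (partial i f).
Proof.
move=> sf.
have comm (r : 'rV[R]_p -> R) :
    (forall k y, derivable r y (delta_mx 0 k)) ->
    (forall k l y, derivable ('D_(delta_mx 0 k) r) y (delta_mx 0 l)) ->
    (forall k l, continuous ('D_(delta_mx 0 l) ('D_(delta_mx 0 k) r))) ->
    forall x, 'D_(delta_mx 0 i) ('D_(delta_mx 0 j) r) x =
      'D_(delta_mx 0 j) ('D_(delta_mx 0 i) r) x.
  move=> d1 d2 c2 x.
  exact: (@derive_comm R 'rV[R]_p r (delta_mx 0 j) (delta_mx 0 i) x (d1 j) (d1 i)
    (d2 j i) (d2 i j) (c2 j i) (c2 i j)).
have d1 := let: And3 _ _ d := sf [::] in d.
have d2 k := let: And3 _ _ d := sf [:: k] in d.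
have ER := comm (fun y => complex.Re (f y)) (fun k y => (d1 y k).1)
  (fun k l y => (d2 k y l).1) (fun k l => let: And3 c _ _ := sf [:: l; k] in c).
have EI := comm (fun y => complex.Im (f y)) (fun k y => (d1 y k).2)
  (fun k l y => (d2 k y l).2) (fun k l => let: And3 _ c _ := sf [:: l; k] in c).
by apply/funext => x; exact: (congr2 (fun a b : R => a +i* b) (ER x) (EI x)).
Qed.

Lemma partials_comm s t f : smooth f ->
  partials s (partials t f) = partials t (partials s f).
Proof.
have one i r g : smooth g -> partial i (partials r g) = partials r (partial i g).
  move=> sg; elim: r => //= j r IH; rewrite -/(partials _ _).
  by rewrite (partial_comm _ _ (smooth_partials r sg)) IH.
move=> sf; elim: s => //= i s IH; rewrite -/(partials _ _) IH.
exact: one (smooth_partials s sf).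
Qed.

Lemma partials_perm s t f : smooth f -> perm_eq s t ->
  partials s f = partials t f.
Proof.
move=> sf st; pose P r := partials s f = partials r f.
apply: (@catCA_perm_ind _ P _ s t) => // s1 s2 s3 E.
rewrite /P E !partials_cat.
exact: partials_comm (smooth_partials s3 sf).
Qed.

(** By the symmetry of mixed derivatives only the number of occurrences of each index matters, which
    passes from words to multi-indices. *)
Lemma partials_mderiv s f : smooth f ->
  partials s f = mderiv [ffun i => count_mem i s] f.
Proof.
move=> sf; apply: partials_perm => //; apply/allP => j _ /=; apply/eqP.
rewrite count_flatten -map_comp sumnE big_map big_enum /=.
rewrite (bigD1 j)//= count_nseq /= eqxx mul1n ffunE.
by rewrite big1 ?addn0// => i /negbTE ij; rewrite count_nseq /= ij.
Qed.

Lemma polyfun_monomial a : polyfun (fun x : 'rV[R]_p => monomial x a).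
Proof. by apply: polyfun_prod => i; apply: polyfunX; exact: polyfun_coord. Qed.

Lemma monomial0 x : monomial x [ffun=> 0%N] = 1.
Proof. by rewrite /monomial big1// => i _; rewrite ffunE. Qed.

Lemma monomial_coord x (a : multiindex p) i :
  monomial x a * x 0 i = monomial x [ffun j => (a j + (i == j))%N].
Proof.
rewrite /monomial; under [RHS]eq_bigr do rewrite ffunE exprD.
rewrite big_split /=; congr (_ * _); rewrite (bigD1 i)//= eqxx expr1.
by rewrite big1 ?mulr1// => j; rewrite eq_sym => /negbTE ->.
Qed.

Lemma mderiv_nil f : mderiv [ffun=> 0%N] f = f.
Proof.
rewrite /mderiv (_ : flatten _ = [::])//.
by elim: (enum _) => //= i s ->; rewrite ffunE.
Qed.

Section Family.
Variable I : Type.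
Implicit Types u v : I -> 'rV[R]_p -> C.

(** Induction on the polynomial: a coordinate raises the multi-index by one, and a product is
    handled by absorbing one factor into the family, which is why [v] varies in the induction. *)
Lemma polyfun_dominated r v : polyfun r ->
  (forall a, exists M, forall k x, `|monomial x a| * normc (v k x) <= M) ->
  forall a, exists M, forall k x,
    `|monomial x a| * (`|r x| * normc (v k x)) <= M.
Proof.
move=> pr; elim: pr v => [c|i|{}r s _ IHr _ IHs|{}r s _ IHr _ IHs] v vM a.
- have [M aM] := vM a; exists (`|c| * M) => k x.
  by rewrite mulrCA ler_wpM2l.
- have [M aM] := vM [ffun j => (a j + (i == j))%N]; exists M => k x.
  by rewrite mulrA -normrM monomial_coord.
- have [M1 h1] := IHr v vM a; have [M2 h2] := IHs v vM a.
  exists (M1 + M2) => k x; apply: le_trans (lerD (h1 k x) (h2 k x)).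
  by rewrite -mulrDr ler_wpM2l// -mulrDl ler_wpM2r ?normc_nneg// ler_normD.
- have vM' b : exists M, forall k x,
      `|monomial x b| * normc ((s x)%:C * v k x) <= M.
    have [M hM] := IHs v vM b; exists M => k x.
    by rewrite normcM normc_real.
  have [M hM] := IHr _ vM' a; exists M => k x.
  by have := hM k x; rewrite normcM normc_real normrM !mulrA.
Qed.

(** The invariant is being a finite sum of polynomials times iterated derivatives of [u]: x_i
    changes the polynomial, and d_i turns each term into two by the Leibniz rule. Each term is
    bounded by finitely many of the usual seminorms. *)
Lemma bddS_seminorms u : (forall k, smooth (u k)) ->
  (forall a b, exists M, forall k x,
    normc ((monomial x a)%:C * mderiv b (u k) x) <= M) ->
  bddS u.
Proof.
move=> su uM.
have sM r s : polyfun r ->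
    exists M, forall k x, normc ((r x)%:C * partials s (u k) x) <= M.
  move=> pr.
  have h a : exists M, forall k x,
      `|monomial x a| * normc (partials s (u k) x) <= M.
    have [M hM] := uM a [ffun i => count_mem i s]; exists M => k x.
    by have := hM k x; rewrite -partials_mderiv// normcM normc_real.
  have [M hM] := polyfun_dominated pr h [ffun=> 0%N]; exists M => k x.
  by have := hM k x; rewrite monomial0 normr1 mul1r normcM normc_real.
pose D (rs : ('rV[R]_p -> R) * seq 'I_p) k x : C :=
  (rs.1 x)%:C * partials rs.2 (u k) x.
pose P v := exists2 l : seq (('rV[R]_p -> R) * seq 'I_p),
  (forall rs, List.In rs l -> polyfun rs.1) &
  v = fun k x => \sum_(rs <- l) D rs k x.
have C1D rs k : polyfun rs.1 -> C1_fun (D rs k).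
  by move=> pr; apply: C1_funM; [exact: C1_polyfun|exact: su].
have C1s l k : (forall rs, List.In rs l -> polyfun rs.1) ->
    C1_fun (fun x => \sum_(rs <- l) D rs k x).
  elim: l => [|rs l IH] pl.
    by under eq_fun do rewrite big_nil; exact: C1_cst.
  under eq_fun do rewrite big_cons; apply: C1_funD.
    by apply: C1D; apply: pl; left.
  by apply: IH => rs' l'; apply: pl; right.
apply: (@bddS_coind _ _ _ P).
- by move=> _ [l pl ->] k; exact: C1s.
- move=> _ [l pl ->]; elim: l pl => [|rs l IH] pl.
    by exists 0 => k x; rewrite big_nil normc0.
  have [|M hM] := IH; first by move=> rs' l'; apply: pl; right.
  have [|M' hM'] := sM rs.1 rs.2; first by apply: pl; left.
  exists (M' + M) => k x; rewrite big_cons; apply: le_trans (le_normcD _ _) _.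
  exact: lerD (hM' k x) (hM k x).
- move=> _ [i|i] [l pl ->] /=.
    exists [seq ((fun x => x 0 i * rs.1 x), rs.2) | rs <- l].
      move=> rs /List.in_map_iff[rs' [<- l']] /=.
      by apply: polyfunM; [exact: polyfun_coord|exact: pl].
    apply/funext => k; apply/funext => x; rewrite big_map mulr_sumr.
    by apply: eq_bigr => rs _; rewrite /D /= rmorphM mulrA.
  elim: l pl => [|rs l IH] pl.
    exists [::] => //; apply/funext => k; apply/funext => x.
    by under eq_fun do rewrite big_nil; rewrite big_nil partial_cst.
  have [|l' pl' E] := IH; first by move=> rs' l'; apply: pl; right.
  have prs : polyfun rs.1 by apply: pl; left.
  have [dr pdr rd] := polyfun_derive prs i.
  exists [:: (dr, rs.2), (rs.1, i :: rs.2) & l'].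
    by move=> rs' /= [<-//|[<-//|]]; exact: pl'.
  apply/funext => k; apply/funext => x; rewrite !big_cons.
  under eq_fun do rewrite big_cons.
  rewrite partialD; last 2 first.
  + exact: C1D.
  + by apply: C1s => rs' l2; apply: pl; right.
  rewrite addrA; congr (_ + _); last by have := congr1 (fun h => h k x) E.
  rewrite partialM; [|exact: C1_polyfun|exact: su].
  by rewrite (is_partialE (is_partial_real (rd x))).
- exists [:: (fun=> 1, [::])].
    by move=> rs /= [<-|//] /=; exact: polyfun_cst.
  by apply/funext => k; apply/funext => x; rewrite big_seq1 /D /= mul1r.
Qed.

Lemma bddS_monomial u a b : bddS u -> exists2 M, 0 <= M & forall k x,
  normc ((monomial x a)%:C * mderiv b (u k) x) <= M.
Proof.
move=> bu.
have [M M0 hM] := bddS_polybound (polyfun_monomial a)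
  (bddS_partials (flatten [seq nseq (b i) i | i <- enum 'I_p]) bu).
by exists M => // k x; rewrite normcM normc_real; exact: hM.
Qed.

End Family.
End Seminorms.

(** * Parameter integrals of complex functions *)

Section ComplexParameterIntegral.
Context d (Y : measurableType d) (R : realType).
Variable mu : {measure set Y -> \bar R}.
Local Notation C := R[i].
Variables (p : nat) (f : 'rV[R]_p -> Y -> C) (df : 'I_p -> 'rV[R]_p -> Y -> C).
Variables (B0 B1 : Y -> R).
Hypotheses (iB0 : rintegrable mu B0) (iB1 : rintegrable mu B1).
Hypothesis mf : forall x, cmeasurable (f x).
Hypothesis fB0 : forall x y, normc (f x y) <= B0 y.
Hypothesis fd : forall i x y, is_partial i (f^~ y) x (df i x y).
Hypothesis dfB1 : forall i x y, normc (df i x y) <= B1 y.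

Lemma is_partial_cintegral i x :
  is_partial i (fun x => cintegral mu (f x)) x (cintegral mu (df i x)).
Proof.
split => /=.
- have E y z : is_derive z (delta_mx 0 i) (fun z => complex.Re (f z y))
    (complex.Re (df i z y)) by have [] := fd i z y.
  rewrite (_ : (fun y => complex.Re (df i x y)) =
    (fun y => 'D_(delta_mx 0 i) (fun z => complex.Re (f z y)) x)); last first.
    by apply/funext => y; rewrite (@derive_val _ _ _ _ _ _ _ (E y x)).
  apply: (@is_derive_Rintegral_row d Y R mu p (fun z y => complex.Re (f z y)) i x B0 B1 iB0 iB1).
  + by move=> z; case: (mf z).
  + by move=> z y; exact: le_trans (normRe _) (fB0 z y).
  + by move=> z y; exact: (@ex_derive _ _ _ _ _ _ _ (E y z)).
  + move=> z y; rewrite (@derive_val _ _ _ _ _ _ _ (E y z)).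
    exact: le_trans (normRe _) (dfB1 i z y).
- have E y z : is_derive z (delta_mx 0 i) (fun z => complex.Im (f z y))
    (complex.Im (df i z y)) by have [] := fd i z y.
  rewrite (_ : (fun y => complex.Im (df i x y)) =
    (fun y => 'D_(delta_mx 0 i) (fun z => complex.Im (f z y)) x)); last first.
    by apply/funext => y; rewrite (@derive_val _ _ _ _ _ _ _ (E y x)).
  apply: (@is_derive_Rintegral_row d Y R mu p (fun z y => complex.Im (f z y)) i x B0 B1 iB0 iB1).
  + by move=> z; case: (mf z).
  + by move=> z y; exact: le_trans (normIm _) (fB0 z y).
  + by move=> z y; exact: (@ex_derive _ _ _ _ _ _ _ (E y z)).
  + move=> z y; rewrite (@derive_val _ _ _ _ _ _ _ (E y z)).
    exact: le_trans (normIm _) (dfB1 i z y).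
Qed.

Hypothesis mdf : forall i x, cmeasurable (df i x).

(** Continuity needs no limit argument: the partial derivatives are integrals bounded uniformly in
    x, so the integral is Lipschitz. *)
Lemma C1_cintegral : C1_fun (fun x => cintegral mu (f x)).
Proof.
have bd i x := normc_cintegral iB1 (mdf i x) (dfB1 i x).
have ip i x := is_partial_cintegral i x.
apply: (is_partial_C1 (df := fun i x => cintegral mu (df i x))) => //.
split; apply: (lipschitz_continuous (K := 2 * Rintegral mu setT B1)) => x i.
- by have [h _] := ip i x; exact: (@ex_derive _ _ _ _ _ _ _ h).
- have [h _] := ip i x; rewrite (@derive_val _ _ _ _ _ _ _ h).
  exact: le_trans (normRe _) (bd i x).
- by have [_ h] := ip i x; exact: (@ex_derive _ _ _ _ _ _ _ h).
- have [_ h] := ip i x; rewrite (@derive_val _ _ _ _ _ _ _ h).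
  exact: le_trans (normIm _) (bd i x).
Qed.

End ComplexParameterIntegral.

(** * Integrals over R^n *)

Section IntegralRn.
Variable R : realType.
Local Notation C := R[i].
Local Notation muT := (lebesgue_tuple R).
Variable n : nat.
Implicit Types (f g h : 'rV[R]_n -> C).

Definition omega_bounded f := ccontinuous f /\
  exists M, forall y, normc (f y) <= M * omega y.

Definition Omega : R := Rintegral (muT n) setT (fun t => omega (row_of_tuple t)).

Lemma rintegrableMomega (M : R) :
  rintegrable (muT n) (fun t => M * omega (row_of_tuple t)).
Proof.
rewrite /rintegrable (_ : _ \o _ = (fun t => M%:E * (omega (row_of_tuple t))%:E)%E).
  apply: integrableZl => //; exact: rintegrable_omega.
by apply/funext => t; rewrite /= EFinM.
Qed.

Lemma cmeasurable_Rn f : ccontinuous f ->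
  cmeasurable (fun t : n.-tuple (measurableTypeR R) => f (row_of_tuple t)).
Proof. by move=> [cR cI]; exact: cmeasurable_row. Qed.

Lemma omega_bounded_cintegrable f : omega_bounded f ->
  cintegrable (muT n) (fun t => f (row_of_tuple t)).
Proof.
move=> [cf [M fM]]; apply: (cintegrable_dom (rintegrableMomega M)).
  exact: cmeasurable_Rn.
by move=> t; exact: fM.
Qed.

Lemma omega_boundedZ (c : C) f : omega_bounded f ->
  omega_bounded (fun y => c * f y).
Proof.
move=> [cf [M fM]]; split.
  by apply: ccontinuousM => //; exact: ccontinuous_cst.
by exists (normc c * M) => y; rewrite normcM -mulrA ler_wpM2l ?normc_nneg.
Qed.

Lemma omega_boundedD f g : omega_bounded f -> omega_bounded g ->
  omega_bounded (fun y => f y + g y).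
Proof.
move=> [cf [M fM]] [cg [N gN]]; split; first exact: ccontinuousD.
exists (M + N) => y; apply: le_trans (le_normcD _ _) _.
by rewrite mulrDl lerD.
Qed.

Lemma integral_RnZ (c : C) f : omega_bounded f ->
  integral_Rn (fun y => c * f y) = c * integral_Rn f.
Proof. by move=> fo; apply: cintegralZ; exact: omega_bounded_cintegrable. Qed.

Lemma integral_RnD f g : omega_bounded f -> omega_bounded g ->
  integral_Rn (fun y => f y + g y) = integral_Rn f + integral_Rn g.
Proof. by move=> fo go; apply: cintegralD; exact: omega_bounded_cintegrable. Qed.

Lemma eq_integral_Rn f g : f =1 g -> integral_Rn f = integral_Rn g.
Proof. by move=> fg; congr integral_Rn; exact/funext. Qed.

Lemma normc_integral_Rn f M : ccontinuous f ->
  (forall y, normc (f y) <= M * omega y) ->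
  normc (integral_Rn f) <= 2 * (M * Omega).
Proof.
move=> cf fM; have := @normc_cintegral _ _ _ (muT n)
  (fun t => M * omega (row_of_tuple t)) (fun t => f (row_of_tuple t))
  (rintegrableMomega M) (cmeasurable_Rn cf) (fun t => fM _).
rewrite RintegralZl//; exact: rintegrable_omega.
Qed.

Lemma integral_Rn_affine (a : 'rV[R]_n) k f : 0 < k -> omega_bounded f ->
  integral_Rn (fun y => f (a + k *: y)) = (k^-1 ^+ n)%:C * integral_Rn f.
Proof.
move=> k0 fo; rewrite -(cintegral_tuple_affine a k0 (omega_bounded_cintegrable fo)).
by apply: eq_cintegral => t; rewrite row_of_tuple_affine.
Qed.

(** Only the factor j changes. There z^2 <= 2 (t + z)^2 + 2 t^2, the difference being (2 t + z)^2,
    and t^2 <= 1 makes 3 a sufficient constant. *)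
Lemma omega_translate j (t : R) (y : 'rV[R]_n) : `|t| <= 1 ->
  omega (t *: delta_mx 0 j + y) <= 3 * omega y.
Proof.
move=> t1; rewrite /omega (bigD1 j)//= [in leRHS](bigD1 j)//= mulrA.
rewrite (eq_bigr (fun i => (1 + y 0 i ^+ 2)^-1)); last first.
  by move=> i ij; rewrite !mxE eqxx /= (negbTE ij) mulr0 add0r.
apply: ler_wpM2r.
  by apply: prodr_ge0 => i _; rewrite invr_ge0 addr_ge0// sqr_ge0.
rewrite !mxE !eqxx mulr1; set z := y 0 j.
have z1 : 0 < 1 + z ^+ 2 by rewrite ltr_wpDr// sqr_ge0.
have z2 : 0 < 1 + (t + z) ^+ 2 by rewrite ltr_wpDr// sqr_ge0.
rewrite ler_pdivlMr// mulrC ler_pdivrMr//.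
have t2 : t ^+ 2 <= 1 by rewrite -real_normK ?num_real// expr_le1.
have : 0 <= (2 * t + z) ^+ 2 by exact: sqr_ge0.
have : 0 <= (t + 2 * z) ^+ 2 by exact: sqr_ge0.
have : 0 <= z ^+ 2 by exact: sqr_ge0.
rewrite -/z in z1 z2 *; nra.
Qed.

(* The integral of r (y + s e_j) does not depend on s; differentiate at s = 0. *)
Lemma Rintegral_derive0 (r dr : 'rV[R]_n -> R) j (M0 M1 : R) :
  continuous r -> (forall y, is_derive y (delta_mx 0 j) r (dr y)) ->
  (forall y, `|r y| <= M0 * omega y) -> (forall y, `|dr y| <= M1 * omega y) ->
  (forall s : R, Rintegral (muT n) setT
      (fun t => r (s *: delta_mx 0 j + row_of_tuple t)) =
    Rintegral (muT n) setT (fun t => r (row_of_tuple t))) ->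
  Rintegral (muT n) setT (fun t => dr (row_of_tuple t)) = 0.
Proof.
move=> cr rd rM drM rc; pose e : 'rV[R]_n := delta_mx 0 j.
have nn M (f : 'rV[R]_n -> R) : (forall y, `|f y| <= M * omega y) -> 0 <= M.
  move=> /(_ 0); have := normr_ge0 (f 0); move=> /le_trans H /H.
  by rewrite pmulr_lge0// omega_gt0.
have bd M (f : 'rV[R]_n -> R) : (forall y, `|f y| <= M * omega y) ->
    forall (s : R) y, -1 < s < 1 -> `|f (s *: e + y)| <= (3 * M) * omega y.
  move=> fM s y /andP[s1 s2]; apply: le_trans (fM _) _.
  rewrite (mulrC 3) -mulrA; apply: ler_wpM2l; first exact: nn fM.
  by apply: omega_translate; rewrite ler_norml !ltW.
have tr (s : R) : continuous (fun y : 'rV[R]_n => s *: e + y).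
  move=> y; apply: (@cvgD _ _ _ (nbhs y) _ (fun=> s *: e) id).
    exact: cvg_cst.
  exact: cvg_id.
pose f (s : R) (t : n.-tuple (measurableTypeR R)) : R := r (s *: e + row_of_tuple t).
have mf s : measurable_fun setT (f s).
  apply: (@measurable_row_of_tuple R n (fun y => r (s *: e + y))) => y.
  apply: (@continuous_comp _ _ _ (fun y => s *: e + y) r); [exact: tr|exact: cr].
have E (s : R) t : is_derive s 1 (f^~ t) (dr (s *: e + row_of_tuple t)).
  exact: ((@is_derive_along R 'rV[R]_n r (row_of_tuple t) e _ s).1 (rd _)).
have H : is_derive (0 : R) 1 (fun s => Rintegral (muT n) setT (f s))
    (Rintegral (muT n) setT (fun t => dr (row_of_tuple t))).
  apply: (@is_derive_Rintegral _ _ R (muT n) f (fun t => dr (row_of_tuple t)) _ _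
    (rintegrableMomega (3 * M0)) (rintegrableMomega (3 * M1))).
  - by move=> s _; exact: mf.
  - by move=> s t s1; exact: bd.
  - by move=> s t s1; exact: (@ex_derive _ _ _ _ _ _ _ (E s t)).
  - move=> s t s1; rewrite (@derive_val _ _ _ _ _ _ _ (E s t)).
    exact: (bd M1 dr).
  - move=> t; rewrite (@derive_val _ _ _ _ _ _ _ (E 0 t)).
    by rewrite scale0r add0r.
rewrite -(@derive_val _ _ _ _ _ _ _ H) (_ : (fun s => _) =
  cst (Rintegral (muT n) setT (fun t => r (row_of_tuple t)))) ?derive_cst//.
by apply/funext => s; exact: rc.
Qed.

(** This is integration by parts without boundary terms: translation invariance of the measure
    replaces the passage to the limit over boxes. *)
Lemma integral_Rn_partial0 h j : C1_fun h -> omega_bounded h ->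
  omega_bounded (partial j h) -> integral_Rn (partial j h) = 0.
Proof.
move=> ch ho [cdh [M1 hM1]]; have [[cR cI] [M0 hM0]] := ho.
pose e : 'rV[R]_n := delta_mx 0 j.
have const t : integral_Rn (fun y => h (t *: e + y)) = integral_Rn h.
  have := integral_Rn_affine (t *: e) ltr01 ho; rewrite invr1 expr1n mul1r => <-.
  by apply: eq_integral_Rn => y; rewrite scale1r.
have ip y := C1_is_partial ch j y.
apply/eqP; rewrite eq_complex; apply/andP; split; apply/eqP.
- apply: (@Rintegral_derive0 (fun y => complex.Re (h y))
    (fun y => complex.Re (partial j h y)) j M0 M1 cR).
  + by move=> y; have [] := ip y.
  + by move=> y; exact: le_trans (normRe _) (hM0 y).
  + by move=> y; exact: le_trans (normRe _) (hM1 y).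
  + by move=> s; have := const s => /(congr1 (@complex.Re R)).
- apply: (@Rintegral_derive0 (fun y => complex.Im (h y))
    (fun y => complex.Im (partial j h y)) j M0 M1 cI).
  + by move=> y; have [] := ip y.
  + by move=> y; exact: le_trans (normIm _) (hM0 y).
  + by move=> y; exact: le_trans (normIm _) (hM1 y).
  + by move=> s; have := const s => /(congr1 (@complex.Im R)).
Qed.

End IntegralRn.

(** * Partial Fourier transforms and kernel operators *)

Section KernelOperators.
Variable R : realType.
Local Notation C := R[i].
Local Notation muT := (lebesgue_tuple R).
Variables m n : nat.
Implicit Types (x : 'rV[R]_m) (w y z : 'rV[R]_n) (X : 'rV[R]_(m + n)).
Implicit Types (f : 'rV[R]_(m + n) -> C).

Lemma addZdeltaE q (h : R) (k l : 'I_q) (v : 'rV[R]_q) :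
  (h *: delta_mx 0 k + v) 0 l = h * (l == k)%:R + v 0 l.
Proof. by rewrite !mxE eqxx. Qed.

Lemma lrsplit (k : 'I_(m + n)) :
  (exists l, k = lshift n l) \/ (exists l, k = rshift m l).
Proof.
by case: (splitP k) => l kl; [left|right]; exists l; apply/val_inj.
Qed.

Lemma row_mx_shiftl i (h : R) x w :
  row_mx (h *: delta_mx 0 i + x) w = h *: delta_mx 0 (lshift n i) + row_mx x w.
Proof.
apply/rowP => k; case: (lrsplit k) => -[l ->]; rewrite addZdeltaE.
  by rewrite !row_mxEl addZdeltaE (inj_eq (@lshift_inj _ _)).
by rewrite !row_mxEr eq_rlshift mulr0 add0r.
Qed.

Lemma row_mx_shiftr j (h : R) x w :
  row_mx x (h *: delta_mx 0 j + w) = h *: delta_mx 0 (rshift m j) + row_mx x w.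
Proof.
apply/rowP => k; case: (lrsplit k) => -[l ->]; rewrite addZdeltaE.
  by rewrite !row_mxEl eq_lrshift mulr0 add0r.
by rewrite !row_mxEr addZdeltaE (inj_eq (@rshift_inj _ _)).
Qed.

Lemma lsubmx_shiftl i (h : R) X :
  lsubmx (h *: delta_mx 0 (lshift n i) + X) = h *: delta_mx 0 i + lsubmx X.
Proof.
apply/rowP => k; rewrite addZdeltaE [LHS]mxE addZdeltaE [in RHS]mxE.
by rewrite (inj_eq (@lshift_inj _ _)).
Qed.

Lemma lsubmx_shiftr j (h : R) X :
  lsubmx (h *: delta_mx 0 (rshift m j) + X) = lsubmx X.
Proof.
by apply/rowP => k; rewrite [LHS]mxE addZdeltaE [RHS]mxE eq_lrshift mulr0 add0r.
Qed.

Lemma rsubmx_shiftl i (h : R) X :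
  rsubmx (h *: delta_mx 0 (lshift n i) + X) = rsubmx X.
Proof.
by apply/rowP => k; rewrite [LHS]mxE addZdeltaE [RHS]mxE eq_rlshift mulr0 add0r.
Qed.

Lemma rsubmx_shiftr j (h : R) X :
  rsubmx (h *: delta_mx 0 (rshift m j) + X) = h *: delta_mx 0 j + rsubmx X.
Proof.
apply/rowP => k; rewrite addZdeltaE [LHS]mxE addZdeltaE [in RHS]mxE.
by rewrite (inj_eq (@rshift_inj _ _)).
Qed.

Lemma continuous_row_mx (Z : topologicalType) (a : Z -> 'rV[R]_m)
    (b : Z -> 'rV[R]_n) : continuous a -> continuous b ->
  continuous (fun t => row_mx (a t) (b t)).
Proof.
move=> ca cb; apply: continuous_rowP => k; case: (lrsplit k) => -[l ->].
  under eq_fun do rewrite row_mxEl.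
  move=> t.
  apply: (@continuous_comp _ _ _ a (fun x => x 0 l)); first exact: ca.
  exact: coord_continuous.
under eq_fun do rewrite row_mxEr.
move=> t.
apply: (@continuous_comp _ _ _ b (fun z => z 0 l)); first exact: cb.
exact: coord_continuous.
Qed.

Lemma polyfun_rsubmx (r : 'rV[R]_n -> R) : polyfun r ->
  polyfun (fun X : 'rV[R]_(m + n) => r (rsubmx X)).
Proof.
elim=> [c|i|{}r s _ pr _ ps|{}r s _ pr _ ps].
- exact: polyfun_cst.
- by under eq_fun do rewrite mxE; exact: polyfun_coord.
- exact: polyfunD.
- exact: polyfunM.
Qed.

Lemma polyfun_omegaV : polyfun (fun w : 'rV[R]_n => (omega w)^-1).
Proof.
rewrite /omega; under eq_fun do rewrite -prodfV.
apply: polyfun_prod => i; under eq_fun do rewrite invrK.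
apply: polyfunD; first exact: polyfun_cst.
by apply: polyfunX; exact: polyfun_coord.
Qed.

(** The polynomial r / omega in the second variable is absorbed by the seminorms; dividing back
    leaves a factor [omega], uniformly in the index and in x. *)
Lemma bddS_decay (I : Type) (u : I -> 'rV[R]_(m + n) -> C) (r : 'rV[R]_n -> R) :
  polyfun r -> bddS u -> exists2 M, 0 <= M &
    forall k x w, `|r w| * normc (u k (row_mx x w)) <= M * omega w.
Proof.
move=> pr bu.
have [M M0 hM] := bddS_polybound
  (polyfun_rsubmx (polyfunM polyfun_omegaV pr)) bu.
exists M => // k x w; rewrite -ler_pdivrMr ?omega_gt0// mulrC mulrA.
have := hM k (row_mx x w).
by rewrite row_mxKr normrM ger0_norm// invr_ge0 omega_ge0.
Qed.

Lemma bddS_decay1 (I : Type) (u : I -> 'rV[R]_(m + n) -> C) : bddS u ->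
  exists2 M, 0 <= M & forall k x w, normc (u k (row_mx x w)) <= M * omega w.
Proof.
move=> bu; have [M M0 hM] := bddS_decay (@polyfun_cst R n 1) bu.
by exists M => // k x w; have := hM k x w; rewrite normr1 mul1r.
Qed.

Lemma dotrv_polyfun p (a : 'rV[R]_p) : polyfun (fun y : 'rV[R]_p => dotrv a y).
Proof.
apply: polyfun_sum => i; apply: polyfunM; last exact: polyfun_coord.
exact: polyfun_cst.
Qed.

Lemma dotrvC p (a b : 'rV[R]_p) : dotrv a b = dotrv b a.
Proof. by apply: eq_bigr => i _; rewrite mulrC. Qed.

Lemma is_derive_dotrv p (a : 'rV[R]_p) j (x : 'rV[R]_p) :
  is_derive x (delta_mx 0 j) (fun y : 'rV[R]_p => dotrv a y) (a 0 j).
Proof.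
apply/is_derive_along0.
have -> : (fun t : R => dotrv a (t *: delta_mx 0 j + x)) =
    (fun t => a 0 j *: t) + cst (dotrv a x).
  apply/funext => t; transitivity (a 0 j * t + dotrv a x); last by [].
  rewrite /dotrv (bigD1 j)//= [in RHS](bigD1 j)//= addZdeltaE eqxx mulr1.
  rewrite mulrDr -addrA; congr (_ + (_ + _)); apply: eq_bigr => i /negbTE ij.
  by rewrite addZdeltaE ij mulr0 add0r.
apply: is_derive_eq (is_deriveD (is_deriveZ _ (is_derive_id _ _)) (is_derive_cst _ _ _)) _.
by rewrite addr0 [_ *: _]mulr1.
Qed.

(** The unnormalised Fourier transform in the last n variables only. The sign s = 1 or -1 of the
    exponent covers the transform and its inverse at once, and m = 0 gives the full transform. *)
Definition fourier2 (s : R) f : 'rV[R]_(m + n) -> C := fun X =>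
  integral_Rn (fun w => cis (s * dotrv (rsubmx X) w) * f (row_mx (lsubmx X) w)).

Lemma ccontinuous_fourier2_integrand s f X : ccontinuous f ->
  ccontinuous (fun w => cis (s * dotrv (rsubmx X) w) * f (row_mx (lsubmx X) w)).
Proof.
move=> cf; apply: ccontinuousM.
  apply: ccontinuous_cis; apply: polyfun_continuous.
  by apply: polyfunM; [exact: polyfun_cst|exact: dotrv_polyfun].
apply: (ccontinuous_comp (f := f)) => //.
by apply: continuous_row_mx; [exact: cst_continuous|move=> y; exact: cvg_id].
Qed.

Lemma bddS_C1_row (I : Type) (u : I -> 'rV[R]_(m + n) -> C) k x : bddS u ->
  C1_fun (fun w => u k (row_mx x w)) /\
  forall j w, partial j (fun w => u k (row_mx x w)) w =
    partial (rshift m j) (u k) (row_mx x w).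
Proof.
move=> bu; have cu := bddS_C1 bu k.
have ip j w : is_partial j (fun w => u k (row_mx x w)) w
    (partial (rshift m j) (u k) (row_mx x w)).
  apply: (is_partial_line (j := rshift m j) (f := u k) (L := fun w => row_mx x w)).
    by move=> h; rewrite row_mx_shiftr.
  exact: C1_is_partial.
split; last by move=> j w; exact: is_partialE.
apply: (is_partial_C1 _ ip); apply: ccontinuous_comp (C1_ccontinuous cu).
by apply: continuous_row_mx; [exact: cst_continuous|move=> y; exact: cvg_id].
Qed.

Section Fourier.
Variable s : R.
Hypothesis ss1 : s * s = 1.
Variable I : Type.
Implicit Types u v : I -> 'rV[R]_(m + n) -> C.

(* The effect on the argument of a derivative, resp. a multiplication, of the *)
(* partial Fourier transform. *)
Let FD (o : 'I_(m + n)) u : I -> 'rV[R]_(m + n) -> C :=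
  match fintype.split o with
  | inl _ => fun k => appop (DerX o) (u k)
  | inr _ => fun k X => (0 +i* s) * appop (MulX o) (u k) X
  end.

Let FM (o : 'I_(m + n)) u : I -> 'rV[R]_(m + n) -> C :=
  match fintype.split o with
  | inl _ => fun k => appop (MulX o) (u k)
  | inr _ => fun k X => (0 +i* s) * appop (DerX o) (u k) X
  end.

Let bddS_D o u : bddS u -> bddS (FD o u).
Proof.
rewrite /FD; case: (fintype.split o) => _ bu; first exact: (bddS_op (DerX o)).
apply: (bddSZ (c := fun=> 0 +i* s) (K := normc (0 +i* s))) => //.
exact: (bddS_op (MulX o)).
Qed.

Let bddS_M o u : bddS u -> bddS (FM o u).
Proof.
rewrite /FM; case: (fintype.split o) => _ bu; first exact: (bddS_op (MulX o)).
apply: (bddSZ (c := fun=> 0 +i* s) (K := normc (0 +i* s))) => //.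
exact: (bddS_op (DerX o)).
Qed.

Let phase_derive o X w : is_derive X (delta_mx 0 o)
    (fun X : 'rV[R]_(m + n) => s * dotrv (rsubmx X) w)
    (match fintype.split o with inl _ => 0 | inr j => s * w 0 j end).
Proof.
case: split_ordP => j ->.
  apply/is_derive_along0; under eq_fun do rewrite rsubmx_shiftl.
  exact: is_derive_cst.
apply: (is_derive_line (f := fun z => s * dotrv z w) (L := fun X => rsubmx X)
  (w := delta_mx 0 j)); first by move=> h; exact: rsubmx_shiftr.
under eq_fun do rewrite dotrvC.
exact: is_deriveZ (is_derive_dotrv w j (rsubmx X)).
Qed.

Let integrand_is_partial o u k X w : bddS u ->
  is_partial o (fun X => cis (s * dotrv (rsubmx X) w) * u k (row_mx (lsubmx X) w)) X
    (cis (s * dotrv (rsubmx X) w) * FD o u k (row_mx (lsubmx X) w)).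
Proof.
move=> bu; have cu := bddS_C1 bu k.
have := is_partial_cis (phase_derive o X w); rewrite /FD.
case: split_ordP => j -> ph.
  have h2 : is_partial (lshift n j) (fun X => u k (row_mx (lsubmx X) w)) X
      (partial (lshift n j) (u k) (row_mx (lsubmx X) w)).
    apply: (is_partial_line (j := lshift n j) (f := u k)
      (L := fun X => row_mx (lsubmx X) w)); last exact: C1_is_partial.
    by move=> h; rewrite lsubmx_shiftl row_mx_shiftl.
  by have := is_partialM ph h2; rewrite mul0r mul0r add0r.
have h2 : is_partial (rshift m j) (fun X => u k (row_mx (lsubmx X) w)) X 0.
  by split; apply/is_derive_along0; under eq_fun do rewrite lsubmx_shiftr;
    exact: is_derive_cst.
have E : 0 +i* (s * w 0 j) = (0 +i* s) * (w 0 j)%:C.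
  by apply/eqP; rewrite eq_complex /=; apply/andP; split; apply/eqP; ring.
have := is_partialM ph h2; rewrite mulr0 addr0 E.
set c := cis _; rewrite (_ : c * _ = (0 +i* s) * (w 0 j)%:C * c *
  u k (row_mx (lsubmx X) w))// /= row_mxEr.
by ring.
Qed.

Lemma fourier2_partial u k : bddS u -> C1_fun (fourier2 s (u k)) /\
  forall o X, is_partial o (fourier2 s (u k)) X (fourier2 s (FD o u k) X).
Proof.
move=> bu; have [A A0 hA] := bddS_decay1 bu.
pose f X (t : n.-tuple (measurableTypeR R)) :=
  cis (s * dotrv (rsubmx X) (row_of_tuple t)) * u k (row_mx (lsubmx X) (row_of_tuple t)).
pose df o X (t : n.-tuple (measurableTypeR R)) :=
  cis (s * dotrv (rsubmx X) (row_of_tuple t)) *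
  FD o u k (row_mx (lsubmx X) (row_of_tuple t)).
have /choice[B hB] : forall o, exists B, forall k x w,
    normc (FD o u k (row_mx x w)) <= B * omega w.
  by move=> o'; have [B _ hB] := bddS_decay1 (bddS_D o' bu); exists B.
(* One majorant that serves all directions of differentiation at the same time. *)
pose B1 := \sum_o `|B o|.
have mf X' : cmeasurable (f X').
  exact: (cmeasurable_Rn (ccontinuous_fourier2_integrand s X' (C1_ccontinuous (bddS_C1 bu k)))).
have mdf o' X' : cmeasurable (df o' X').
  exact: (cmeasurable_Rn (ccontinuous_fourier2_integrand s X'
    (C1_ccontinuous (bddS_C1 (bddS_D o' bu) k)))).
have fB X' t : normc (f X' t) <= A * omega (row_of_tuple t).
  by rewrite normcM normc_cis mul1r.
have dfB o' X' t : normc (df o' X' t) <= B1 * omega (row_of_tuple t).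
  rewrite normcM normc_cis mul1r; apply: le_trans (hB o' k _ _) _.
  apply: ler_wpM2r; first exact: omega_ge0.
  apply: le_trans (ler_norm _) _; rewrite /B1 (bigD1 o')//= lerDl.
  by apply: sumr_ge0.
have fd o' X' t : is_partial o' (f^~ t) X' (df o' X' t) by exact: integrand_is_partial.
split; last move=> o X.
- exact: (C1_cintegral (rintegrableMomega n A) (rintegrableMomega n B1) mf fB fd dfB mdf).
- exact: (is_partial_cintegral (rintegrableMomega n A) (rintegrableMomega n B1) mf fB fd dfB).
Qed.

Lemma fourier2_omega_bounded u k X : bddS u -> omega_bounded
  (fun w => cis (s * dotrv (rsubmx X) w) * u k (row_mx (lsubmx X) w)).
Proof.
move=> bu; split.
  exact/ccontinuous_fourier2_integrand/C1_ccontinuous/bddS_C1.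
have [A A0 hA] := bddS_decay1 bu; exists A => w.
by rewrite normcM normc_cis mul1r.
Qed.

(** For a frequency variable this is integration by parts: the frequency factor is produced by
    differentiating the exponential and moved onto the function. *)
Lemma fourier2_mul o u k X : bddS u ->
  (X 0 o)%:C * fourier2 s (u k) X = fourier2 s (FM o u k) X.
Proof.
move=> bu; have uo := fourier2_omega_bounded k X bu.
rewrite /FM; case: split_ordP => j jE; rewrite {}jE.
  rewrite /fourier2 -integral_RnZ//.
  by apply: eq_integral_Rn => w; rewrite /= row_mxEl mxE mulrCA.
rewrite (_ : X 0 (rshift m j) = rsubmx X 0 j); last by rewrite mxE.
rewrite /fourier2.
set x := lsubmx X; set z := rsubmx X.
have [cg pg] := bddS_C1_row k x bu.
have ph w : is_partial j (fun w => cis (s * dotrv z w)) w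
    ((0 +i* (s * z 0 j)) * cis (s * dotrv z w)).
  by apply: is_partial_cis; exact: is_deriveZ (is_derive_dotrv z j w).
have pc : polyfun (fun w => s * dotrv z w).
  by apply: polyfunM; [exact: polyfun_cst|exact: dotrv_polyfun].
have ch : C1_fun (fun w => cis (s * dotrv z w)).
  apply: (is_partial_C1 (df := fun j w => (0 +i* (s * z 0 j)) * cis (s * dotrv z w))).
    exact/ccontinuous_cis/polyfun_continuous.
  by move=> i w; apply: is_partial_cis; exact: is_deriveZ (is_derive_dotrv z i w).
have E w : partial j (fun w => cis (s * dotrv z w) * u k (row_mx x w)) w =
    (0 +i* (s * z 0 j)) * (cis (s * dotrv z w) * u k (row_mx x w)) +
    cis (s * dotrv z w) * partial (rshift m j) (u k) (row_mx x w).
  by rewrite (partialM j w ch cg) (is_partialE (ph w)) pg mulrA.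
have o2 := fourier2_omega_bounded k X (bddS_op (DerX (rshift m j)) bu).
set J := integral_Rn _.
pose K := integral_Rn (fun w => cis (s * dotrv z w) *
  partial (rshift m j) (u k) (row_mx x w)).
have -> : integral_Rn (fun w => cis (s * dotrv z w) *
    ((0 +i* s) * appop (DerX (rshift m j)) (u k) (row_mx x w))) = (0 +i* s) * K.
  by rewrite -integral_RnZ//; apply: eq_integral_Rn => w; rewrite mulrCA.
have o1 := omega_boundedZ (0 +i* (s * z 0 j)) uo.
(* The integral of the w_j-derivative of the whole integrand vanishes. Multiplying K = - i s z_j J
   by i s and using s^2 = 1 returns z_j J. *)
have E0 : (0 +i* (s * z 0 j)) * J + K = 0.
  rewrite -(integral_RnZ _ uo) -integral_RnD//.
  rewrite -(integral_Rn_partial0 (j := j) (C1_funM ch cg) uo).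
    by apply: eq_integral_Rn => w; rewrite E.
  by rewrite (funext E); exact: omega_boundedD.
move: E0 => /eqP; rewrite addrC addr_eq0 => /eqP ->.
rewrite mulrN mulrA -mulNr; congr (_ * _).
apply/eqP; rewrite eq_complex /=; apply/andP; split; apply/eqP; last by ring.
by rewrite -[LHS]mul1r -ss1; ring.
Qed.

(** Every x_i or d_i applied to the transform is the transform of a family obtained from [u] by one
    such operator and possibly a constant factor, so images of bounded families are stable; their
    boundedness follows from the decay in the integrated variable. *)
Lemma bddS_fourier2 u : bddS u -> bddS (fun k => fourier2 s (u k)).
Proof.
move=> bu; pose P v := exists2 u, bddS u & v = fun k => fourier2 s (u k).
apply: (@bddS_coind _ _ _ P); last by exists u.
- by move=> _ [v bv ->] k; have [] := fourier2_partial k bv.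
- move=> _ [v bv ->]; have [A A0 hA] := bddS_decay1 bv.
  exists (2 * (A * Omega R n)) => k X; apply: normc_integral_Rn.
    exact/ccontinuous_fourier2_integrand/C1_ccontinuous/bddS_C1.
  by move=> w; rewrite normcM normc_cis mul1r.
- move=> _ [l|l] [v bv ->].
    exists (FM l v); first exact: bddS_M.
    by apply/funext => k; apply/funext => X; exact: fourier2_mul.
  exists (FD l v); first exact: bddS_D.
  apply/funext => k; apply/funext => X; apply: is_partialE.
  by have [_] := fourier2_partial k bv; apply.
Qed.

End Fourier.

Definition kernel_op (d : 'rV[R]_(m + n) -> C) (g : 'rV[R]_n -> C) :
    'rV[R]_m -> C :=
  fun x => integral_Rn (fun y => d (row_mx x y) * g y).

Section Kernel.
Variable I : Type.
Implicit Types u v : I -> 'rV[R]_(m + n) -> C.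
Variables (g : I -> 'rV[R]_n -> C) (r : 'rV[R]_n -> R).
Hypotheses (cg : forall k, ccontinuous (g k)) (pr : polyfun r).
Hypothesis gr : forall k y, normc (g k y) <= r y.

Lemma kernel_op_bound u : bddS u -> exists2 M, 0 <= M &
  forall k x y, normc (u k (row_mx x y) * g k y) <= M * omega y.
Proof.
move=> bu; have [A A0 hA] := bddS_decay pr bu.
exists A => // k x y; apply: le_trans (hA k x y).
rewrite normcM mulrC ler_wpM2r ?normc_nneg//.
exact: le_trans (gr k y) (ler_norm _).
Qed.

Lemma kernel_op_continuous u k x : bddS u ->
  ccontinuous (fun y => u k (row_mx x y) * g k y).
Proof.
move=> bu; apply: ccontinuousM => //.
apply: ccontinuous_comp (C1_ccontinuous (bddS_C1 bu k)).
by apply: continuous_row_mx; [exact: cst_continuous|move=> y; exact: cvg_id].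
Qed.

Lemma kernel_op_omega_bounded u k x : bddS u ->
  omega_bounded (fun y => u k (row_mx x y) * g k y).
Proof.
move=> bu; split; first exact: kernel_op_continuous.
by have [A A0 hA] := kernel_op_bound bu; exists A.
Qed.

Lemma kernel_op_partial u k : bddS u -> C1_fun (kernel_op (u k) (g k)) /\
  forall o x, is_partial o (kernel_op (u k) (g k)) x
    (kernel_op (partial (lshift n o) (u k)) (g k) x).
Proof.
move=> bu; have [A A0 hA] := kernel_op_bound bu.
pose f x (t : n.-tuple (measurableTypeR R)) :=
  u k (row_mx x (row_of_tuple t)) * g k (row_of_tuple t).
pose df o x (t : n.-tuple (measurableTypeR R)) :=
  partial (lshift n o) (u k) (row_mx x (row_of_tuple t)) * g k (row_of_tuple t).
have bd o := bddS_op (DerX (lshift n o)) bu.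
have /choice[B hB] : forall o, exists B, forall k x y,
    normc (partial (lshift n o) (u k) (row_mx x y) * g k y) <= B * omega y.
  by move=> o; have [B _ hB] := kernel_op_bound (bd o); exists B.
pose B1 := \sum_o `|B o|.
have mf x : cmeasurable (f x) by exact: (cmeasurable_Rn (kernel_op_continuous k x bu)).
have mdf o x : cmeasurable (df o x).
  exact: (cmeasurable_Rn (kernel_op_continuous k x (bd o))).
have fB x t : normc (f x t) <= A * omega (row_of_tuple t) by exact: hA.
have dfB o x t : normc (df o x t) <= B1 * omega (row_of_tuple t).
  apply: le_trans (hB o k _ _) _.
  apply: ler_wpM2r; first exact: omega_ge0.
  apply: le_trans (ler_norm _) _; rewrite /B1 (bigD1 o)//= lerDl.
  by apply: sumr_ge0.
have fd o x t : is_partial o (f^~ t) x (df o x t).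
  have h : is_partial o (fun x => u k (row_mx x (row_of_tuple t))) x
      (partial (lshift n o) (u k) (row_mx x (row_of_tuple t))).
    apply: (is_partial_line (j := lshift n o) (f := u k)
      (L := fun x => row_mx x (row_of_tuple t))).
      by move=> c; rewrite row_mx_shiftl.
    by apply: C1_is_partial; exact: bddS_C1.
  have := is_partialM h (is_partial_cst o (g k (row_of_tuple t)) x).
  by rewrite mulr0 addr0.
split; last move=> o x.
- exact: (C1_cintegral (rintegrableMomega n A) (rintegrableMomega n B1) mf fB fd dfB mdf).
- exact: (is_partial_cintegral (rintegrableMomega n A) (rintegrableMomega n B1) mf fB fd dfB).
Qed.

(** The decay of the kernel in y outweighs the polynomial growth of [g], and the operators x_i and
    d_i act on the kernel through its left variables alone. *)
Lemma bddS_kernel_op u : bddS u -> bddS (fun k => kernel_op (u k) (g k)).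
Proof.
move=> bu; pose P (v : I -> 'rV[R]_m -> C) := exists2 u, bddS u & v = fun k => kernel_op (u k) (g k).
apply: (@bddS_coind _ _ _ P); last by exists u.
- by move=> _ [v bv ->] k; have [] := kernel_op_partial k bv.
- move=> _ [v bv ->]; have [A A0 hA] := kernel_op_bound bv.
  exists (2 * (A * Omega R n)) => k x; apply: normc_integral_Rn => //.
  exact: kernel_op_continuous.
- move=> _ [l|l] [v bv ->].
    exists (fun k => appop (MulX (lshift n l)) (v k)); first exact: bddS_op.
    apply/funext => k; apply/funext => x /=.
    rewrite /kernel_op -integral_RnZ//; last exact: kernel_op_omega_bounded.
    by apply: eq_integral_Rn => y; rewrite row_mxEl mulrA.
  exists (fun k => appop (DerX (lshift n l)) (v k)); first exact: bddS_op.
  apply/funext => k; apply/funext => x; apply: is_partialE.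
  by have [_] := kernel_op_partial k bv; apply.
Qed.

End Kernel.
End KernelOperators.

(** * Fourier inversion *)

Section PoissonKernel.
Variable R : realType.
Local Notation C := R[i].
Local Notation T := (measurableTypeR R).
Local Notation mu := (@lebesgue_measure R).
Local Notation muT := (lebesgue_tuple R).

(** The Abel multiplier in one variable. Its Fourier transform is twice a factor of [omega], so that
    the summation kernel is of the same shape as the majorant used everywhere. *)
Definition lapl (t : R) : R := expR (- `|t|).

Lemma lapl_ge0 t : 0 <= lapl t. Proof. exact: expR_ge0. Qed.

(** From 1 + |t| / 2 <= e^(|t| / 2) one gets 4 e^|t| >= 4 (1 + |t| / 2)^2 >= 1 + t^2. *)
Lemma lapl_le t : lapl t <= 4 * (1 + t ^+ 2)^-1.
Proof.
rewrite /lapl expRN -[X in _ <= X * _]invrK -invfM lef_pV2 ?posrE ?expR_gt0//.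
  have -> : `|t| = `|t| / 2 + `|t| / 2 by rewrite -splitr.
  rewrite expRD -(@ler_pM2l _ 4)// mulrA divff// mul1r.
  have h : 1 + `|t| / 2 <= expR (`|t| / 2) by exact: expR_ge1Dx.
  have h0 : 0 <= `|t| by [].
  have : (1 + `|t| / 2) * (1 + `|t| / 2) <= expR (`|t| / 2) * expR (`|t| / 2).
    by apply: ler_pM => //; rewrite addr_ge0// divr_ge0.
  rewrite -[t ^+ 2]real_normK ?num_real//; nra.
by rewrite mulr_gt0 ?invr_gt0// ltr_wpDr// sqr_ge0.
Qed.

Lemma continuous_lapl : continuous lapl.
Proof.
move=> t; apply: (@continuous_comp _ _ _ (fun t : R => - `|t|) expR).
  by apply: (@continuousN R _ _ (fun t : R => `|t|)); exact: norm_continuous.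
exact: continuous_expR.
Qed.

Lemma measurable_lapl : measurable_fun setT (lapl : T -> R).
Proof. by apply: continuous_measurable_fun; exact: continuous_lapl. Qed.

Lemma rintegrable_lapl : rintegrable mu lapl.
Proof.
have i4 : rintegrable mu (fun t : T => 4 * (1 + t ^+ 2)^-1 : R).
  rewrite /rintegrable (_ : _ \o _ = (fun t => 4%:E * ((1 + t ^+ 2)^-1)%:E)%E).
    by apply: integrableZl => //; exact: rintegrable_oneDsqrV.
  by apply/funext => t; rewrite /= EFinM.
apply: le_integrable i4 => //.
  by apply/measurable_EFinP; exact: measurable_lapl.
move=> t _; rewrite lee_fin ger0_norm ?lapl_ge0//.
by rewrite (le_trans (lapl_le t))// ler_norm.
Qed.

Lemma continuous_Mr (w : R) : continuous (fun t : R => t * w).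
Proof. by apply: continuous_rmul => t; [exact: cvg_id|exact: cvg_cst]. Qed.

Lemma continuous_oneDcos (w : R) : continuous (fun t : R => 1 + cos (t * w)).
Proof.
apply: continuous_radd => t; first exact: cvg_cst.
apply: (@continuous_comp _ _ _ (fun t : R => t * w) cos).
  exact: continuous_Mr.
exact: continuous_cos.
Qed.

Lemma oneDcos_ge0 (x : R) : 0 <= 1 + cos x.
Proof. by have := cos_geN1 x; lra. Qed.

(* The summand 1 makes the integrand nonnegative, as required by               *)
(* ge0_continuous_FTC2y; it is removed again in fourier_lapl by comparison with *)
(* the case w = 0. *)
Lemma half_laplace (w : R) : (\int[mu]_(t in `[0%R, +oo[)
  (lapl t * (1 + cos (t * w)))%:E = (1 + (1 + w ^+ 2)^-1)%:E)%E.
Proof.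
have w1 : 1 + w ^+ 2 != 0 by rewrite gt_eqF// ltr_wpDr// sqr_ge0.
(* An antiderivative of e^(-t) (1 + cos (t w)), as two integrations by parts give; it tends to 0 at
   infinity, and its value at 0 is minus the claimed integral. *)
pose F (t : R) := expR (- t) * ((w * sin (t * w) - cos (t * w)) / (1 + w ^+ 2) - 1).
have Fd (t : R) : is_derive t 1 F (expR (- t) * (1 + cos (t * w))).
  have d1 : is_derive t 1 (fun t : R => expR (- t)) (- expR (- t)).
    apply: is_derive_eq (is_derive1_comp (is_derive_expR _)
      (is_deriveN (is_derive_id t 1))) _.
    by ring.
  have dm : is_derive t 1 (fun t : R => t * w) w.
    apply: is_derive_eq (is_deriveM (is_derive_id t 1) (is_derive_cst w t 1)) _.
    by rewrite scaler0 add0r [_ *: _]mulr1.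
  have dc : is_derive t 1 (fun t : R => cos (t * w)) (- sin (t * w) * w).
    exact: (is_derive1_comp (is_derive_cos _) dm).
  have ds : is_derive t 1 (fun t : R => sin (t * w)) (cos (t * w) * w).
    exact: (is_derive1_comp (is_derive_sin _) dm).
  have dG : is_derive t 1
      (fun t : R => (1 + w ^+ 2)^-1 * (w * sin (t * w) - cos (t * w)) + (- 1))
      (cos (t * w) * w * w / (1 + w ^+ 2) + sin (t * w) * w / (1 + w ^+ 2)).
    have d2 : is_derive t 1 (fun t : R => w * sin (t * w)) (w * (cos (t * w) * w)).
      apply: is_derive_eq (is_deriveM (is_derive_cst w t 1) ds) _.
      by rewrite /GRing.scale /=; ring.
    have d3 : is_derive t 1 (fun t : R => w * sin (t * w) - cos (t * w))
        (w * (cos (t * w) * w) - (- sin (t * w) * w)) by exact: is_deriveB d2 dc.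
    have d4 : is_derive t 1 (fun t : R => (1 + w ^+ 2)^-1 * (w * sin (t * w) - cos (t * w)))
        ((1 + w ^+ 2)^-1 * (w * (cos (t * w) * w) - (- sin (t * w) * w))).
      apply: is_derive_eq (is_deriveM (is_derive_cst ((1 + w ^+ 2)^-1 : R) t 1) d3) _.
      by rewrite /GRing.scale /=; ring.
    apply: is_derive_eq (is_deriveD d4 (is_derive_cst (- 1 : R) t 1)) _.
    by field.
  rewrite (_ : F = (fun t => expR (- t) *
      ((1 + w ^+ 2)^-1 * (w * sin (t * w) - cos (t * w)) + (- 1)))); last first.
    by apply/funext => r; rewrite /F mulrC [in RHS]mulrC (mulrC (_^-1)).
  apply: is_derive_eq (is_deriveM d1 dG) _.
  by rewrite /GRing.scale /=; field.
have Fc : continuous F.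
  move=> t; apply: differentiable_continuous; apply/derivable1_diffP.
  exact: (@ex_derive _ _ _ _ _ _ _ (Fd t)).
have F0 : F 0 = - (1 + (1 + w ^+ 2)^-1).
  by rewrite /F oppr0 expR0 mul0r sin0 cos0; field.
have Foo : F t @[t --> +oo] --> (0 : R).
  pose K := (`|w| + 1) / (1 + w ^+ 2) + 1.
  have FK t : `|F t| <= expR (- t) * K.
    rewrite /F normrM (ger0_norm (expR_ge0 _)) ler_wpM2l ?expR_ge0//.
    apply: le_trans (ler_normB _ _) _; rewrite normr1 lerD2r.
    rewrite normrM [X in _ * X]ger0_norm; last by rewrite invr_ge0 addr_ge0// sqr_ge0.
    rewrite ler_wpM2r ?invr_ge0 ?addr_ge0 ?sqr_ge0//.
    apply: le_trans (ler_normB _ _) _; apply: lerD.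
      rewrite normrM ler_piMr//; rewrite ler_norml sin_geN1 sin_le1//.
    by rewrite ler_norml cos_geN1 cos_le1.
  have Koo : expR (- t) * K @[t --> +oo] --> (0 : R).
    by rewrite -(mul0r K); apply: cvgMr_tmp; exact: cvgr_expR.
  apply: norm_cvg0; apply: (@squeeze_cvgr _ _ _ _ (cst 0) _ _ _ _ _ Koo).
    by apply: nearW => t; rewrite normr_ge0 /=; exact: FK.
  exact: cvg_cst.
rewrite (eq_integral (fun t : T => (expR (- t) * (1 + cos (t * w)))%:E)); last first.
  move=> t; rewrite inE /= in_itv /= andbT => t0.
  by rewrite /lapl ger0_norm.
have cf : continuous (fun t : R => expR (- t) * (1 + cos (t * w))).
  apply: continuous_rmul; last exact: continuous_oneDcos.
  move=> t; apply: (@continuous_comp _ _ _ (fun t : R => - t) expR).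
    by apply: (@continuousN R _ _ id); exact: cvg_id.
  exact: continuous_expR.
rewrite (@ge0_continuous_FTC2y R _ F 0 0).
- by rewrite F0 -EFinB opprK add0r.
- by move=> t _; rewrite mulr_ge0 ?expR_ge0// oneDcos_ge0.
- exact: continuous_subspaceT.
- exact: Foo.
- by move=> t _; exact: (@ex_derive _ _ _ _ _ _ _ (Fd t)).
- by apply: cvg_at_right_filter; exact: Fc.
- by move=> t _; rewrite derive1E (@derive_val _ _ _ _ _ _ _ (Fd t)).
Qed.

Lemma full_laplace (w : R) : Rintegral mu setT (fun t => lapl t * (1 + cos (t * w))) =
  2 * (1 + (1 + w ^+ 2)^-1).
Proof.
rewrite /Rintegral (@ge0_symfun_integralT R (fun t => lapl t * (1 + cos (t * w)))).
- by rewrite -set_itvcy half_laplace.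
- by move=> t; rewrite mulr_ge0 ?lapl_ge0// oneDcos_ge0.
- by apply: continuous_rmul; [exact: continuous_lapl|exact: continuous_oneDcos].
- by move=> t /=; rewrite /lapl normrN mulNr cosN.
Qed.

Let g (w t : R) : C := cis (t * w) * (lapl t)%:C.

Let g_measurable w : cmeasurable (g w : T -> C).
Proof.
apply: cmeasurableM; last first.
  exact: (cmeasurable_real measurable_lapl).
by apply: cmeasurable_cis; apply: continuous_measurable_fun; exact: continuous_Mr.
Qed.

Let g_bound w t : normc (g w t) <= lapl t.
Proof. by rewrite /g normcM normc_cis mul1r normc_real ger0_norm ?lapl_ge0. Qed.

Lemma Rintegral_oppr (h : T -> R) : mu.-integrable setT (EFin \o h) ->
  Rintegral mu setT (fun t => h (- t)) = Rintegral mu setT h.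
Proof.
move=> ih; have mh := measurable_int mu ih.
have mN : measurable_fun setT (-%R : T -> T).
  apply: continuous_measurable_fun => t.
  by apply: (@continuousN R _ _ id); exact: cvg_id.
have E (f : T -> \bar R) : measurable_fun setT f -> (forall t, (0 <= f t)%E) ->
    (\int[mu]_t f (- t)%R = \int[mu]_t f t)%E.
  move=> mf f0; have := @ge0_integral_pushforward _ _ _ _ _ _ mN mu setT f measurableT mf.
  rewrite preimage_setT => <-//.
  by apply: eq_measure_integral => A mA _; exact: lebesgue_measureN.
rewrite /Rintegral integralE [in RHS]integralE.
rewrite (_ : (fun t : T => (h (- t))%:E)^\+%E = (EFin \o h)^\+%E \o -%R); last first.
  by rewrite -funepos_comp.
rewrite (_ : (fun t : T => (h (- t))%:E)^\-%E = (EFin \o h)^\-%E \o -%R); last first.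
  by rewrite -funeneg_comp.
rewrite (E (EFin \o h)^\+%E (measurable_funepos mh))//.
by rewrite (E (EFin \o h)^\-%E (measurable_funeneg mh)).
Qed.

Lemma fourier_lapl (w : R) : cintegral mu (g w) = (2 * (1 + w ^+ 2)^-1)%:C.
Proof.
have ReE v t : complex.Re (g v t) = lapl t * cos (t * v).
  by rewrite /g cReM /=; ring.
have ImE t : complex.Im (g w t) = lapl t * sin (t * w).
  by rewrite /g cImM /=; ring.
have iR v : mu.-integrable setT (EFin \o (fun t => lapl t * cos (t * v))).
  have [+ _] := cintegrable_dom rintegrable_lapl (g_measurable v) (g_bound v).
  rewrite (_ : (fun t => (complex.Re (g v t))%:E) =
    EFin \o (fun t => lapl t * cos (t * v)))//.
  by apply/funext => t; rewrite ReE.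
have iI : mu.-integrable setT (EFin \o (fun t => lapl t * sin (t * w))).
  have [_ +] := cintegrable_dom rintegrable_lapl (g_measurable w) (g_bound w).
  rewrite (_ : (fun t => (complex.Im (g w t))%:E) =
    EFin \o (fun t => lapl t * sin (t * w)))//.
  by apply/funext => t; rewrite ImE.
have sumE v : Rintegral mu setT lapl +
    Rintegral mu setT (fun t => lapl t * cos (t * v)) = 2 * (1 + (1 + v ^+ 2)^-1).
  rewrite -full_laplace -RintegralD//; last exact: rintegrable_lapl.
  by apply: eq_Rintegral => t _; rewrite mulrDr mulr1.
have c0 : Rintegral mu setT (fun t => lapl t * cos (t * 0)) = Rintegral mu setT lapl.
  by apply: eq_Rintegral => t _; rewrite mulr0 cos0 mulr1.
(* At v = 0 both summands of [sumE] are the integral of [lapl], and their sum is 4. *)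
have I2 : Rintegral mu setT lapl = 2.
  by have := sumE 0; rewrite c0 expr0n addr0 invr1; lra.
apply/eqP; rewrite eq_complex /=; apply/andP; split; apply/eqP.
- transitivity (Rintegral mu setT (fun t => lapl t * cos (t * w))).
    by apply: eq_Rintegral => t _; exact: ReE.
  by have := sumE w; rewrite I2; lra.
- transitivity (Rintegral mu setT (fun t => lapl t * sin (t * w))).
    by apply: eq_Rintegral => t _; exact: ImE.
  (* The imaginary part has an odd integrand: its integral equals its own opposite. *)
  have : Rintegral mu setT (fun t => lapl (- t) * sin (- t * w)) =
    Rintegral mu setT (fun t => lapl t * sin (t * w)) := Rintegral_oppr iI.
  have -> : Rintegral mu setT (fun t => lapl (- t) * sin (- t * w)) =
      Rintegral mu setT (fun t => -1 * (lapl t * sin (t * w))).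
    by apply: eq_Rintegral => t _; rewrite [in LHS]mulNr sinN /lapl normrN; ring.
  by rewrite RintegralZl//; lra.
Qed.

Definition laplE n (y : 'rV[R]_n) : R := \prod_i lapl (y 0 i).

Lemma cis_sum (I : Type) (s : seq I) (f : I -> R) :
  cis (\sum_(i <- s) f i) = \prod_(i <- s) cis (f i).
Proof. by apply: (big_morph _ (@cisD R)); exact: cis0. Qed.

Lemma laplE_le n (y : 'rV[R]_n) : laplE y <= 4 ^+ n * omega y.
Proof.
have -> : 4 ^+ n = \prod_(i < n) 4 :> R by rewrite prodr_const card_ord.
rewrite /laplE /omega -big_split /=.
by apply: ler_prod => i _; rewrite lapl_ge0 /=; exact: lapl_le.
Qed.

Lemma laplE_ge0 n (y : 'rV[R]_n) : 0 <= laplE y.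
Proof. by apply: prodr_ge0 => i _; exact: lapl_ge0. Qed.

Lemma continuous_laplE n : continuous (@laplE n).
Proof.
apply: continuous_prod => i y.
apply: (@continuous_comp _ _ _ (fun y : 'rV[R]_n => y 0 i) lapl).
  exact: continuous_coord.
exact: continuous_lapl.
Qed.

Lemma poisson_omega_bounded n (v : 'rV[R]_n) :
  omega_bounded (fun xi => cis (dotrv v xi) * (laplE xi)%:C).
Proof.
split.
  apply: ccontinuousM; last exact/ccontinuous_real/continuous_laplE.
  exact/ccontinuous_cis/polyfun_continuous/dotrv_polyfun.
exists (4 ^+ n) => xi.
by rewrite normcM normc_cis mul1r normc_real ger0_norm ?laplE_ge0 ?laplE_le.
Qed.

(** Both the exponential and the multiplier are products over the coordinates, so the integral
    factors into one-dimensional ones. *)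
Lemma fourier_laplE n (v : 'rV[R]_n) :
  integral_Rn (fun xi => cis (dotrv v xi) * (laplE xi)%:C) = (2 ^+ n * omega v)%:C.
Proof.
transitivity (\prod_(i < n) cintegral mu (g (v 0 i))).
  rewrite -(cintegral_prod lapl_ge0 rintegrable_lapl); last 2 first.
  - by move=> i; exact: g_measurable.
  - by move=> i t; exact: g_bound.
  apply: eq_cintegral => t; rewrite /laplE /dotrv cis_sum rmorph_prod -big_split /=.
  by apply: eq_bigr => i _; rewrite !mxE /g mulrC [in RHS]mulrC (mulrC (v 0 i)).
under eq_bigr do rewrite fourier_lapl.
by rewrite -rmorph_prod big_split /= prodr_const card_ord.
Qed.

Lemma fourier_laplE_scaled n (v : 'rV[R]_n) k : 0 < k ->
  integral_Rn (fun xi => cis (dotrv v xi) * (laplE (k *: xi))%:C) =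
  (k^-1 ^+ n * (2 ^+ n * omega (k^-1 *: v)))%:C.
Proof.
move=> k0; rewrite rmorphM /= -fourier_laplE.
rewrite -(integral_Rn_affine 0 k0 (poisson_omega_bounded (k^-1 *: v))).
apply: eq_integral_Rn => xi; rewrite add0r; congr (cis _ * _).
by apply: eq_bigr => i _; rewrite !mxE mulrACA mulVf ?mul1r// gt_eqF.
Qed.

Lemma integral_omega n : integral_Rn (fun y : 'rV[R]_n => (omega y)%:C) = (pi ^+ n)%:C.
Proof.
pose h (t : R) : C := ((1 + t ^+ 2)^-1)%:C.
transitivity (\prod_(i < n) cintegral mu h).
  rewrite -(cintegral_prod (b := fun t => (1 + t ^+ 2)^-1) (g := fun i : 'I_n => h)).
  - by apply: eq_cintegral => t; rewrite /omega rmorph_prod; apply: eq_bigr => i _; rewrite !mxE.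
  - by move=> t; rewrite invr_ge0 addr_ge0// sqr_ge0.
  - exact: rintegrable_oneDsqrV.
  - move=> _; apply: cmeasurable_real; apply: continuous_measurable_fun.
    exact: continuous_oneDsqrV.
  - by move=> _ t; rewrite normc_real ger0_norm// invr_ge0 addr_ge0// sqr_ge0.
rewrite prodr_const card_ord /h cintegral_real /Rintegral integral_oneDsqrV.
by rewrite rmorphXn.
Qed.

End PoissonKernel.

(** * Fourier inversion by Abel summation *)

Section Inversion.
Variable R : realType.
Local Notation C := R[i].
Local Notation muT := (lebesgue_tuple R).
Variable n : nat.
Implicit Types (f : 'rV[R]_n -> C) (x y xi : 'rV[R]_n).

Lemma omegaZsqr1 (s : R) y : s * s = 1 -> omega (s *: y) = omega y.
Proof.
move=> ss1; apply: eq_bigr => i _.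
by rewrite mxE exprMn [s ^+ 2]ss1 mul1r.
Qed.

(** In each coordinate k^2 (1 + a^2) <= 1 + (k a)^2 because k <= 1. *)
Lemma omega_contraction (k : R) y : 0 < k -> k <= 1 ->
  omega (k *: y) <= (k ^- 2) ^+ n * omega y.
Proof.
move=> k0 k1.
have -> : (k ^- 2) ^+ n = \prod_(i < n) k ^- 2 by rewrite prodr_const card_ord.
rewrite /omega -big_split /=; apply: ler_prod => i _.
have h0 (a : R) : 0 < 1 + a ^+ 2 by rewrite ltr_wpDr// sqr_ge0.
rewrite invr_ge0 ltW//= -invfM lef_pV2 ?posrE ?mulr_gt0 ?exprn_gt0//.
by rewrite mxE mulrDr mulr1 exprMn lerD2r expr_le1// ltW.
Qed.

Lemma laplE_omega_bounded k : 0 < k -> k <= 1 ->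
  exists M, forall xi, laplE (k *: xi) <= M * omega xi.
Proof.
move=> k0 k1; exists (4 ^+ n * (k ^- 2) ^+ n) => xi.
apply: le_trans (laplE_le _) _; rewrite -mulrA ler_wpM2l ?exprn_ge0//.
exact: omega_contraction.
Qed.

Lemma integral_Rn_fubini (B1 B2 : R) (G : 'rV[R]_n -> 'rV[R]_n -> C) :
  ccontinuous (fun X : 'rV[R]_(n + n) => G (lsubmx X) (rsubmx X)) ->
  (forall y xi, normc (G y xi) <= (B1 * omega y) * (B2 * omega xi)) ->
  0 <= B1 -> 0 <= B2 ->
  integral_Rn (fun y => integral_Rn (G y)) = integral_RnRn G /\
  integral_Rn (fun xi => integral_Rn (G^~ xi)) = integral_RnRn G.
Proof.
move=> [cR cI] GB B10 B20.
(* The 2n coordinates of a pair of tuples, so that a continuous function on R^2n becomes measurable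
   on the product of the two tuple spaces. *)
pose c (i : 'I_(n + n)) (t : n.-tuple (measurableTypeR R) * n.-tuple (measurableTypeR R)) : R :=
  match fintype.split i with inl j => tnth t.1 j | inr j => tnth t.2 j end.
have mc i : measurable_fun setT (c i).
  rewrite /c; case: (fintype.split i) => j.
    exact: (measurableT_comp (@measurable_tnth _ _ n j) measurable_fst).
  exact: (measurableT_comp (@measurable_tnth _ _ n j) measurable_snd).
have cE t : G (row_of_tuple t.1) (row_of_tuple t.2) =
    G (lsubmx (\row_i c i t)) (rsubmx (\row_i c i t)).
  congr G; apply/rowP => j; rewrite !mxE /c.
    by rewrite (unsplitK (inl j)).
  by rewrite (unsplitK (inr j)).
have mG : cmeasurable (fun t : n.-tuple (measurableTypeR R) * n.-tuple (measurableTypeR R) =>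
    G (row_of_tuple t.1) (row_of_tuple t.2)).
  rewrite (funext cE); split.
  - exact: (measurable_continuous_row cR mc).
  - exact: (measurable_continuous_row cI mc).
have o0 B (t : n.-tuple (measurableTypeR R)) : 0 <= B -> 0 <= B * omega (row_of_tuple t).
  by move=> B0; rewrite mulr_ge0// omega_ge0.
have [F1 F2] := @cfubini _ _ _ _ _ (muT n) (muT n) _ _
  (fun t => G (row_of_tuple t.1) (row_of_tuple t.2)) (fun t => o0 B1 t B10)
  (fun t => o0 B2 t B20) (rintegrableMomega n B1) (rintegrableMomega n B2) mG
  (fun t1 t2 => GB (row_of_tuple t1) (row_of_tuple t2)).
by split; [exact: F1|exact: F2].
Qed.

Lemma cvg_Rn_dominated (M : R) (f_ : nat -> 'rV[R]_n -> C) f :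
  (forall k, ccontinuous (f_ k)) -> ccontinuous f ->
  (forall k y, normc (f_ k y) <= M * omega y) ->
  (forall y, complex.Re (f_ k y) @[k --> \oo] --> complex.Re (f y)) ->
  (forall y, complex.Im (f_ k y) @[k --> \oo] --> complex.Im (f y)) ->
  (complex.Re (integral_Rn (f_ k)) @[k --> \oo] --> complex.Re (integral_Rn f)) /\
  (complex.Im (integral_Rn (f_ k)) @[k --> \oo] --> complex.Im (integral_Rn f)).
Proof.
move=> cf_ cf fM cR cI.
apply: (@ccvg_dominated _ _ R (muT n) _ (fun k t => f_ k (row_of_tuple t))
  (fun t => f (row_of_tuple t)) (rintegrableMomega n M)).
- by move=> k; exact: cmeasurable_Rn.
- exact: cmeasurable_Rn.
- by move=> k t; exact: fM.
- by move=> t; exact: cR.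
- by move=> t; exact: cI.
Qed.

Lemma continuous_affine x (k : R) : continuous (fun y : 'rV[R]_n => x + k *: y).
Proof.
apply: continuous_rowP => j; under eq_fun do rewrite !mxE.
apply: continuous_radd; first exact: cst_continuous.
by apply: continuous_rmul; [exact: cst_continuous|exact: continuous_coord].
Qed.

Lemma continuous_scale (k : R) : continuous (fun y : 'rV[R]_n => k *: y).
Proof.
apply: continuous_rowP => j; under eq_fun do rewrite !mxE.
by apply: continuous_rmul; [exact: cst_continuous|exact: continuous_coord].
Qed.

Lemma continuous_dil (x : 'rV[R]_n) : continuous (fun k : R => k *: x).
Proof.
apply: continuous_rowP => j; under eq_fun do rewrite !mxE.
by apply: continuous_rmul; [move=> ?; exact: cvg_id|exact: cst_continuous].
Qed.

Lemma fourier_inversion (s : R) f x : s * s = 1 -> omega_bounded f ->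
  omega_bounded (fun xi => integral_Rn (fun y => cis (- s * dotrv xi y) * f y)) ->
  integral_Rn (fun xi => cis (s * dotrv xi x) *
    integral_Rn (fun y => cis (- s * dotrv xi y) * f y)) =
  ((2 * pi) ^+ n)%:C * f x.
Proof.
move=> ss1 [cf [M0 fM0]]; set fh := fun xi => integral_Rn _ => -[cfh [N0 fhN0]].
have [M [M1 fM]] : exists M, 0 <= M /\ forall y, normc (f y) <= M * omega y.
  exists `|M0|; split=> // y; apply: le_trans (fM0 y) _.
  by rewrite ler_wpM2r ?omega_ge0// ler_norm.
have [N [N1 fhN]] : exists N, 0 <= N /\ forall y, normc (fh y) <= N * omega y.
  exists `|N0|; split=> // y; apply: le_trans (fhN0 y) _.
  by rewrite ler_wpM2r ?omega_ge0// ler_norm.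
pose d k : R := k.+1%:R^-1.
have d0 k : 0 < d k by rewrite invr_gt0.
have d1 k : d k <= 1 by rewrite invf_le1// ler1n.
have dcvg : d k @[k --> \oo] --> (0 : R) by exact: cvg_harmonic.
have cdot (a : R) z : continuous (fun xi => a * dotrv xi z).
  under eq_fun do rewrite dotrvC; apply: polyfun_continuous.
  by apply: polyfunM; [exact: polyfun_cst|exact: dotrv_polyfun].
have ccis (a : R) z : ccontinuous (fun xi => cis (a * dotrv xi z)).
  exact/ccontinuous_cis/cdot.
have cE k : continuous (fun xi => laplE (k *: xi)).
  move=> xi; apply: (@continuous_comp _ _ _ (fun xi => k *: xi) (@laplE R n)).
    exact: continuous_scale.
  exact: continuous_laplE.
pose L k := integral_Rn (fun xi => (laplE (d k *: xi))%:C * (cis (s * dotrv xi x) * fh xi)).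
have Lcvg := @cvg_Rn_dominated N
  (fun k xi => (laplE (d k *: xi))%:C * (cis (s * dotrv xi x) * fh xi))
  (fun xi => cis (s * dotrv xi x) * fh xi).
have Ecvg xi : laplE (d k *: xi) @[k --> \oo] --> (1 : R).
  have -> : (1 : R) = laplE (0 *: xi).
    rewrite /laplE big1// => i _; by rewrite mxE mul0r /lapl normr0 oppr0 expR0.
  apply: (@cvg_comp _ _ _ d (fun k => laplE (k *: xi)) _ _ _ dcvg).
  apply: (@continuous_comp _ _ _ (fun k : R => k *: xi) (@laplE R n)).
    exact: continuous_dil.
  exact: continuous_laplE.
have E1 y : laplE y <= 1.
  have -> : 1 = \prod_(i < n) 1 :> R by rewrite big1_eq.
  by apply: ler_prod => i _; rewrite lapl_ge0 /= /lapl -expR0 ler_expR oppr_le0.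
have Ez xi (z : C) : (complex.Re ((laplE (d k *: xi))%:C * z) @[k --> \oo] --> complex.Re z) /\
    (complex.Im ((laplE (d k *: xi))%:C * z) @[k --> \oo] --> complex.Im z).
  rewrite (_ : (fun k => _) = (fun k => laplE (d k *: xi) * complex.Re z)); last first.
    by apply/funext => k; rewrite cReM /= mul0r subr0.
  rewrite (_ : (fun k => complex.Im _) = (fun k => laplE (d k *: xi) * complex.Im z)); last first.
    by apply/funext => k; rewrite cImM /= mul0r addr0.
  by split; rewrite -[X in _ --> X]mul1r; apply: cvgMr_tmp; exact: Ecvg.
have {}Lcvg : (complex.Re (L k) @[k --> \oo] -->
      complex.Re (integral_Rn (fun xi => cis (s * dotrv xi x) * fh xi))) /\
    (complex.Im (L k) @[k --> \oo] -->
      complex.Im (integral_Rn (fun xi => cis (s * dotrv xi x) * fh xi))).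
  apply: Lcvg.
  - move=> k; apply: ccontinuousM; first exact/ccontinuous_real/cE.
    by apply: ccontinuousM => //; exact: ccis.
  - by apply: ccontinuousM => //; exact: ccis.
  - move=> k xi; rewrite !normcM normc_cis mul1r normc_real ger0_norm ?laplE_ge0//.
    by apply: le_trans (fhN xi); rewrite ler_piMl ?normc_nneg// E1.
  - by move=> xi; have [] := Ez xi (cis (s * dotrv xi x) * fh xi).
  - by move=> xi; have [] := Ez xi (cis (s * dotrv xi x) * fh xi).
(* The same quantity as [L k], after Fubini and the substitution y = x + d_k y'. The small parameter
   now sits in the argument of f, where continuity can be used. *)
pose h k y : C := f (x + d k *: y) * (2 ^+ n * omega y)%:C.
have Lh k : L k = integral_Rn (h k).
  pose G y xi : C := (laplE (d k *: xi))%:C * (cis (s * dotrv xi x) *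
    (cis (- s * dotrv xi y) * f y)).
  have [K0 EK0] := laplE_omega_bounded (d0 k) (d1 k).
  have [K [K1 EK]] : exists K, 0 <= K /\ forall y, laplE (d k *: y) <= K * omega y.
    exists `|K0|; split=> // y; apply: le_trans (EK0 y) _.
    by rewrite ler_wpM2r ?omega_ge0// ler_norm.
  have fo xi : omega_bounded (fun y => cis (- s * dotrv xi y) * f y).
    split; first by apply: ccontinuousM => //; under eq_fun do rewrite dotrvC; exact: ccis.
    by exists M => y; rewrite normcM normc_cis mul1r.
  have cG : ccontinuous (fun X : 'rV[R]_(n + n) => G (lsubmx X) (rsubmx X)).
    have cl := @continuous_lsubmx R 1 n n; have cr := @continuous_rsubmx R 1 n n.
    apply: ccontinuousM.
      exact: (ccontinuous_comp cr (ccontinuous_real (cE (d k)))).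
    apply: ccontinuousM.
      exact: (ccontinuous_comp (f := fun xi => cis (s * dotrv xi x)) cr (ccis s x)).
    apply: ccontinuousM; last exact: (ccontinuous_comp (f := f) cl cf).
    apply: ccontinuous_cis; apply: continuous_rmul; first exact: cst_continuous.
    apply: continuous_sum => i; apply: continuous_rmul.
      by under eq_fun do rewrite mxE; exact: continuous_coord.
    by under eq_fun do rewrite mxE; exact: continuous_coord.
  have GB y xi : normc (G y xi) <= (M * omega y) * (K * omega xi).
    rewrite !normcM !normc_cis !mul1r normc_real ger0_norm ?laplE_ge0// mulrC.
    by apply: ler_pM; rewrite ?normc_nneg ?laplE_ge0.
  have [F1 F2] := integral_Rn_fubini cG GB M1 K1.
  have -> : L k = integral_Rn (fun xi => integral_Rn (G^~ xi)).
    apply: eq_integral_Rn => xi; rewrite /fh -integral_RnZ// -integral_RnZ//.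
    exact: omega_boundedZ.
  rewrite F2 -F1.
  (* f times the Poisson kernel around x, up to the factor d_k^-n, which the affine substitution
     produces. *)
  pose H y : C := f y * (2 ^+ n * omega ((d k)^-1 *: (s *: (x - y))))%:C.
  have Ho : omega_bounded H.
    split.
      apply: ccontinuousM => //; apply: ccontinuous_real.
      apply: continuous_rmul; first exact: cst_continuous.
      have ca : continuous (fun y => (d k)^-1 *: (s *: (x - y))).
        apply: continuous_rowP => j; under eq_fun do rewrite !mxE.
        apply: continuous_rmul; first exact: cst_continuous.
        apply: continuous_rmul; first exact: cst_continuous.
        by apply: continuous_rsub; [exact: cst_continuous|exact: continuous_coord].
      move=> y; apply: (@continuous_comp _ _ _ (fun y => (d k)^-1 *: (s *: (x - y)))
        (@omega R n)); [exact: ca|exact: continuous_omega].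
    exists (2 ^+ n * M) => y; rewrite normcM normc_real ger0_norm; last first.
      by rewrite mulr_ge0 ?exprn_ge0 ?omega_ge0.
    rewrite -mulrA mulrC; apply: ler_pM.
    - by rewrite mulr_ge0 ?exprn_ge0 ?omega_ge0.
    - exact: normc_nneg.
    - by rewrite ler_piMr ?exprn_ge0 ?omega_le1.
    - exact: fM.
  have -> : integral_Rn (h k) = integral_Rn (fun y => H (x + d k *: y)).
    apply: eq_integral_Rn => y; rewrite /h /H; congr (_ * (_ * _)%:C).
    rewrite opprD addNKr -scaleNr 2!scalerA.
    rewrite (_ : (d k)^-1 * s * - d k = - s); last first.
      by field; rewrite gt_eqF.
    (* The sign s disappears because [omega] is even. *)
    by rewrite omegaZsqr1// mulrNN.
  rewrite (integral_Rn_affine x (d0 k) Ho) -integral_RnZ//.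
  apply: eq_integral_Rn => y.
  rewrite (_ : integral_Rn (G y) = integral_Rn (fun xi => f y *
      (cis (dotrv (s *: (x - y)) xi) * (laplE (d k *: xi))%:C))); last first.
    apply: eq_integral_Rn => xi; rewrite /G.
    have -> : dotrv (s *: (x - y)) xi = s * dotrv xi x + - s * dotrv xi y.
      rewrite /dotrv !mulr_sumr -big_split /=; apply: eq_bigr => i _.
      by rewrite !mxE; ring.
    by rewrite cisD; ring.
  have po : omega_bounded (fun xi => cis (dotrv (s *: (x - y)) xi) * (laplE (d k *: xi))%:C).
    split; last first.
      by exists K => xi; rewrite normcM normc_cis mul1r normc_real ger0_norm ?laplE_ge0.
    apply: ccontinuousM; last exact/ccontinuous_real/cE.
    exact/ccontinuous_cis/polyfun_continuous/dotrv_polyfun.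
  rewrite integral_RnZ// fourier_laplE_scaled// /H.
  by rewrite [in LHS]rmorphM /= mulrCA.
have hcvg := @cvg_Rn_dominated (M * 2 ^+ n) h (fun y => f x * (2 ^+ n * omega y)%:C).
have fcvg y : (complex.Re (f (x + d k *: y)) @[k --> \oo] --> complex.Re (f x)) /\
    (complex.Im (f (x + d k *: y)) @[k --> \oo] --> complex.Im (f x)).
  have xcvg : continuous (fun k : R => x + k *: y).
    apply: continuous_rowP => j; under eq_fun do rewrite !mxE.
    apply: continuous_radd; first exact: cst_continuous.
    by apply: continuous_rmul; [move=> ?; exact: cvg_id|exact: cst_continuous].
  have [cR cI] := ccontinuous_comp (f := f) xcvg cf.
  have x0 : f x = f (x + 0 *: y) by rewrite scale0r addr0.
  rewrite x0; split.
    exact: (@cvg_comp _ _ _ d (fun k => complex.Re (f (x + k *: y))) _ _ _ dcvg (cR 0)).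
  exact: (@cvg_comp _ _ _ d (fun k => complex.Im (f (x + k *: y))) _ _ _ dcvg (cI 0)).
have {}hcvg : (complex.Re (integral_Rn (h k)) @[k --> \oo] -->
      complex.Re (integral_Rn (fun y => f x * (2 ^+ n * omega y)%:C))) /\
    (complex.Im (integral_Rn (h k)) @[k --> \oo] -->
      complex.Im (integral_Rn (fun y => f x * (2 ^+ n * omega y)%:C))).
  have comega : continuous (fun y : 'rV[R]_n => 2 ^+ n * omega y).
    by apply: continuous_rmul; [exact: cst_continuous|exact: continuous_omega].
  have o0 y : 0 <= 2 ^+ n * omega y by rewrite mulr_ge0 ?exprn_ge0 ?omega_ge0.
  have hz (z : nat -> C) (z0 : C) (r : R) :
      (complex.Re (z k) @[k --> \oo] --> complex.Re z0) ->
      (complex.Im (z k) @[k --> \oo] --> complex.Im z0) ->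
      (complex.Re (z k * r%:C) @[k --> \oo] --> complex.Re (z0 * r%:C)) /\
      (complex.Im (z k * r%:C) @[k --> \oo] --> complex.Im (z0 * r%:C)).
    have ReE (w : C) : complex.Re (w * r%:C) = complex.Re w * r.
      by rewrite cReM /= mulr0 subr0.
    have ImE (w : C) : complex.Im (w * r%:C) = complex.Im w * r.
      by rewrite cImM /= mulr0 add0r.
    move=> zR zI; rewrite ReE ImE (funext (fun k => ReE (z k))) (funext (fun k => ImE (z k))).
    by split; apply: cvgMr_tmp.
  apply: hcvg.
  - move=> k; apply: ccontinuousM; last exact: ccontinuous_real.
    exact: ccontinuous_comp (@continuous_affine x (d k)) cf.
  - by apply: ccontinuousM; [exact: ccontinuous_cst|exact: ccontinuous_real].
  - move=> k y; rewrite normcM normc_real ger0_norm// mulrA.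
    rewrite ler_wpM2r ?omega_ge0// ler_wpM2r ?exprn_ge0//.
    by apply: le_trans (fM _) _; rewrite ler_piMr ?omega_le1.
  - move=> y; have [a b] := fcvg y.
    have [? _] := hz (fun k => f (x + d k *: y)) (f x) (2 ^+ n * omega y) a b.
    by [].
  - move=> y; have [a b] := fcvg y.
    have [_ ?] := hz (fun k => f (x + d k *: y)) (f x) (2 ^+ n * omega y) a b.
    by [].
have oo : omega_bounded (fun y : 'rV[R]_n => (omega y)%:C).
  split; first exact/ccontinuous_real/continuous_omega.
  by exists 1 => y; rewrite normc_real ger0_norm ?omega_ge0// mul1r.
have -> : ((2 * pi) ^+ n)%:C * f x = integral_Rn (fun y => f x * (2 ^+ n * omega y)%:C).
  rewrite (_ : (fun y => _) = (fun y => (f x * (2 ^+ n)%:C) * (omega y)%:C)); last first.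
    by apply/funext => y; rewrite rmorphM mulrA.
  by rewrite integral_RnZ// integral_omega exprMn rmorphM /=; ring.
have LhR : (fun k => complex.Re (L k)) = (fun k => complex.Re (integral_Rn (h k))).
  by apply/funext => k; rewrite Lh.
have LhI : (fun k => complex.Im (L k)) = (fun k => complex.Im (integral_Rn (h k))).
  by apply/funext => k; rewrite Lh.
have [hR hI] := hcvg; have [LR LI] := Lcvg; rewrite LhR in LR; rewrite LhI in LI.
(* The sequences [L k] and the integrals of [h k] are equal, so their two limits agree. *)
apply/eqP; rewrite eq_complex; apply/andP; split; apply/eqP.
- exact: (cvg_unique _ LR hR).
- exact: (cvg_unique _ LI hI).
Qed.

End Inversion.

(** * Nets and weights *)

Section Nets.
Variable R : realType.
Local Notation C := R[i].
Variable p : nat.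
Implicit Types (u v : net R p) (w : eps01 R -> R) (z : 'rV[R]_p).

Lemma scale_addr0 (c : C) (f : 'rV[R]_p -> C) : (fun x => c * f x) = c *: f + 0.
Proof. by rewrite addr0. Qed.

Lemma smoothZ (c : C) (f : 'rV[R]_p -> C) : smooth f -> smooth (fun x => c * f x).
Proof. by move=> sf; rewrite scale_addr0; exact: (smoothZD c sf (@smooth0 R p)). Qed.

Lemma mderivZ (b : multiindex p) (c : C) (f : 'rV[R]_p -> C) x : smooth f ->
  mderiv b (fun x => c * f x) x = c * mderiv b f x.
Proof.
move=> sf; rewrite scale_addr0 (mderivZD b c x sf (@smooth0 R p)).
by rewrite mderiv0 addr0.
Qed.

Definition weighted w u : eps01 R -> 'rV[R]_p -> C := fun e x => (w e)%:C * u e x.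

Lemma mderiv_weighted b w u e x : smooth_net u ->
  mderiv b (weighted w u e) x = (w e)%:C * mderiv b (u e) x.
Proof. by move=> su; exact: mderivZ. Qed.

Lemma bddS_weighted w u : (forall e, 0 < w e) -> smooth_net u ->
  (forall a b : multiindex p,
    sup_finite w (fun e x => (monomial x a)%:C * mderiv b (u e) x)) ->
  bddS (weighted w u).
Proof.
move=> w0 su uM; apply: bddS_seminorms => [e|a b]; first exact: smoothZ.
have /(sup_finiteP _ w0)[M hM] := uM a b; exists M => e x.
have := hM e x; rewrite mderiv_weighted// (mulrCA _ (w e)%:C) (normcM (w e)%:C).
by rewrite (normc_real (w e)) (ger0_norm (ltW (w0 e))).
Qed.

Lemma weighted_bddS w u : (forall e, 0 < w e) -> bddS (weighted w u) ->
  smooth_net u /\ forall a b : multiindex p,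
    sup_finite w (fun e x => (monomial x a)%:C * mderiv b (u e) x).
Proof.
move=> w0 bu.
have wV e : ((w e)^-1)%:C * (w e)%:C = 1 :> C.
  by rewrite -rmorphM mulVf ?gt_eqF.
have uE e : u e = fun x => ((w e)^-1)%:C * weighted w u e x.
  by apply/funext => x; rewrite /weighted mulrA wV mul1r.
have su : smooth_net u by move=> e; rewrite uE; apply: smoothZ; exact: bddS_smooth.
split=> // a b; apply/(sup_finiteP _ w0).
have [M M0 hM] := bddS_monomial a b bu; exists M => e x.
have := hM e x; rewrite mderiv_weighted// (mulrCA _ (w e)%:C) (normcM (w e)%:C).
by rewrite (normc_real (w e)) (ger0_norm (ltW (w0 e))).
Qed.

(** In an S-regular net the power N is the same for all seminorms. This is what makes the weighted
    net one bounded family, with eps as its index. *)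
Lemma regular_bddS u : regular_S u ->
  exists N, bddS (weighted (fun e => sval e ^+ N) u).
Proof.
move=> [su [N hN]]; exists N; apply: bddS_weighted => // e; exact: eps_pow_gt0.
Qed.

Lemma bddS_regular N u : bddS (weighted (fun e => sval e ^+ N) u) -> regular_S u.
Proof.
move=> /weighted_bddS[e|su hu]; first exact: eps_pow_gt0.
by split => //; exists N.
Qed.

Lemma negligible_bddS u : negligible_S u ->
  forall q, bddS (weighted (fun e => sval e ^- q) u).
Proof.
move=> [su hu] q; apply: bddS_weighted => // e; exact: eps_powN_gt0.
Qed.

Lemma bddS_negligible u : (forall q, bddS (weighted (fun e => sval e ^- q) u)) ->
  negligible_S u.
Proof.
move=> bu; have h q := weighted_bddS (eps_powN_gt0 q) (bu q).
by split=> [|a b q]; [case: (h 0%N)|case: (h q)].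
Qed.

Lemma negligible_moderate u : negligible_S u -> moderate_tau u.
Proof.
move=> [su hu]; split => // a; exists 0%N.
have /(sup_finiteP _ (eps_powN_gt0 0))[M hM] := hu [ffun=> 0%N] a 0%N.
apply/(sup_finiteP _ (eps_pow_gt0 0)); exists M => e x.
by have := hM e x; rewrite monomial0 !expr0 !invr1.
Qed.

(** The square of <z>, which is a polynomial whereas <z> is not; it is therefore the form in which
    growth enters [bddS] estimates. *)
Definition jap2 (z : 'rV[R]_p) : R := 1 + \sum_i z 0 i ^+ 2.

Lemma japanese_sqr z : japanese z ^+ 2 = jap2 z.
Proof.
have s0 : 0 <= \sum_i z 0 i ^+ 2 by apply: sumr_ge0 => i _; exact: sqr_ge0.
by rewrite /japanese /enorm !sqr_sqrtr// addr_ge0// sqr_ge0.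
Qed.

Lemma polyfun_jap2 : polyfun jap2.
Proof.
apply: polyfunD; first exact: polyfun_cst.
by apply: polyfun_sum => i; apply: polyfunX; exact: polyfun_coord.
Qed.

Lemma japanese_gt0 z : 0 < japanese z.
Proof. exact: lt_le_trans (japanese_ge1 z). Qed.

Lemma jap2_ge1 z : 1 <= jap2 z.
Proof. by rewrite -japanese_sqr expr_ge1// ?japanese_ge1// ltW// japanese_gt0. Qed.

Lemma coord_japanese z i : `|z 0 i| <= japanese z.
Proof.
rewrite -(@ler_pXn2r _ 2)// ?nnegrE ?(ltW (japanese_gt0 z))//.
rewrite japanese_sqr real_normK ?num_real// /jap2 (bigD1 i)//= addrCA lerDl.
by rewrite addr_ge0// sumr_ge0// => j _; exact: sqr_ge0.
Qed.

Lemma monomial_japanese z a : `|monomial z a| <= japanese z ^+ order_mi a.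
Proof.
rewrite /monomial normr_prod /order_mi -prodrXr.
apply: ler_prod => i _; rewrite normr_ge0 /= normrX.
by rewrite lerXn2r// ?nnegrE// ?coord_japanese// ltW// japanese_gt0.
Qed.

End Nets.

(** * Trading powers of a weight for powers of <z> *)

Section Weights.
Variable R : realType.
Variable p : nat.
Variables (Lambda : 'rV[R]_p -> R) (mu c1 c2 : R).
Hypotheses (mu0 : 0 < mu) (c10 : 0 < c1) (c20 : 0 < c2).
Hypothesis Ll : forall z, japanese z `^ mu <= c1 * Lambda z.
Hypothesis Lu : forall z, Lambda z <= c2 * japanese z.
Implicit Type z : 'rV[R]_p.

Lemma weight_gt0 z : 0 < Lambda z.
Proof.
rewrite -(pmulr_rgt0 _ c10); apply: lt_le_trans (Ll z).
by rewrite powR_gt0// japanese_gt0.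
Qed.

Lemma weight_ge z : c1^-1 * japanese z `^ mu <= Lambda z.
Proof. by rewrite ler_pdivrMl. Qed.

(** Raise the lower bound c1^-1 <z>^mu <= Lambda to the power k / mu: the exponent -k / mu of Lambda
    compensates <z>^k. *)
Lemma weight_decay (k : nat) : exists e C : R, 0 <= C /\
  forall z, japanese z ^+ k * Lambda z `^ e <= C.
Proof.
exists (- (k%:R / mu)), ((c1^-1 `^ (k%:R / mu))^-1); split.
  by rewrite invr_ge0 powR_ge0.
move=> z; have kmu : 0 <= k%:R / mu by rewrite divr_ge0// ltW.
have ci0 : 0 <= c1^-1 by rewrite invr_ge0 ltW.
have L0 := weight_gt0 z; have j0 := japanese_gt0 z.
rewrite powRN ler_pdivrMr ?powR_gt0// ler_pdivlMl; last by rewrite powR_gt0 ?invr_gt0.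
have <- : (japanese z `^ mu) `^ (k%:R / mu) = japanese z ^+ k.
  by rewrite -powRrM mulrC divfK ?gt_eqF// powR_mulrn// ltW.
rewrite -powRM ?powR_ge0//; apply: ge0_ler_powR => //.
- by rewrite nnegrE mulr_ge0// powR_ge0.
- by rewrite nnegrE ltW.
- exact: weight_ge.
Qed.

(** For e >= 0 the weight is bounded below, as <z>^mu >= 1. For e < 0 the upper bound Lambda <= c2
    <z> gives Lambda^(-e) <= c2^(-e) <z>^(-e), and an integer above -e absorbs the last factor. *)
Lemma weight_lower (e : R) : exists (C : R) (k : nat), 0 < C /\
  forall z, 1 <= C * Lambda z `^ e * jap2 z ^+ k.
Proof.
have ci0 : 0 < c1^-1 by rewrite invr_gt0.
have [e0|e0] := leP 0 e.
  exists ((c1^-1 `^ e)^-1), 0%N; split; first by rewrite invr_gt0 powR_gt0.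
  move=> z; have L0 := weight_gt0 z; have j0 := japanese_gt0 z.
  rewrite expr0 mulr1 ler_pdivlMl ?powR_gt0// mulr1.
  apply: ge0_ler_powR => //; rewrite ?nnegrE ?(ltW ci0) ?(ltW L0)//.
  apply: le_trans (weight_ge z); rewrite ler_peMr// ?(ltW ci0)//.
  by rewrite -(powRr0 (japanese z)) ler_powR ?japanese_ge1 ?ltW.
pose k := (Num.truncn (- e)).+1.
have ke : - e <= k%:R by apply/ltW; rewrite /k truncnS_gt.
exists (c2 `^ (- e)), k; split; first by rewrite powR_gt0.
move=> z; have L0 := weight_gt0 z; have j0 := japanese_gt0 z.
have -> : Lambda z `^ e = (Lambda z `^ (- e))^-1 by rewrite -powRN opprK.
rewrite mulrAC ler_pdivlMr ?powR_gt0// mul1r.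
have ne0 : 0 <= - e by rewrite oppr_ge0 ltW.
apply: (@le_trans _ _ ((c2 * japanese z) `^ (- e))).
  apply: ge0_ler_powR => //; rewrite ?nnegrE ?(ltW L0)//.
  by rewrite mulr_ge0// ltW.
rewrite (powRM _ (ltW c20) (ltW j0)); apply: ler_wpM2l; first exact: powR_ge0.
rewrite -japanese_sqr -exprM.
apply: (@le_trans _ _ (japanese z `^ (2 * k)%:R)); last by rewrite powR_mulrn// ltW.
rewrite ler_powR ?japanese_ge1//; apply: le_trans ke _.
by rewrite ler_nat leq_pmull.
Qed.

Lemma smoothing_regular rho (a : net R p) : smoothing_symbol Lambda rho a ->
  regular_S a.
Proof.
move=> [N hN]; split; first by have [] := hN 0.
exists N => al be; apply/(sup_finiteP _ (eps_pow_gt0 N)).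
have [e [K [K0 hK]]] := weight_decay (order_mi al).
(* The order m is chosen so that m - rho |be| is exactly the exponent [e] that compensates the
   monomial. *)
have [_ /(_ be)[c c0 hc]] := hN (e + rho * (order_mi be)%:R).
exists (c * K) => eps z; have := hc eps z; rewrite addrK => {}hc.
have e0 := eps_pow_gt0 N eps.
rewrite normcM normc_real mulrCA.
apply: (@le_trans _ _ (japanese z ^+ order_mi al * (c * Lambda z `^ e))).
  apply: ler_pM => //.
  - by rewrite mulr_ge0 ?normc_nneg// ltW.
  - exact: monomial_japanese.
  - by rewrite mulrC -ler_pdivlMr.
by rewrite mulrCA ler_wpM2l// ltW.
Qed.

(** The required power of the weight dominates a negative power of <z> up to a constant, and the
    derivatives of [a] decay faster than that. The power N comes from regularity alone, hence is the
    same for all m. *)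
Lemma regular_smoothing rho (a : net R p) : regular_S a ->
  smoothing_symbol Lambda rho a.
Proof.
move=> ra; have [sa _] := ra; have [N ba] := regular_bddS ra.
exists N => m; split => // al; set e := m - _.
have [C [k [C0 hC]]] := weight_lower e.
have bd := bddS_partials (flatten [seq nseq (al i) i | i <- enum 'I_p]) ba.
have [M M0 hM] := bddS_polybound (polyfunX k (@polyfun_jap2 R p)) bd.
(* M may be 0; adding 1 makes the constant strictly positive. *)
exists ((M + 1) * C); first by rewrite mulr_gt0// ltr_wpDl.
move=> eps z; have e0 := eps_pow_gt0 N eps.
have := hM eps z; rewrite -/(mderiv al _ z) mderiv_weighted// normcM normc_real.
rewrite (ger0_norm (ltW e0)) ger0_norm ?exprn_ge0 ?(le_trans _ (jap2_ge1 z))//.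
set d := normc _; move=> {}hM; have d0 : 0 <= d by exact: normc_nneg.
rewrite ler_pdivlMr//.
have LC := hC z; set J := jap2 z ^+ k in hM LC; set L := Lambda z `^ e in LC *.
have L0 : 0 <= C * L by rewrite mulr_ge0 ?powR_ge0// ltW.
apply: (@le_trans _ _ (sval eps ^+ N * d * (C * L * J))).
  rewrite mulrC ler_peMr//; by rewrite mulr_ge0// ltW.
have -> : sval eps ^+ N * d * (C * L * J) = (C * L) * (J * (sval eps ^+ N * d)).
  by ring.
have -> : (M + 1) * C * L = (C * L) * (M + 1) by ring.
by apply: ler_wpM2l => //; apply: le_trans hM _; rewrite lerDl.
Qed.

End Weights.

(** * Kernels and symbols *)

Section Mollifier.
Variable R : realType.
Local Notation C := R[i].
Variable n : nat.
Implicit Types (x y z w xi : 'rV[R]_n).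

(** With no left variables, R^(0 + n) is R^n, and the results on partial transforms apply to the
    Fourier transform of [phi]. *)
Lemma row_mx_0l (v : 'rV[R]_0) w : row_mx v w = w.
Proof.
apply/rowP => i; transitivity (row_mx v w 0 (rshift 0 i)); last exact: row_mxEr.
by congr (row_mx v w _ _); apply/val_inj.
Qed.

Lemma rsubmx_0l (X : 'rV[R]_(0 + n)) : rsubmx X = X.
Proof. by apply/rowP => i; rewrite mxE; congr (X _ _); apply/val_inj. Qed.

Variable phi : 'rV[R]_n -> C.
Hypothesis phi_schwartz : schwartz phi.

Lemma schwartz_bddS : @bddS R n unit (fun=> phi).
Proof.
have [sphi hphi] := phi_schwartz.
apply: bddS_seminorms => // a b; have h := hphi a b.
pose S := supnorm (fun x => (monomial x a)%:C * mderiv b phi x).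
have hS x : ((normc ((monomial x a)%:C * mderiv b phi x))%:E <= S)%E.
  by apply: ereal_sup_ubound; exists x.
have Sfin : S \is a fin_num.
  rewrite fin_numE gt_eqF ?lt_eqF//.
  by apply: lt_le_trans (hS 0); rewrite ltNyr.
by exists (fine S) => _ x; rewrite -lee_fin fineK.
Qed.

Lemma fourier_fourier2 : fourier phi = fourier2 (m := 0) (-1) phi.
Proof.
apply/funext => xi; apply: eq_integral_Rn => x.
by rewrite rsubmx_0l row_mx_0l mulN1r dotrvC.
Qed.

Lemma bddS_fourier : @bddS R n unit (fun=> fourier phi).
Proof.
rewrite fourier_fourier2; apply: (@bddS_fourier2 R 0 n).
  by rewrite mulrNN mulr1.
exact: schwartz_bddS.
Qed.

Lemma phase_omega_bounded y : omega_bounded (fun x => cis (- dotrv x y) * phi x).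
Proof.
have [A A0 hA] := @bddS_decay1 R 0 n unit _ schwartz_bddS.
split; last first.
  by exists A => x; rewrite normcM normc_cis mul1r; have := hA tt 0 x; rewrite row_mx_0l.
apply: ccontinuousM; last exact: C1_ccontinuous (bddS_C1 schwartz_bddS tt).
apply: ccontinuous_cis; under eq_fun do rewrite dotrvC -mulN1r.
apply: polyfun_continuous; apply: polyfunM; first exact: polyfun_cst.
exact: dotrv_polyfun.
Qed.

Lemma omega_dilation k x : 1 <= k -> omega (k *: x) <= omega x.
Proof.
move=> k1; apply: ler_prod => i _.
have h0 (a : R) : 0 < 1 + a ^+ 2 by rewrite ltr_wpDr// sqr_ge0.
rewrite invr_ge0 ltW//= lef_pV2 ?posrE// lerD2l mxE exprMn ler_peMl ?sqr_ge0//.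
by rewrite expr_ge1// (le_trans ler01).
Qed.

(** The substitution x = eps x' in the Fourier integral; its Jacobian cancels the normalising factor
    eps^-n. *)
Lemma fourier_mollify (e : eps01 R) y :
  fourier (mollify phi e) y = fourier phi (sval e *: y).
Proof.
case: e => e /= e01; have /andP[e0 e1] := e01; have ei0 : 0 < e^-1 by rewrite invr_gt0.
have := integral_Rn_affine 0 ei0 (phase_omega_bounded (e *: y)).
rewrite invrK => E; transitivity ((e ^- n)%:C *
    ((e ^+ n)%:C * integral_Rn (fun x => cis (- dotrv x (e *: y)) * phi x))).
  rewrite -E -integral_RnZ; last first.
    have [cf [M hM]] := phase_omega_bounded (e *: y).
    split; first exact: ccontinuous_comp (@continuous_affine R n 0 e^-1) cf.
    exists `|M| => x; rewrite add0r; apply: le_trans (hM _) _.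
    apply: (@le_trans _ _ (`|M| * omega (e^-1 *: x))).
      by rewrite ler_wpM2r ?omega_ge0// ler_norm.
    by rewrite ler_wpM2l// omega_dilation// invf_ge1.
  apply: eq_integral_Rn => x; rewrite /mollify /= add0r mulrCA; congr (_ * (cis (- _) * _)).
  by apply: eq_bigr => i _; rewrite !mxE mulrACA mulVf ?mul1r// gt_eqF.
rewrite mulrA -rmorphM mulVf ?mul1r// expf_neq0// gt_eqF//.
Qed.

Lemma moderate_growth (u : net R n) : moderate_tau u -> exists (N k : nat) (A : R),
  0 <= A /\ forall e y, normc (u e y) <= A * sval e ^- N * jap2 y ^+ k.
Proof.
move=> [su /(_ [ffun=> 0%N])[N /(sup_finiteP _ (eps_pow_gt0 N))[M hM]]].
exists N, N, `|M|; split => // e y; have := hM e y.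
have j0 := japanese_gt0 y; have jn0 : 0 < japanese y ^+ N by rewrite exprn_gt0.
rewrite mderiv_nil normcM normc_real ger0_norm ?invr_ge0 ?(ltW jn0)// => {}hM.
have e0 := eps_pow_gt0 N e.
rewrite -[leRHS]mulrA [X in _ * X]mulrC mulrA ler_pdivlMr//.
have {}hM : sval e ^+ N * normc (u e y) <= M * japanese y ^+ N.
  by rewrite -ler_pdivrMr// mulrAC -mulrA.
rewrite mulrC; apply: le_trans hM _; apply: (@le_trans _ _ (`|M| * japanese y ^+ N)).
  by rewrite ler_wpM2r ?ler_norm// ltW.
apply: ler_wpM2l => //; rewrite -japanese_sqr -exprM ler_weXn2l ?japanese_ge1//.
by rewrite leq_pmull.
Qed.

Lemma fourier_bounds k : exists2 M : R, 0 <= M &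
  forall y, jap2 y ^+ k * normc (fourier phi y) <= M * omega y.
Proof.
have [M M0 hM] := @bddS_decay R 0 n unit (fun=> fourier phi)
  (fun y => jap2 y ^+ k) (polyfunX k (@polyfun_jap2 R n)) bddS_fourier.
exists M => // y; have := hM tt 0 y; rewrite row_mx_0l ger0_norm// exprn_ge0//.
exact: le_trans (jap2_ge1 y).
Qed.

Definition cutoff_net (u : net R n) (e : eps01 R) : 'rV[R]_n -> C :=
  fun y => u e y * fourier (mollify phi e) y.

Lemma cutoff_net_continuous u e : smooth_net u -> ccontinuous (cutoff_net u e).
Proof.
move=> su; apply: ccontinuousM; first exact: C1_ccontinuous (smooth_C1 (su e)).
rewrite (funext (fourier_mollify e)).
apply: ccontinuous_comp (C1_ccontinuous (bddS_C1 bddS_fourier tt)).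
exact: continuous_scale.
Qed.

Lemma jap2_dilation (e : R) y : 0 < e -> e <= 1 -> jap2 y <= e ^- 2 * jap2 (e *: y).
Proof.
move=> e0 e1; have e2 : 0 < e ^+ 2 by rewrite exprn_gt0.
rewrite ler_pdivlMl// /jap2 mulrDr mulr1 lerD//; first by rewrite expr_le1// ltW.
by rewrite mulr_sumr ler_sum// => i _; rewrite mxE exprMn.
Qed.

(** For fixed eps, <y>^2 <= eps^-2 <eps y>^2 turns the growth of u_eps into growth in eps y, which
    the rapid decay of hat phi absorbs. The constant depends on eps, which is harmless: the bound
    only serves to justify Fubini and linearity for one eps at a time. *)
Lemma cutoff_net_omega_bounded u e : moderate_tau u ->
  omega_bounded (cutoff_net u e).
Proof.
move=> mu; have [N [k [A [A0 hA]]]] := moderate_growth mu.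
split; first by apply: cutoff_net_continuous; case: mu.
have [M M0 hM] := fourier_bounds k.
have uA := hA e; rewrite /cutoff_net; move: (u e) uA => ue uA.
have e0N := eps_pow_gt0 N e; rewrite (funext (fourier_mollify e)).
case: e uA e0N => e /= /andP[e0 e1] uA e0N.
exists (A * e ^- N * (e ^- 2) ^+ k * M * (e ^- 2) ^+ n) => y.
have AN0 : 0 <= A * e ^- N by rewrite mulr_ge0// invr_ge0 ltW.
have ek0 j : 0 <= (e ^- 2) ^+ j by rewrite exprn_ge0// invr_ge0 exprn_ge0// ltW.
have j1 x : 0 <= jap2 x by apply: le_trans (jap2_ge1 x).
rewrite normcM; set f := normc (fourier phi _).
have f0 : 0 <= f by exact: normc_nneg.
apply: (@le_trans _ _ (A * e ^- N * ((e ^- 2) ^+ k * jap2 (e *: y) ^+ k) * f)).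
  apply: ler_wpM2r => //; apply: le_trans (uA y) _; apply: ler_wpM2l => //.
  by rewrite -exprMn lerXn2r ?nnegrE ?mulr_ge0 ?(ek0 1%N) ?jap2_dilation.
rewrite -!mulrA; do 3 (apply: ler_wpM2l; first by rewrite ?invr_ge0 ?ek0// ltW).
apply: le_trans (hM (e *: y)) _; apply: ler_wpM2l => //.
exact: omega_contraction.
Qed.

(** Here the constants are uniform in eps. The cut-off is merely bounded, so polynomial growth in y
    is left for the kernel to absorb. *)
Lemma cutoff_net_growth u : moderate_tau u -> exists (N k : nat) (A : R),
  forall e y, normc ((sval e ^+ N)%:C * cutoff_net u e y) <= A * jap2 y ^+ k.
Proof.
move=> mu; have [N [k [A [A0 hA]]]] := moderate_growth mu.
have [M M0 hM] := fourier_bounds 0.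
exists N, k, (A * M) => e y; have e0 := eps_pow_gt0 N e.
rewrite normcM normc_real ger0_norm ?(ltW e0)// /cutoff_net fourier_mollify normcM.
have hu : sval e ^+ N * normc (u e y) <= A * jap2 y ^+ k.
  by rewrite -ler_pdivlMl// mulrA (mulrC _ A).
have hf : normc (fourier phi (sval e *: y)) <= M.
  have := hM (sval e *: y); rewrite expr0 mul1r => /le_trans; apply.
  by rewrite ler_piMr// omega_le1.
rewrite mulrA (mulrAC A M); apply: ler_pM => //.
  by rewrite mulr_ge0 ?normc_nneg// ltW.
exact: normc_nneg.
Qed.

End Mollifier.

(** * The correspondence between symbols and kernels *)

Section Operators.
Variable R : realType.
Local Notation C := R[i].
Variable n : nat.
Implicit Types (x y xi w : 'rV[R]_n) (Z : 'rV[R]_(n + n)).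

Lemma dotrvBl x y xi : dotrv (x - y) xi = dotrv x xi - dotrv y xi.
Proof. by rewrite /dotrv -sumrB; apply: eq_bigr => i _; rewrite !mxE mulrBl. Qed.

Definition phase (s : R) Z : R := s * dotrv (lsubmx Z) (rsubmx Z).

Lemma polyfun_phase s : polyfun (phase s).
Proof.
apply: polyfunM; first exact: polyfun_cst.
apply: polyfun_sum => i; apply: polyfunM.
  by under eq_fun do rewrite mxE; exact: polyfun_coord.
by under eq_fun do rewrite mxE; exact: polyfun_coord.
Qed.

(** The kernel of the operator with symbol [a], without the factor (2 pi)^-n: the exponential e^(i x
    xi) is applied before the transform from xi to y. [kernel_symbol] undoes the two operations in
    the opposite order. *)
Definition symbol_kernel (a : 'rV[R]_(n + n) -> C) : 'rV[R]_(n + n) -> C :=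
  fourier2 (-1) (fun Z => cis (phase 1 Z) * a Z).

Definition kernel_symbol (k : 'rV[R]_(n + n) -> C) : 'rV[R]_(n + n) -> C :=
  fun Z => cis (phase (-1) Z) * fourier2 1 k Z.

Lemma bddS_symbol_kernel (I : Type) (u : I -> 'rV[R]_(n + n) -> C) : bddS u ->
  bddS (fun k => symbol_kernel (u k)).
Proof.
move=> bu; apply: (@bddS_fourier2 R n n); first by rewrite mulrNN mulr1.
by apply: bddS_cis => //; exact: polyfun_phase.
Qed.

Lemma bddS_kernel_symbol (I : Type) (u : I -> 'rV[R]_(n + n) -> C) : bddS u ->
  bddS (fun k => kernel_symbol (u k)).
Proof.
move=> bu; apply: bddS_cis; first exact: polyfun_phase.
by apply: (@bddS_fourier2 R n n) => //; rewrite mulr1.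
Qed.

Lemma fourier2_scale (I : Type) (u : I -> 'rV[R]_(n + n) -> C) k s (c : C) :
  s * s = 1 -> bddS u ->
  fourier2 s (fun Z => c * u k Z) = fun Z => c * fourier2 s (u k) Z.
Proof.
move=> ss1 bu; apply/funext => Z; rewrite /fourier2 -integral_RnZ.
  by apply: eq_integral_Rn => w; rewrite mulrCA.
exact: (@fourier2_omega_bounded R n n s _ u k Z bu).
Qed.

Lemma symbol_kernelE a x y : symbol_kernel a (row_mx x y) =
  integral_Rn (fun xi => cis (dotrv (x - y) xi) * a (row_mx x xi)).
Proof.
apply: eq_integral_Rn => xi; rewrite row_mxKl row_mxKr /phase row_mxKl row_mxKr.
by rewrite mul1r mulrA -cisD mulN1r dotrvBl addrC.
Qed.

(** The factor e^(-i x xi) in [kernel_symbol] cancels e^(i x xi), and what remains is Fourier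
    inversion at y, with x as a parameter and s = -1. *)
Lemma kernel_symbolK k x y : @bddS R (n + n) unit (fun=> k) ->
  integral_Rn (fun xi => cis (dotrv (x - y) xi) * kernel_symbol k (row_mx x xi)) =
  ((2 * pi) ^+ n)%:C * k (row_mx x y).
Proof.
move=> bk; have bF : @bddS R (n + n) unit (fun=> fourier2 1 k).
  by apply: (@bddS_fourier2 R n n 1 _ unit (fun=> k)); rewrite ?mulr1.
have [A A0 hA] := bddS_decay1 bk; have [B B0 hB] := bddS_decay1 bF.
have crow (f : 'rV[R]_(n + n) -> C) : ccontinuous f -> ccontinuous (fun w => f (row_mx x w)).
  move=> cf; apply: ccontinuous_comp cf.
  by apply: continuous_row_mx; [exact: cst_continuous|move=> z; exact: cvg_id].
have ok : omega_bounded (fun w => k (row_mx x w)).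
  split; first exact: crow (C1_ccontinuous (bddS_C1 bk tt)).
  by exists A => w; exact: (hA tt).
have FE xi : integral_Rn (fun w => cis (- -1 * dotrv xi w) * k (row_mx x w)) =
    fourier2 1 k (row_mx x xi).
  by apply: eq_integral_Rn => w; rewrite row_mxKl row_mxKr opprK.
have oF : omega_bounded (fun xi =>
    integral_Rn (fun w => cis (- -1 * dotrv xi w) * k (row_mx x w))).
  rewrite (funext FE); split; first exact: crow (C1_ccontinuous (bddS_C1 bF tt)).
  by exists B => w; exact: (hB tt).
have ss1 : (-1 : R) * (-1) = 1 by rewrite mulrNN mulr1.
have <- := @fourier_inversion R n (-1) (fun w => k (row_mx x w)) y ss1 ok oF.
apply: eq_integral_Rn => xi; rewrite FE /kernel_symbol /phase row_mxKl row_mxKr.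
by rewrite mulrA -cisD dotrvBl !mulN1r (dotrvC xi) addrAC subrr add0r.
Qed.

(** Fubini with a product majorant: [g] is responsible for the decay in y, and the symbol for the
    decay in xi. *)
Lemma integral_symbolE a g x : @bddS R (n + n) unit (fun=> a) -> omega_bounded g ->
  integral_RnRn (fun y xi => cis (dotrv (x - y) xi) * a (row_mx x xi) * g y) =
  integral_Rn (fun y =>
    integral_Rn (fun xi => cis (dotrv (x - y) xi) * a (row_mx x xi)) * g y).
Proof.
move=> ba [cg [B0 gB0]].
have [B [B1 gB]] : exists B, 0 <= B /\ forall y, normc (g y) <= B * omega y.
  exists `|B0|; split=> // y; apply: le_trans (gB0 y) _.
  by rewrite ler_wpM2r ?omega_ge0// ler_norm.
have [A A0 hA] := bddS_decay1 ba; have ca := C1_ccontinuous (bddS_C1 ba tt).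
have arow : ccontinuous (fun xi => a (row_mx x xi)).
  apply: ccontinuous_comp ca.
  by apply: continuous_row_mx; [exact: cst_continuous|move=> z; exact: cvg_id].
have io y : omega_bounded (fun xi => cis (dotrv (x - y) xi) * a (row_mx x xi)).
  split; last by exists A => xi; rewrite normcM normc_cis mul1r; exact: (hA tt).
  by apply: ccontinuousM => //; exact/ccontinuous_cis/polyfun_continuous/dotrv_polyfun.
have [] := @integral_Rn_fubini R n B A
  (fun y xi => cis (dotrv (x - y) xi) * a (row_mx x xi) * g y) _ _ B1 A0.
- have cl := @continuous_lsubmx R 1 n n; have cr := @continuous_rsubmx R 1 n n.
  apply: ccontinuousM; last exact: (ccontinuous_comp cl cg).
  apply: ccontinuousM; last exact: (ccontinuous_comp cr arow).
  apply: ccontinuous_cis; apply: continuous_sum => i; apply: continuous_rmul.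
    under eq_fun do rewrite !mxE; apply: continuous_rsub; first exact: cst_continuous.
    exact: continuous_coord.
  by under eq_fun do rewrite mxE; exact: continuous_coord.
- move=> y xi; rewrite !normcM normc_cis mul1r mulrC.
  by apply: ler_pM; rewrite ?normc_nneg//; exact: (hA tt).
move=> <- _; apply: eq_integral_Rn => y; rewrite mulrC -integral_RnZ//.
by apply: eq_integral_Rn => xi; rewrite mulrC.
Qed.

Lemma row_mul_omega_bounded f g x : @bddS R (n + n) unit (fun=> f) ->
  omega_bounded g -> omega_bounded (fun y => f (row_mx x y) * g y).
Proof.
move=> bf [cg [B hB]]; have [A A0 hA] := bddS_decay1 bf; split.
  apply: ccontinuousM => //; apply: ccontinuous_comp (C1_ccontinuous (bddS_C1 bf tt)).
  by apply: continuous_row_mx; [exact: cst_continuous|move=> z; exact: cvg_id].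
exists (A * B) => y; rewrite normcM -mulrA; apply: ler_pM; rewrite ?normc_nneg//.
by apply: le_trans (hA tt x y) _; rewrite ler_piMr// omega_le1.
Qed.

Variable phi : 'rV[R]_n -> C.
Hypothesis phi_schwartz : schwartz phi.

(** For a single eps the weight is a nonzero constant and can be divided out. *)
Lemma unweight (N : nat) (a : net R (n + n)) e :
  bddS (weighted (fun e => sval e ^+ N) a) -> @bddS R (n + n) unit (fun=> a e).
Proof.
move=> ba; have e0 := eps_pow_gt0 N e.
have h := bddSZ (c := fun=> (sval e ^- N)%:C) (K := normc (sval e ^- N)%:C)
  (fun _ => lexx _) (bddS_reindex (fun=> e : eps01 R) (J := unit) ba).
move: h; congr bddS; apply/funext => _; apply/funext => Z.
by rewrite /weighted mulrA -rmorphM mulVf ?mul1r// gt_eqF.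
Qed.

Lemma psdo_netE (N : nat) (a : net R (n + n)) (u : net R n) e x :
  bddS (weighted (fun e => sval e ^+ N) a) -> moderate_tau u ->
  psdo_net phi a u e x = ((2 * pi) ^- n)%:C * integral_Rn (fun y =>
    integral_Rn (fun xi => cis (dotrv (x - y) xi) * a e (row_mx x xi)) *
    cutoff_net phi u e y).
Proof.
move=> ba mu; rewrite /psdo_net -integral_symbolE; first last.
- exact: cutoff_net_omega_bounded.
- exact: unweight ba.
congr (_ * _); apply: eq_cintegral => -[t1 t2] /=.
by rewrite /cutoff_net mulrA.
Qed.

Lemma kernel_netE (k : net R (n + n)) (u : net R n) e x :
  kernel_net phi k u e x = kernel_op (k e) (cutoff_net phi u e) x.
Proof. by apply: eq_integral_Rn => y; rewrite /cutoff_net mulrA. Qed.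

Lemma twopi_neq0 : (2 * pi : R) ^+ n != 0.
Proof. by rewrite expf_neq0// mulf_neq0// gt_eqF// pi_gt0. Qed.

Lemma kernel_as_psdo (k : net R (n + n)) : regular_S k ->
  let a : net R (n + n) := fun e => kernel_symbol (k e) in
  regular_S a /\ forall u, moderate_tau u -> psdo_net phi a u = kernel_net phi k u.
Proof.
move=> /regular_bddS[N bk] a.
have ba : bddS (weighted (fun e => sval e ^+ N) a).
  have := bddS_kernel_symbol bk; congr bddS; apply/funext => e.
  rewrite /weighted /kernel_symbol.
  rewrite (@fourier2_scale unit (fun=> k e) tt 1 (sval e ^+ N)%:C) ?mulr1//; last first.
    exact: unweight bk.
  by apply/funext => Z; rewrite mulrCA.
split; first exact: bddS_regular ba.
move=> u mu; apply/funext => e; apply/funext => x.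
rewrite (psdo_netE e x ba mu) kernel_netE.
have ko := row_mul_omega_bounded x (unweight e bk) (cutoff_net_omega_bounded phi_schwartz e mu).
rewrite -integral_RnZ; last first.
  have -> : (fun y => integral_Rn (fun xi => cis (dotrv (x - y) xi) * a e (row_mx x xi)) *
      cutoff_net phi u e y) = (fun y => ((2 * pi) ^+ n)%:C *
      (k e (row_mx x y) * cutoff_net phi u e y)).
    by apply/funext => y; rewrite kernel_symbolK ?mulrA//; exact: unweight bk.
  exact: omega_boundedZ.
apply: eq_integral_Rn => y; rewrite kernel_symbolK; last exact: unweight bk.
by rewrite !mulrA -rmorphM mulVf ?mul1r// twopi_neq0.
Qed.

Lemma psdo_as_kernel (a : net R (n + n)) : regular_S a ->
  let k : net R (n + n) := fun e Z => ((2 * pi) ^- n)%:C * symbol_kernel (a e) Z in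
  regular_S k /\ forall u, moderate_tau u -> psdo_net phi a u = kernel_net phi k u.
Proof.
move=> /regular_bddS[N ba] k.
have bk : bddS (weighted (fun e => sval e ^+ N) k).
  have h := bddSZ (c := fun=> ((2 * pi) ^- n)%:C) (K := normc ((2 * pi) ^- n)%:C)
    (fun _ => lexx _) (bddS_symbol_kernel ba).
  move: h; congr bddS; apply/funext => e; apply/funext => Z.
  rewrite /weighted /symbol_kernel /k mulrCA; congr (_ * _).
  rewrite (_ : (fun Z => _) = (fun Z => (sval e ^+ N)%:C * (cis (phase 1 Z) * a e Z))); last first.
    by apply/funext => Z'; rewrite mulrCA.
  rewrite (@fourier2_scale unit (fun _ Z => cis (phase 1 Z) * a e Z) tt (-1))//.
    by rewrite mulrNN mulr1.
  by apply: bddS_cis; [exact: polyfun_phase|exact: unweight ba].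
split; first exact: bddS_regular bk.
move=> u mu; apply/funext => e; apply/funext => x.
have bs : @bddS R (n + n) unit (fun=> symbol_kernel (a e)).
  exact: (bddS_symbol_kernel (unweight e ba)).
have so := cutoff_net_omega_bounded phi_schwartz e mu.
have E : integral_Rn (fun y =>
      integral_Rn (fun xi => cis (dotrv (x - y) xi) * a e (row_mx x xi)) *
      cutoff_net phi u e y) =
    integral_Rn (fun y => symbol_kernel (a e) (row_mx x y) * cutoff_net phi u e y).
  by apply: eq_integral_Rn => y; rewrite symbol_kernelE.
rewrite (psdo_netE e x ba mu) kernel_netE E.
rewrite -(integral_RnZ ((2 * pi) ^- n)%:C (row_mul_omega_bounded x bs so)).
by apply: eq_integral_Rn => y; rewrite mulrA.
Qed.

Lemma kernel_netD (k l : net R (n + n)) (u : net R n) : regular_S k ->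
  regular_S l -> moderate_tau u ->
  kernel_net phi (k + l) u = kernel_net phi k u + kernel_net phi l u.
Proof.
move=> /regular_bddS[N bk] /regular_bddS[M bl] mu.
apply/funext => e; apply/funext => x.
have so := cutoff_net_omega_bounded phi_schwartz e mu.
transitivity (kernel_net phi k u e x + kernel_net phi l u e x); last by [].
rewrite !kernel_netE /kernel_op -integral_RnD.
- by apply: eq_integral_Rn => y; rewrite -mulrDl.
- exact: row_mul_omega_bounded (unweight e bk) so.
- exact: row_mul_omega_bounded (unweight e bl) so.
Qed.

Lemma negligible_regular p (u : net R p) : negligible_S u -> regular_S u.
Proof.
move=> /negligible_bddS/(_ 0%N) bu; apply: (@bddS_regular _ _ 0).
by move: bu; congr bddS; apply/funext => e; rewrite /weighted expr0 invr1.
Qed.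

(** The net u_eps(y) hat phi(eps y) costs a factor eps^-N; negligibility of the kernel at order q +
    N pays for it and leaves eps^q. *)
Lemma kernel_net_negligible (k : net R (n + n)) (u : net R n) :
  negligible_S k -> moderate_tau u -> negligible_S (kernel_net phi k u).
Proof.
move=> nk mu; apply: bddS_negligible => q.
have [N [j [A hA]]] := cutoff_net_growth phi_schwartz mu.
pose g e y := (sval e ^+ N)%:C * cutoff_net phi u e y.
have cg e : ccontinuous (g e).
  apply: ccontinuousM; first exact: ccontinuous_cst.
  by apply: cutoff_net_continuous => //; case: mu.
have pr : polyfun (fun y : 'rV[R]_n => A * jap2 y ^+ j).
  by apply: polyfunM; [exact: polyfun_cst|apply: polyfunX; exact: polyfun_jap2].
have := bddS_kernel_op cg pr hA (negligible_bddS nk (q + N)).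
congr bddS; apply/funext => e; apply/funext => x.
have e0 := eps_pow_gt0 N e.
have bke : @bddS R (n + n) unit (fun=> k e).
  have [M bM] := regular_bddS (negligible_regular nk); exact: unweight bM.
have so := cutoff_net_omega_bounded phi_schwartz e mu.
rewrite [RHS]/weighted kernel_netE /kernel_op.
rewrite -(integral_RnZ _ (row_mul_omega_bounded x bke so)).
apply: eq_integral_Rn => y; rewrite /g /weighted.
have -> : (sval e ^- q)%:C = (sval e ^- (q + N))%:C * (sval e ^+ N)%:C :> C.
  by rewrite -rmorphM exprD invfM mulfVK// gt_eqF.
by ring.
Qed.

End Operators.

(** * Representatives and classes *)

Section Quotients.
Variable R : realType.
Local Notation C := R[i].

Lemma rep_moderate p (u : net R p) (U : G_tauS R p) : rep_tauS u U -> moderate_tau u.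
Proof. by move=> [v <- _]; have /asboolP := valP v. Qed.

Lemma repinf_regular p (k : net R p) (K : Ginf_S R p) : repinf_S k K -> regular_S k.
Proof. by move=> [v <- _]; have /asboolP := valP v. Qed.

Lemma repinf_exists p (K : Ginf_S R p) : exists k : net R p, repinf_S k K.
Proof. by exists (val (repr K)); exists (repr K) => //; exact: reprK. Qed.

Lemma regular_repinf p (k : net R p) : regular_S k ->
  exists K : Ginf_S R p, repinf_S k K.
Proof.
move=> rk; have mk : k \in @regular_S_pred R p by apply/asboolP.
exists (\pi_(subquot (@regular_S_pred R p) (@negligible_S_pred R p)) (Subm mk)).
by exists (Subm mk).
Qed.

Lemma repinf_negligible p (k l : net R p) (K : Ginf_S R p) :
  repinf_S k K -> repinf_S l K -> negligible_S (k - l).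
Proof.
move=> [v <- <-] [w <- /esym/subquot_eqP]; by rewrite inE raddfB.
Qed.

(** Negligible nets are moderate, so the sum stays among the admissible representatives of the same
    class. *)
Lemma rep_tauSD p (u v : net R p) (U : G_tauS R p) :
  rep_tauS u U -> negligible_S v -> rep_tauS (u + v) U.
Proof.
move=> [w <- <-] nv.
have mv : v \in @moderate_tau_pred R p by apply/asboolP; exact: negligible_moderate.
exists (w + Subm mv); first by rewrite raddfD.
apply/subquot_eqP; by rewrite addrAC subrr add0r inE.
Qed.

End Quotients.

Theorem proposition5p5 (R : realType) (n : nat) (n_gt0 : (0 < n)%N)
  (phi : 'rV[R]_n -> R[i]) (phi_mollifier : mollifier phi)
  (Lambda : 'rV[R]_(n + n) -> R) (Lambda_weight : weight_function Lambda)
  (rho : R) (rho_gt0 : 0 < rho) (rho_le1 : rho <= 1)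
  (A : {linear G_tauS R n -> G_tauS R n}) :
  S_regular_kernel phi A <-> psdo_smoothing phi Lambda rho A.
Proof.
have [sphi _ _] := phi_mollifier.
have [_ [mu [mu0 [c1 c10 h1] [c2 c20 h2] _]] _] := Lambda_weight.
have Ll z := h1 z I; have Lu z := h2 z I.
split.
(* One representative of the kernel suffices to define the symbol, since the resulting operator is
   the same net. *)
- move=> [K hK]; have [k kK] := repinf_exists K.
  have [ra aE] := kernel_as_psdo sphi (repinf_regular kK).
  exists (fun e => kernel_symbol (k e)); split.
    exact: (regular_smoothing mu0 c10 c20 Ll Lu).
  by move=> U u uU; rewrite aE; [exact: hK|exact: rep_moderate uU].
- move=> [a [sa ha]].
  have [rk kE] := psdo_as_kernel sphi (smoothing_regular mu0 c10 Ll sa).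
  set k := fun e Z => _ in rk kE; have [K kK] := regular_repinf rk.
  exists K => l lK U u uU; have mu' := rep_moderate uU.
  have nd := repinf_negligible lK kK.
  (* An arbitrary representative [l] of the class differs from the explicit kernel [k] by a
     negligible net, whose contribution does not change the class of the result. *)
  have -> : l = k + (l - k) by rewrite addrC subrK.
  rewrite (kernel_netD sphi rk (negligible_regular nd) mu') -kE//.
  apply: rep_tauSD; first exact: ha.
  exact: kernel_net_negligible.
Qed.
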